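(* Assume Mutual Locality, Commutativity, Symmetry, that the $q_{i,j}$ ($1\le i\le L+1$, $1\le j\le L$) are distinct, and that $\left|q_{j+1,j}/q_{j,j}\right|\ne 1$ ($1\le j\le L$) and $-1<A_{k,k+1}(0)<0$ ($1\le k\le L-1$). Then, up to the three freedoms (rearranging indices, scaling variables, scaling free fields), the parameters $p_{i,j},q_{i,j},A_{i,j}(m),s_j(m),\lambda_{i,j}(m),g_i$ and the currents $B_j(z)$ are uniquely determined as follows. Conversely, by choosing these parameters, Mutual Locality, Commutativity and Symmetry are satisfied. (1) $q_{j,j}=x^{D(1,j-1;\Phi)}$, $q_{j+1,j}=x^{2r+D(1,j-1;\Phi)}$ ($1\le j\le L$); $p_{1,1}=x^{2}$ if $1\in\widehat I(-\frac1r)$, $p_{1,1}=x^{2r-2}$ if $1\in\widehat I(\frac{1-r}r)$; for $2\le j\le L$: $p_{j,j}=x^{D(1,j-2;\Phi)}x^{r+1}$ if $j\in\widehat I(-\frac1r)$, $p_{j,j}=x^{D(1,j-2;\Phi)}x^{2r-1}$ if $j\in\widehat I(\frac{1-r}r)$; for $2\le j\le L+1$: $p_{j,j-1}=x^{D(1,j-2;\Phi)}x^{2r-2}$ if $j\in\widehat I(-\frac1r)$, $p_{j,j-1}=x^{D(1,j-2;\Phi)}x^{2}$ if $j\in\widehat I(\frac{1-r}r)$; $p_{k,l}=q_{k,l}$ for $k\ne l,l+1$, $1\le k\le L+1$, $1\le l\le L$. (2) For $m>0$, $1\le j\le L$: $s_j(m)=1$, and $$s_j(-m)=\begin{cases}-1&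 j\in\widehat J,\\ -\dfrac{[m]_x[2(r-1)m]_x}{[rm]_x[(r-1)m]_x}& j\notin\widehat J,\ j\in\widehat I(-\frac1r),\\ -\dfrac{[(r-1)m]_x[2m]_x}{[rm]_x[m]_x}& j\notin\widehat J,\ j\in\widehat I(\frac{1-r}r).\end{cases}$$ (3) For $1\le i\le L+1$: $A_{i,i}(0)=1$ if $i\in\widehat J$; $A_{i,i}(0)=\frac2r$ if $i\notin\widehat J$, $i\in\widehat I(-\frac1r)$; $A_{i,i}(0)=\frac{2(r-1)}r$ if $i\notin\widehat J$, $i\in\widehat I(\frac{1-r}r)$. For $1\le j\le L+1$: $A_{j-1,j}(0)=A_{j,j-1}(0)=-\frac1r$ if $j\in\widehat I(-\frac1r)$ and $=\frac{1-r}r$ if $j\in\widehat I(\frac{1-r}r)$. $A_{k,l}(0)=A_{l,k}(0)=0$ if $|k-l|\ge2$, $1\le k<l\le L$, or $k=0$, $l\ne0,1,L$. (4) $A_{j,j}(m)=1$ ($m\ne0$, $1\le j\le L$); $A_{k,l}(m)=0$ ($m\ne0$, $|k-l|\ge2$, $1\le k,l\le L$); for $2\le j\le L$, $$A_{j-1,j}(m)=c_j(m)\times\begin{cases}1/s_j(-m)&(m>0),\\ 1/s_{j-1}(m)&(m<0),\end{cases}\qquad c_j(m)=\begin{cases}\dfrac{[m]_x}{[rm]_x}& j\in\widehat I(-\frac1r),\\[2mm] \dfrac{[(r-1)m]_x}{[rm]_x}& j\in\widehat I(\frac{1-r}r),\end{cases}$$ and $A_{j-1,j}(-m)=A_{j,j-1}(m)$,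 $A_{j,j-1}(-m)=A_{j-1,j}(m)$ ($m>0$, $2\le j\le L$). (5) For $1\le i\le L+1$, $$\lambda_{i,j}(0)=\frac{2r\log x}{D(0,L;\Phi)}\times\begin{cases}D(0,j-1;\Phi)&(1\le j\le i-1),\\ -D(j,L;\Phi)&(i\le j\le L),\end{cases}$$ and for $m\ne0$, $$\frac{\lambda_{i,j}(m)}{s_j(m)}=\frac{[rm]_x(x-x^{-1})}{[D(0,L;\Phi)m]_x}\times\begin{cases}-x^{(r+D(1,L;\Phi))m}[D(0,j-1;\Phi)m]_x&(1\le j\le i-1),\\ x^{(r-D(0,0;\Phi))m}[D(j,L;\Phi)m]_x&(i\le j\le L).\end{cases}$$ (6) For $1\le i\le L+1$, $g_i=g\,[r-1]_x$ if $i\in\widehat I(-\frac1r)$ and $g_i=g$ if $i\in\widehat I(\frac{1-r}r)$, with a common constant $g$. (7) $B_j(z)=g_j\left(\frac{q_{j,j}}{p_{j,j}}-1\right):\Lambda_j(z)S_j(q_{j,j}^{-1}z):$ ($1\le j\le L$).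
   Context: Fix integers $M,N\ge0$ with $M+N\ge1$ and put $L=M+N+1$. Heisenberg algebra: generators $a_i(m),Q_i$ ($m\in\mathbf Z$, $1\le i\le L$), relations $[a_i(m),a_j(n)]=\frac1m A_{i,j}(m)\delta_{m+n,0}$ ($m,n\ne0$), $[a_i(0),Q_j]=A_{i,j}(0)$, all other commutators zero. The parameters $A_{i,j}(m)\in\mathbf C$ satisfy $A_{i,i}(m)=1$ ($m\ne0$), $A_{i,j}(m)=A_{j,i}(-m)$ ($m\in\mathbf Z$, $i\ne j$), $\det(A_{i,j}(m))_{i,j=1}^L\ne0$ ($m\in\mathbf Z$). Normal ordering $:\ :$ puts $a_i(m)$ with $m<0$ to the left of those with $m\ge0$, and $Q_j$ to the left of $a_i(0)$. Vertex operators (on Fock space), with parameters $\lambda_{i,j}(m),s_j(m),g_i$: $\Lambda_i(z)=e^{\sum_{j=1}^L\lambda_{i,j}(0)a_j(0)}:\exp\big(\sum_{j=1}^L\sum_{m\ne0}\lambda_{i,j}(m)a_j(m)z^{-m}\big):$ ($1\le i\le L+1$), $T_1(z)=\sum_{i=1}^{L+1}g_i\Lambda_i(z)$, $S_j(w)=w^{\frac12A_{j,j}(0)}e^{Q_j}w^{a_j(0)}:\exp\big(\sum_{m\ne0}s_j(m)a_j(m)w^{-m}\big):$ ($1\le j\le L$), and $\widetilde S_j(w)=e^{-Q_j}S_j(w)$. For vertex operators $V,W$ write $V(z)W(w)=\varphi_{V,W}(z,w):V(z)W(w):$ for $|z|\gg|w|$. $V(z)$ and $W(w)$ are mutually local if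 $\varphi_{V,W}(z,w)$ and $\varphi_{W,V}(w,z)$ converge to rational functions and these are equal. $\delta(z)=\sum_{m\in\mathbf Z}z^m$. Mutual Locality: $\Lambda_i(z)$ and $S_j(w)$ are mutually local and, for nonzero $p_{i,j},q_{i,j}$ (possibly $p_{i,j}=q_{i,j}$), $\varphi_{\Lambda_i,S_j}(z,w)=\varphi_{S_j,\Lambda_i}(w,z)=\dfrac{w-z/p_{i,j}}{w-z/q_{i,j}}$ ($1\le i\le L+1$, $1\le j\le L$). Commutativity: $[T_1(z),S_j(w)]=B_j(z)\big(\delta(q_{j,j}w/z)-\delta(q_{j+1,j}w/z)\big)$ ($1\le j\le L$) with some currents $B_j(z)$. Symmetry: $\varphi_{\widetilde S_k,\widetilde S_l}(w,z)=\varphi_{\widetilde S_l,\widetilde S_k}(w,z)$ ($1\le k,l\le L$), and $\varphi_{\widetilde S_k,\widetilde S_l}(w,z)=1$ if $|k-l|\ge2$. Freedoms. Rearranging indices: $\Lambda_i\mapsto\Lambda_{i'}$, $S_j\mapsto S_{j'}$. Scaling variables: $\lambda_{i,j}(m)\mapsto s^m\lambda_{i,j}(m)$ ($m\neq 0$), $q_{i,j}\mapsto sq_{i,j}$, $p_{i,j}\mapsto sp_{i,j}$. Scaling free fields: for $m\ne0$, $a_j(m)\mapsto\alpha_j(m)^{-1}a_j(m)$, $s_j(m)\mapsto\alpha_j(m)s_j(m)$, $\lambda_{i,j}(m)\mapsto\lambda_{i,j}(m)\alpha_j(m)$, $A_{i,j}(m)\mapsto\alpha_i(m)^{-1}A_{i,j}(m)\alpha_j(m)$,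 where $\alpha_j(m)\ne0$ and $\alpha_j(-m)=\alpha_j(m)^{-1}$ ($m>0$). Extended matrix and parameters $r,x$. A nonempty set $\{j_1<\dots<j_K\}\subset\{1,\dots,L\}$ is fixed and it is assumed that $A_{j,j}(0)=1$ exactly for $j\in\{j_1,\dots,j_K\}$. Extend the symmetric matrix $(A_{i,j}(0))_{i,j=1}^L$ to a symmetric matrix $(A_{i,j}(0))_{i,j=0}^L$ by: $A_{0,1}(0)=A_{1,2}(0)$ if $j_1\ne1$, $=-1-A_{1,2}(0)$ if $j_1=1$; $A_{0,L}(0)=A_{L,L-1}(0)$ if $j_K\ne L$, $=-1-A_{L,L-1}(0)$ if $j_K=L$; $A_{0,0}(0)=-2A_{0,L}(0)$ if $K$ is even, $=1$ if $K$ is odd; $A_{0,i}(0)=0$ for $i\ne0,1,L$. Subscripts of $A_{i,j}(0)$ are read modulo $L+1$. Put $\widehat J=\{j_1,\dots,j_K\}$ if $K$ is even, $\widehat J=\{j_1,\dots,j_K,L+1\}$ if $K$ is odd; $\widehat I(\delta)=\{1\le j\le L+1: A_{j-1,j}(0)=\delta\}$; $\beta=A_{1,2}(0)$. Define $r=\frac1{1+\beta}$ if $|\widehat I(\beta)|>|\widehat I(-1-\beta)|$ and $r=-\frac1\beta$ if $|\widehat I(\beta)|\le|\widehat I(-1-\beta)|$, and $x$ by $x^{2r}=q_{2,1}/q_{1,1}$; one restricts to $0<|x|<1$, $r>1$. Under the assumptions of the theorem $\widehat I(-\frac1r)\cup\widehat I(\frac{1-r}r)=\{1,\dots,L+1\}$.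 The symbol $\Phi$ denotes the (Dynkin) data $(A_{i,j}(0))$, and $D(k,l;\Phi)=(r-1)\,\#\{j\in\widehat I(-\frac1r):k+1\le j\le l+1\}+\#\{j\in\widehat I(\frac{1-r}r):k+1\le j\le l+1\}$ for $0\le k\le l\le L$, and $D(k,l;\Phi)=0$ for $0\le l<k\le L$. $[u]_x=(x^u-x^{-u})/(x-x^{-1})$.
   Formalization: Assumes nonzero currents B_j and compatible branches of the logarithms of p_{i,j}, q_{i,j} (also fixing λ_{i,j}(0)); D counts each index once when r=2; the converse assumes A_{j,j+1}(0)=A_{j-1,j}(0) for j∉Ĵ and -1-A_{j-1,j}(0) for j∈Ĵ (1≤j≤L). *)

(* Defs.v *)
From HB Require Import structures.
From mathcomp Require Import all_boot all_order all_algebra all_fingroup.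
From mathcomp Require Import complex finmap.
From mathcomp.multinomials Require Import monalg.
From mathcomp Require Import all_classical all_reals all_analysis.

Set Implicit Arguments.
Unset Strict Implicit.
Unset Printing Implicit Defensive.

Import Order.TTheory GRing.Theory Num.Theory.
Import numFieldNormedType.Exports.

Local Open Scope classical_set_scope.
Local Open Scope ring_scope.

(* Conventions.  [n = M + N], so that [L = n.+1].  Free fields and screening   *)
(* currents are indexed by ['I_n.+1], the summands of [T_1] by ['I_n.+2].      *)
(* Formulas are written with the usual 1-based indices, converted by [ix].     *)

Definition ix {n : nat} (k : nat) : 'I_n.+1 := inord k.-1.

Definition cexp {R : realType} (z : R[i]) : R[i] :=
  let: Complex a b := z in Complex (expR a * cos b) (expR a * sin b).

(* Polynomials in the commuting variables [y_(j,k)], which stand for           *)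
(* [a_j(-(k+1))]: the common underlying space of all the Fock modules [F_mu],  *)
(* [mu] being the family of eigenvalues of the [a_j(0)].                       *)
Notation fock R n := {malg (R[i])[{cmonom ('I_n.+1 * nat)%type}]}.

Section FockSpace.
Variables (R : realType) (n : nat).
Local Notation C := R[i].
Local Notation I := 'I_n.+1.

Implicit Types (A : I -> I -> int -> C) (mu : I -> C).

Definition heisenberg A : Prop :=
  [/\ forall i (m : int), m != 0 -> A i i m = 1,
      forall i j (m : int), i != j -> A i j m = A j i (- m)
    & forall m : int, \det (\matrix_(i, j) A i j m) != 0].

Definition yvar (x : I * nat) : fock R n := << ucm x >>.

Definition dyvar (x : I * nat) (f : fock R n) : fock R n :=
  \sum_(m <- msupp f) << (m x)%:R * f@_m *g divcm m (ucm x) >>.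

(* The action of [a_j(m)] on [F_mu]. *)
Definition heis A mu (j : I) (m : int) (f : fock R n) : fock R n :=
  match m with
  | Negz k => yvar (j, k) * f
  | Posz 0 => mu j *: f
  | Posz k.+1 => k.+1%:R^-1 *: \sum_(l < n.+1) A j l k.+1%:Z *: dyvar (l, k) f
  end.

(* The coefficient of [t^d] in [exp (\sum_(m >= 1) X_m t^m)].                  *)
Definition exp_coef (X : nat -> fock R n -> fock R n) (d : nat) (f : fock R n) : fock R n :=
  \sum_(k < d.+1) (k`!%:R : C)^-1 *:
    \sum_(t : k.-tuple 'I_d.+1 |
           all (fun m : 'I_d.+1 => 0 < m)%N t && (\sum_(m <- t) m == d)%N)
      foldr (fun m : 'I_d.+1 => X m) f t.

(* The symbol of the vertex operator                                           *)
(*   z^c e^(\sum_j N_j Q_j) e^(\sum_j h_j a_j(0)) z^(\sum_j k_j a_j(0))        *)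
(*     : exp (\sum_j \sum_(m <> 0) v_j(m) a_j(m) z^(-m)) :                     *)
Record vertex := Vertex {
  vcharge : I -> int;       (* N_j *)
  vexp : I -> C;            (* h_j *)
  vpow : I -> C;            (* k_j *)
  vpow0 : C;                (* c *)
  vosc : I -> int -> C      (* v_j(m), used only for m <> 0 *)
}.

Implicit Types V W : vertex.

(* [V] maps [F_mu] to [F_(wshift A V mu)], since [[a_i(0), Q_j] = A_ij(0)].    *)
Definition wshift A V mu : I -> C :=
  fun i => mu i + \sum_(j < n.+1) (vcharge V j)%:~R * A i j 0.

Definition zdeg V mu : C := vpow0 V + \sum_(j < n.+1) vpow V j * mu j.

Definition creat A V mu : nat -> fock R n -> fock R n :=
  exp_coef (fun m f =>
    \sum_(j < n.+1) vosc V j (- m%:Z) *: heis A mu j (- m%:Z) f).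

Definition annih A V mu : nat -> fock R n -> fock R n :=
  exp_coef (fun m f =>
    \sum_(j < n.+1) vosc V j m%:Z *: heis A mu j m%:Z f).

(* The coefficient of [z^e], [e] complex, in [V(z) : F_mu -> F_(mu')].  On a   *)
(* given [f] only finitely many summands are nonzero.                          *)
Definition vmode A V mu (e : C) (f : fock R n) : fock R n :=
  cexp (\sum_(j < n.+1) vexp V j * mu j) *:
  \sum_(t \in [set t : nat * nat | zdeg V mu + t.1%:R - t.2%:R = e])
    creat A V mu t.1 (annih A V mu t.2 f).

(* The coefficient of [z^e w^e'] in [: V(z) W(w) :] on [F_mu].                 *)
Definition nmode A V W mu (e e' : C) (f : fock R n) : fock R n :=
  cexp (\sum_(j < n.+1) (vexp V j + vexp W j) * mu j) *:
  \sum_(t \in [set t : (nat * nat) * (nat * nat) |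
                 zdeg V mu + t.1.1%:R - t.1.2%:R = e /\
                 zdeg W mu + t.2.1%:R - t.2.2%:R = e'])
    creat A V mu t.1.1 (creat A W mu t.2.1
      (annih A V mu t.1.2 (annih A W mu t.2.2 f))).

(* [V(z) W(w) = phi(z,w) : V(z) W(w) :] with                                   *)
(* [phi(z,w) = \sum_(k >= 0) phi_k (w/z)^k].  (In general [phi] also carries a *)
(* power of [z] coming from the zero modes of [V] and [W]; it is trivial for   *)
(* all the pairs considered below.)                                            *)
Definition contraction A V W (phi : nat -> C) : Prop :=
  forall mu e e' f,
    vmode A V (wshift A W mu) e (vmode A W mu e' f) =
    \sum_(k \in [set: nat]) phi k *: nmode A V W mu (e + k%:R) (e' - k%:R) f.

(* [\sum_k phi_k (w/z)^k] converges to [rho z w] for [|z| >> |w|].             *)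
Definition expands_to (phi : nat -> C) (rho : C -> C -> C) : Prop :=
  exists2 eps : C, 0 < eps &
    forall z w : C, z != 0 -> `|w| < eps * `|z| ->
      (series (fun k => phi k * (w / z) ^+ k : C^o)) @ \oo --> (rho z w : C^o).

Definition mutually_local A V W (rho : C -> C -> C) : Prop :=
  exists phi psi : nat -> C,
    [/\ contraction A V W phi, contraction A W V psi,
        expands_to phi rho & expands_to psi (fun w z => rho z w)].

End FockSpace.

Arguments heis {R n}.

(* The numbers [p_ij] and [q_ij] are given through logarithms, so that complex *)
(* powers of them are meaningful.                                              *)
Record params (R : realType) (n : nat) := Params {
  hA : 'I_n.+1 -> 'I_n.+1 -> int -> R[i];
  sS : 'I_n.+1 -> int -> R[i];               (* used only for m <> 0 *)
  lam : 'I_n.+2 -> 'I_n.+1 -> int -> R[i];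
  gT : 'I_n.+2 -> R[i];
  logp : 'I_n.+2 -> 'I_n.+1 -> R[i];
  logq : 'I_n.+2 -> 'I_n.+1 -> R[i]
}.

Section Currents.
Variables (R : realType) (n : nat).
Local Notation C := R[i].
Local Notation I := 'I_n.+1.
Implicit Types (P : params R n) (mu : I -> C) (f : fock R n).

Definition pp P i j : C := cexp (logp P i j).
Definition qq P i j : C := cexp (logq P i j).

Definition Lambda P (i : 'I_n.+2) : vertex R n :=
  {| vcharge := fun=> 0; vexp := fun j => lam P i j 0; vpow := fun=> 0;
     vpow0 := 0; vosc := lam P i |}.

Definition S_ P (j : I) : vertex R n :=
  {| vcharge := fun l => (l == j)%:Z; vexp := fun=> 0;
     vpow := fun l => (l == j)%:R; vpow0 := hA P j j 0 / 2;
     vosc := fun l m => if l == j then sS P j m else 0 |}.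

(* [e^(-Q_j) S_j(w)] *)
Definition St_ P (j : I) : vertex R n :=
  {| vcharge := fun l => vcharge (S_ P j) l - (l == j)%:Z;
     vexp := vexp (S_ P j); vpow := vpow (S_ P j); vpow0 := vpow0 (S_ P j);
     vosc := vosc (S_ P j) |}.

Definition T1mode P mu (e : C) f : fock R n :=
  \sum_(i < n.+2) gT P i *: vmode (hA P) (Lambda P i) mu e f.

(* A family of currents [B_j(z) = \sum_e B_(j,e) z^e] ([e] complex), acting on *)
(* every [F_mu].                                                               *)
Definition currents : Type := I -> (I -> C) -> C -> fock R n -> fock R n.

(* The coefficient of [z^m w^e] in [B(z) delta(q w/z)], with [q = exp l].      *)
(* [S_j(w)] has non-integral powers of [w], so the product is understood       *)
(* through [B(z) delta(q w/z) = B(q w) delta(q w/z)].                          *)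
Definition delta_mul (l : C) (B : (I -> C) -> C -> fock R n -> fock R n)
    mu (m : int) (e : C) f : fock R n :=
  cexp (e * l) *: B mu (m%:~R + e) f.

Definition mutual_locality P : Prop :=
  forall (i : 'I_n.+2) (j : I),
    mutually_local (hA P) (Lambda P i) (S_ P j)
      (fun z w => (w - z / pp P i j) / (w - z / qq P i j)).

(* [T_1(z)] has integral powers of [z] only. *)
Definition commutativity P (B : currents) : Prop :=
  forall j : nat, (1 <= j <= n.+1)%N ->
  forall mu (m : int) (e : C) f,
    T1mode P (wshift (hA P) (S_ P (ix j)) mu) m%:~R
        (vmode (hA P) (S_ P (ix j)) mu e f)
      - vmode (hA P) (S_ P (ix j)) mu e (T1mode P mu m%:~R f)
    = delta_mul (logq P (ix j) (ix j)) (B (ix j)) mu m e f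
      - delta_mul (logq P (ix j.+1) (ix j)) (B (ix j)) mu m e f.

Definition currents_nonzero (B : currents) : Prop :=
  forall j, exists mu e f, B j mu e f != 0.

Definition symmetry P : Prop :=
  (forall k l : I, exists phi,
     contraction (hA P) (St_ P k) (St_ P l) phi /\
     contraction (hA P) (St_ P l) (St_ P k) phi) /\
  (forall k l : I, (k + 2 <= l)%N || (l + 2 <= k)%N ->
     contraction (hA P) (St_ P k) (St_ P l) (fun m => (m == 0%N)%:R)).

(* Compatibility of the determinations of the logarithm: the logarithms of the *)
(* [p_ij] and [q_ij] with [p_ij <> q_ij] are additive on products, they agree  *)
(* when [p_ij = q_ij], and the zero mode factor [exp (\sum_k ...)] of          *)
(* [Lambda_i(z) S_j(w)], which equals [q_ij / p_ij], has the logarithm         *)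
(* [log q_ij - log p_ij].  Automatic when all quantities are real and the      *)
(* [p_ij], [q_ij] positive with real logarithms.                               *)
Definition genuine_log P (u : C) : Prop :=
  exists i j, pp P i j <> qq P i j /\ (u = logp P i j \/ u = logq P i j).

Definition coherent_logs P : Prop :=
  [/\ forall a b c d, genuine_log P a -> genuine_log P b ->
        genuine_log P c -> genuine_log P d ->
        cexp a * cexp b = cexp c * cexp d -> a + b = c + d,
      forall i j, pp P i j = qq P i j -> logp P i j = logq P i j
    & forall i j, \sum_(k < n.+1) lam P i k 0 * hA P k j 0
                  = logq P i j - logp P i j].

Definition rearrange (sigma : {perm 'I_n.+2}) (tau : {perm 'I_n.+1}) P :
    params R n :=
  {| hA := fun i j m => hA P (tau i) (tau j) m;
     sS := fun j m => sS P (tau j) m;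
     lam := fun i j m => lam P (sigma i) (tau j) m;
     gT := fun i => gT P (sigma i);
     logp := fun i j => logp P (sigma i) (tau j);
     logq := fun i j => logq P (sigma i) (tau j) |}.

(* Scaling of variables by [s = exp l]. *)
Definition scale_variables (l : C) P : params R n :=
  {| hA := hA P; sS := sS P;
     lam := fun i j m => cexp l ^ m * lam P i j m;
     gT := gT P;
     logp := fun i j => l + logp P i j;
     logq := fun i j => l + logq P i j |}.

Definition scale_fields (alpha : I -> int -> C) P : params R n :=
  let al j m := if m == 0 then 1 else alpha j m in
  {| hA := fun i j m => (al i m)^-1 * hA P i j m * al j m;
     sS := fun j m => al j m * sS P j m;
     lam := fun i j m => lam P i j m * al j m;
     gT := gT P; logp := logp P; logq := logq P |}.

Definition field_scaling (alpha : I -> int -> C) : Prop :=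
  forall j (m : int), 0 < m ->
    alpha j m != 0 /\ alpha j (- m) = (alpha j m)^-1.

Section DynkinData.
Variable P : params R n.

Definition Aat (k l : nat) (m : int) : C := hA P (ix k) (ix l) m.

(* [{j_1 < ... < j_K}] *)
Definition Jset : {set I} := [set j | hA P j j 0 == 1]%SET.

Definition A0at (l : nat) : C :=
  if l == 1%N then
    if ix 1 \in Jset then - 1 - Aat 1 2 0 else Aat 1 2 0
  else if l == n.+1 then
    if ix n.+1 \in Jset then - 1 - Aat n.+1 n 0 else Aat n.+1 n 0
  else 0.

(* [A_(k,l)(0)] for all [k], [l], read modulo [L + 1]. *)
Definition Aext (k l : nat) : C :=
  let k' := (k %% n.+2)%N in let l' := (l %% n.+2)%N in
  if k' == 0%N then
    if l' == 0%N then (if odd #|Jset| then 1 else - 2 * A0at n.+1)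
    else A0at l'
  else if l' == 0%N then A0at k' else Aat k' l' 0.

Definition Jhat (j : nat) : bool :=
  if (j <= n.+1)%N then ix j \in Jset else odd #|Jset|.

Definition Ihat (d : C) (j : nat) : bool :=
  (1 <= j <= n.+2)%N && (Aext j.-1 j == d).

Definition nIhat (d : C) : nat := count (Ihat d) (iota 1 n.+2).

Definition rpar : C :=
  let b := Aat 1 2 0 in
  if (nIhat (- 1 - b)%R < nIhat b)%N then (1 + b)^-1 else - b^-1.

(* [x = exp logx] satisfies [x^(2 r) = exp (2 r logx) = q_21 / q_11]. *)
Definition logx : C :=
  (logq P (ix 2) (ix 1) - logq P (ix 1) (ix 1)) / (2 * rpar).

Variables (r lx : C).

Definition I1 (j : nat) : bool := Ihat (- r^-1) j.
Definition I2 (j : nat) : bool := Ihat ((1 - r) / r) j.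

(* For [r = 2] the sets [I1] and [I2] coincide and [r - 1 = 1]; the indices    *)
(* must then be counted once, whence the exclusion of [I1] in the second term. *)
Definition D (k l : nat) : C :=
  (r - 1) * (count I1 (index_iota k.+1 l.+2))%:R
  + (count (fun j => I2 j && ~~ I1 j) (index_iota k.+1 l.+2))%:R.

Definition xpow (u : C) : C := cexp (u * lx).
Definition br (u : C) : C := (xpow u - xpow (- u)) / (xpow 1 - xpow (- 1)).

(* A product with [lx] on the right is the logarithm of a power of [x]. *)
Definition solution_pq : Prop :=
  [/\ forall j, (1 <= j <= n.+1)%N ->
        logq P (ix j) (ix j) = D 1 (j - 1) * lx /\
        logq P (ix j.+1) (ix j) = (2 * r + D 1 (j - 1)) * lx,
      (I1 1 -> logp P (ix 1) (ix 1) = 2 * lx) /\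
      (I2 1 -> logp P (ix 1) (ix 1) = (2 * r - 2) * lx),
      forall j, (2 <= j <= n.+1)%N ->
        (I1 j -> logp P (ix j) (ix j) = (D 1 (j - 2) + (r + 1)) * lx) /\
        (I2 j -> logp P (ix j) (ix j) = (D 1 (j - 2) + (2 * r - 1)) * lx),
      forall j, (2 <= j <= n.+2)%N ->
        (I1 j -> logp P (ix j) (ix (j - 1))
                 = (D 1 (j - 2) + (2 * r - 2)) * lx) /\
        (I2 j -> logp P (ix j) (ix (j - 1)) = (D 1 (j - 2) + 2) * lx)
    & forall k l, (1 <= k <= n.+2)%N -> (1 <= l <= n.+1)%N ->
        k != l -> k != l.+1 -> logp P (ix k) (ix l) = logq P (ix k) (ix l)].

Definition solution_s : Prop :=
  forall (m : int) (j : nat), 0 < m -> (1 <= j <= n.+1)%N ->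
    let b (u : C) := br (u * m%:~R) in
    [/\ sS P (ix j) m = 1,
        Jhat j -> sS P (ix j) (- m) = - 1,
        ~~ Jhat j -> I1 j ->
          sS P (ix j) (- m) = - (b 1 * b (2 * (r - 1)) / (b r * b (r - 1)))
      & ~~ Jhat j -> I2 j ->
          sS P (ix j) (- m) = - (b (r - 1) * b 2 / (b r * b 1))].

(* The last clause expresses that the data form a Dynkin diagram (each row of  *)
(* the extended matrix has zero sum), so that [Jset] and [beta] determine it.  *)
Definition solution_A0 : Prop :=
  [/\ forall i, (1 <= i <= n.+2)%N ->
        [/\ Jhat i -> Aext i i = 1,
            ~~ Jhat i -> I1 i -> Aext i i = 2 / r
          & ~~ Jhat i -> I2 i -> Aext i i = 2 * (r - 1) / r],
      forall j, (1 <= j <= n.+2)%N ->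
        [/\ I1 j || I2 j,
            I1 j -> Aext j.-1 j = - r^-1 /\ Aext j j.-1 = - r^-1
          & I2 j -> Aext j.-1 j = (1 - r) / r /\ Aext j j.-1 = (1 - r) / r],
      forall k l, [&& 1 <= k, k + 2 <= l & l <= n.+1]%N
                  || [&& k == 0, 1 < l & l < n.+1]%N ->
        Aext k l = 0 /\ Aext l k = 0
    & forall j, (1 <= j <= n.+1)%N ->
        Aext j j.+1 = if Jhat j then - 1 - Aext j.-1 j else Aext j.-1 j].

Definition solution_A : Prop :=
  let c (j : nat) (m : int) :=
    if I1 j then br m%:~R / br (r * m%:~R)
    else br ((r - 1) * m%:~R) / br (r * m%:~R) in
  [/\ forall (j : nat) (m : int), (1 <= j <= n.+1)%N -> m != 0 -> Aat j j m = 1,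
      forall (k l : nat) (m : int), (1 <= k <= n.+1)%N -> (1 <= l <= n.+1)%N ->
        (k + 2 <= l)%N || (l + 2 <= k)%N -> m != 0 -> Aat k l m = 0,
      forall (j : nat) (m : int), (2 <= j <= n.+1)%N ->
        (0 < m -> Aat (j - 1) j m = c j m * (1 / sS P (ix j) (- m))) /\
        (m < 0 -> Aat (j - 1) j m = c j m * (1 / sS P (ix (j - 1)) m))
    & forall (j : nat) (m : int), (2 <= j <= n.+1)%N -> 0 < m ->
        Aat (j - 1) j (- m) = Aat j (j - 1) m /\
        Aat j (j - 1) (- m) = Aat (j - 1) j m].

Definition solution_lambda : Prop :=
  forall i j : nat, (1 <= i <= n.+2)%N -> (1 <= j <= n.+1)%N ->
    lam P (ix i) (ix j) 0
      = 2 * r * lx / D 0 n.+1 * (if (j < i)%N then D 0 (j - 1) else - D j n.+1)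
    /\
    forall m : int, m != 0 ->
      let u : C := m%:~R in
      lam P (ix i) (ix j) m / sS P (ix j) m
        = br (r * u) * (xpow 1 - xpow (- 1)) / br (D 0 n.+1 * u)
          * (if (j < i)%N
             then - xpow ((r + D 1 n.+1) * u) * br (D 0 (j - 1) * u)
             else xpow ((r - D 0 0) * u) * br (D j n.+1 * u)).

Definition solution_g : Prop :=
  exists g : C, forall i, (1 <= i <= n.+2)%N ->
    (I1 i -> gT P (ix i) = g * br (r - 1)) /\ (I2 i -> gT P (ix i) = g).

Definition solution_form : Prop :=
  [/\ solution_pq, solution_s, solution_A0 & [/\ solution_A, solution_lambda
    & solution_g]].

End DynkinData.

(* [g_j (q_jj / p_jj - 1) : Lambda_j(z) S_j(q_jj^(-1) z) :]; the coefficient   *)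
(* of [z^e] is obtained by putting [w^e' = q_jj^(-e') z^e'] in                 *)
(* [: Lambda_j(z) S_j(w) :].                                                   *)
Definition Bcurrent P : currents := fun j mu e f =>
  let i : 'I_n.+2 := ix j.+1 in
  (gT P i * (qq P i j / pp P i j - 1)) *:
  \sum_(m \in [set: int])
    cexp (- (e - m%:~R) * logq P i j) *:
      nmode (hA P) (Lambda P i) (S_ P j) mu m%:~R (e - m%:~R) f.

End Currents.

(* Main.v *)
Require Import Defs.
From HB Require Import structures.
From mathcomp Require Import all_boot all_order all_algebra all_fingroup.
From mathcomp Require Import complex finmap.
From mathcomp.multinomials Require Import monalg.
From mathcomp Require Import all_classical all_reals all_analysis.
From mathcomp Require Import ring lra zify.

Set Implicit Arguments.
Unset Strict Implicit.
Unset Printing Implicit Defensive.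

Import Order.TTheory GRing.Theory Num.Theory.
Import numFieldNormedType.Exports.

Local Open Scope classical_set_scope.
Local Open Scope ring_scope.

(** The vertex operators act on a polynomial Fock space by exponentials of commuting
   creation and annihilation operators, so the Wick rule [wick] turns a product into a
   scalar series times the normal ordered product. On the vacuum all coefficients of that
   series can be read off. Put

   [lamA i j m = \sum_k lambda_ik(m) A_kj(m)] and [sXs k l m = s_k(m) A_kl(m) s_l(-m)].

   Then Mutual Locality says that [lamA i j m * s_j(-m) = q_ij^m - p_ij^m] for all nonzero
   [m], together with one equation for the zero modes ([mutual_localityP]), and Symmetry
   says that [sXs] is symmetric in its indices and vanishes for indices at distance at
   least two ([symmetryP]).

   For local operators the two orders of the product are the two expansions of one
   rational function with a simple pole, so their commutator is a delta function times the
   normal ordered product on its support ([sum_bilateral], [commutator]). The commutator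
   [[T_1(z), S_j(w)]] is thus a sum of delta functions at the points [q_ij], which are
   linearly independent. Commutativity therefore means that the residues vanish except
   at [q_jj] and [q_(j+1,j)], and that the two remaining currents are opposite. A vertex
   operator determines its symbol, since the pairing is nondegenerate; comparing symbols
   gives [lambda_(j+1,k)(m) - lambda_jk(m) = s_j(m) (q_jj^m - q_(j+1,j)^m)] for [k = j], and
   [0] for the other [k] ([diff_eqs], [commutativity_suff], [commutativity_nec]).

   Subtracting the locality equations of neighbouring rows expresses every product [sXs]
   by the points [p_ij], [q_ij] ([jump_rel]). These products are even in [m]; comparing
   [m = 1] with [m = -1] yields algebraic relations between the points, which become linear
   relations between their logarithms ([logs_diag], [logs_next], [logs_prev],
   [logs_step]). It follows that [log (q_(j+1,j) / q_jj) = 2 h] does not depend on [j], and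
   that everything is a function of the exponents [delta_j = log (q_jj / q_(j-1,j-1))],
   which equal [h (1 + A_(j-1,j)(0))]. Two consecutive exponents agree, or they add up to [h]
   when [A_jj(0) = 1]. The coefficients [lambda] then solve a tridiagonal linear system, whose
   solution is a hyperbolic sine of the tail sums of the [delta_j] by an addition theorem
   ([sh_recurrence], [rows_solve]). The record [normal_form] collects the result.

   In one direction the normal form follows from the functional equations
   ([system_normal_form]), in the other it implies them ([normal_form_locality],
   [normal_form_diff], [normal_form_symmetry]). Writing [h = r log x], so that every [delta_j]
   is [(r - 1) log x] or [log x], turns it into the formulas of the theorem, after the free
   fields have been scaled so that [s_j(m) = 1] for positive [m] and the variables so that
   [q_11 = 1] ([normal_solution], [solution_normal]). *)

(** * Convolution sums *)

Definition conv (V : nmodType) (F : nat -> nat -> V) (d : nat) : V :=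
  \sum_(i < d.+1) F i (d - i)%N.

Lemma eq_conv (V : nmodType) (F G : nat -> nat -> V) d :
  (forall a b, (a + b)%N = d -> F a b = G a b) -> conv F d = conv G d.
Proof.
move=> FG; apply: eq_bigr => i _; apply: FG.
by rewrite subnKC // -ltnS.
Qed.

Lemma conv0 (V : nmodType) (F : nat -> nat -> V) : conv F 0 = F 0 0.
Proof. by rewrite /conv big_ord1. Qed.

Lemma convC (V : nmodType) (F : nat -> nat -> V) d :
  conv F d = conv (fun a b => F b a) d.
Proof.
rewrite /conv (reindex_inj rev_ord_inj) /=; apply: eq_bigr => i _.
by rewrite subSS subKn // -ltnS.
Qed.

Lemma convS (V : nmodType) (F : nat -> nat -> V) d :
  conv F d.+1 = F 0 d.+1 + conv (fun a b => F a.+1 b) d.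
Proof. by rewrite /conv big_ord_recl /= subn0. Qed.

Lemma convD (V : nmodType) (F G : nat -> nat -> V) d :
  conv (fun a b => F a b + G a b) d = conv F d + conv G d.
Proof. by rewrite /conv big_split. Qed.

Lemma convA (V : nmodType) (F : nat -> nat -> nat -> V) d :
  conv (fun a b => conv (fun m k => F m k b) a) d =
  conv (fun m c => conv (fun k b => F m k b) c) d.
Proof.
elim: d F => [|d IHd] F; first by rewrite !conv0.
rewrite convS [RHS]convS conv0 (eq_conv (G := fun a b =>
  F 0 a.+1 b + conv (fun m k => F m.+1 k b) a)); last first.
  by move=> a b _; rewrite convS.
by rewrite convD (IHd (fun m => F m.+1)) addrA -convS.
Qed.

Section ConvLinear.
Variables (K : pzRingType) (V : lmodType K).
Implicit Types F : nat -> nat -> V.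

Lemma conv_linear (W : lmodType K) (f : {linear V -> W}) F d :
  f (conv F d) = conv (fun a b => f (F a b)) d.
Proof. by rewrite /conv linear_sum. Qed.

Lemma convZ (c : K) F d : c *: conv F d = conv (fun a b => c *: F a b) d.
Proof. by rewrite /conv scaler_sumr. Qed.

Lemma conv_leibniz F d :
  conv (fun a b => a%:R *: F a b) d + conv (fun a b => b%:R *: F a b) d
  = d%:R *: conv F d.
Proof.
rewrite -convD convZ; apply: eq_conv => a b <-.
by rewrite -scalerDl -natrD.
Qed.
End ConvLinear.

(** * Exponentials of commuting operators *)

Lemma convCA (V : nmodType) (F : nat -> nat -> nat -> V) d :
  conv (fun m c => conv (fun k b => F m k b) c) d =
  conv (fun k c => conv (fun m b => F m k b) c) d.
Proof.
rewrite -!convA; apply: eq_conv => a b _; exact: convC.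
Qed.

Section ExpCoef.
Variables (C : numFieldType) (F : lmodType C).
Implicit Types (f : F).

(** The defining sum of [exp_coef] over an arbitrary module. *)
Definition expseq (X : nat -> F -> F) (d : nat) (f : F) : F :=
  \sum_(k < d.+1) (k`!%:R : C)^-1 *:
    \sum_(t : k.-tuple 'I_d.+1 |
           all (fun m : 'I_d.+1 => 0 < m)%N t && (\sum_(m <- t) m == d)%N)
      foldr (fun m : 'I_d.+1 => X m) f t.

Lemma eq_expseq (X Y : nat -> F -> F) d f :
  (forall m g, (0 < m)%N -> X m g = Y m g) ->
  expseq X d f = expseq Y d f.
Proof.
move=> XY; apply: eq_bigr => k _; congr (_ *: _); apply: eq_bigr => t /andP[pt _].
elim: (tval t) pt => //= m s IHs /andP[m_gt0 ps].
by rewrite XY // IHs.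
Qed.

Variable X : nat -> {linear F -> F}.

(** The sum of the products of [k] operators [X m] of total weight [s], built by
   peeling off the first operator; weighting it with [1 / k!] gives [expseq]. *)
Fixpoint expword k s f : F :=
  if k is k'.+1 then
    conv (fun m b => if m == 0%N then 0 else X m (expword k' b f)) s
  else if s == 0%N then f else 0.

Lemma expword_big k s f : (k > s)%N -> expword k s f = 0.
Proof.
elim: k s => // k IHk s; rewrite ltnS => sk /=.
rewrite /conv big1 // => -[i i_lt] _ /=.
case: eqP => // /eqP; rewrite -lt0n => i_gt0.
case: k IHk sk => [|k] IHk sk; first by rewrite ltnS in i_lt; lia.
by rewrite IHk ?linear0 //; lia.
Qed.

Lemma expword_sum N k s f : (s < N)%N ->
  \sum_(t : k.-tuple 'I_N |
      all (fun m : 'I_N => 0 < m)%N t && (\sum_(m <- t) m == s)%N)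
    foldr (fun m : 'I_N => X m) f t = expword k s f.
Proof.
elim: k s => [|k IHk] s sN.
  case: (eqVneq s 0%N) => [->|s0] /=.
    rewrite (big_pred1 [tuple]) // => t; rewrite tuple0 /= big_nil.
    by transitivity true => //; apply/esym/eqP.
  rewrite (negPf s0) big_pred0 // => t; rewrite tuple0 /= big_nil.
  by rewrite eq_sym (negPf s0).
rewrite (reindex (fun p : 'I_N * k.-tuple 'I_N => [tuple of p.1 :: p.2])) /=;
  last first.
  exists (fun t => (thead t, [tuple of behead t])) => [[m t]|t] _ /=.
    by congr pair; apply/val_inj.
  by rewrite [t in RHS]tuple_eta; apply/val_inj.
transitivity (\sum_(m < N) if (m < s.+1)%N && (m != 0%N :> nat) then X m (expword k (s - m)%N f) else 0).
  transitivity (\sum_(m < N) \sum_(t : k.-tuple 'I_N | (0 < m)%N &&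
     (all (fun m : 'I_N => 0 < m)%N t && (m + \sum_(m <- t) m == s)%N))
      X m (foldr (fun m : 'I_N => X m) f t)).
    rewrite pair_big_dep /=; apply: eq_bigl => -[m t] /=.
    by rewrite big_cons andbA.
  apply: eq_bigr => m _; case: ifP => [/andP[ms m0]|ms].
    rewrite -IHk ?linear_sum /=; last lia.
    apply: eq_bigl => t; rewrite lt0n m0 /=; congr andb.
    by rewrite -(eqn_add2l m (\sum_(m0 <- t) m0)%N) subnKC // -ltnS.
  rewrite big1 // => t /and3P[m_gt0 _ /eqP ms'].
  move: ms; rewrite -lt0n m_gt0 andbT => /negbT; lia.
rewrite /conv /= (big_ord_widen_cond N (fun=> true) (fun m : nat =>
   if m == 0%N then 0 else X m (expword k (s - m)%N f))) //.
rewrite [RHS]big_mkcond; apply: eq_bigr => m _ /=.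
by case: (m < s.+1)%N; case: eqP.
Qed.

Lemma expseqE N d f : (d < N)%N ->
  expseq X d f = \sum_(k < N) (k`!%:R : C)^-1 *: expword k d f.
Proof.
move=> dN; transitivity (\sum_(k < d.+1) (k`!%:R : C)^-1 *: expword k d f).
  apply: eq_bigr => k _; congr (_ *: _).
  by rewrite -(@expword_sum d.+1).
rewrite (big_ord_widen_cond N (fun=> true)
   (fun k : nat => (k`!%:R : C)^-1 *: expword k d f)) //.
rewrite big_mkcond; apply: eq_bigr => k _ /=.
by case: ltnP => // kd; rewrite expword_big ?scaler0.
Qed.

Hypothesis XC : forall i j g, X i (X j g) = X j (X i g).

(** The derivative of a [k]-th power, in the form [(X^k)' = k X' X^(k-1)] valid
   because the [X m] commute. *)
Lemma expword_rec k d f :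
  d%:R *: expword k.+1 d f =
  k.+1%:R *: conv (fun m b => m%:R *: X m (expword k b f)) d.
Proof.
elim: k d => [|k IHk] d.
  rewrite [in LHS]/= -conv_leibniz scale1r -convD; apply: eq_conv => a b _ /=.
  case: (eqVneq b 0%N) => [->|b0].
    by rewrite !scale0r addr0; case: (eqVneq a 0%N) => // ->; rewrite !scale0r.
  by rewrite linear0 if_same !scaler0 addr0.
rewrite [expword k.+2]/= -conv_leibniz.
have -> : conv (fun a b : nat => a%:R *:
    (if a == 0%N then 0 else X a (expword k.+1 b f))) d =
    conv (fun a b => a%:R *: X a (expword k.+1 b f)) d.
  by apply: eq_conv => a b _; case: eqP => // ->; rewrite !scale0r.
rewrite -[k.+2%:R]natr1 addrC scalerDl scale1r; congr (_ + _).
rewrite (eq_conv (G := fun m c => conv (fun m' b =>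
   if m == 0%N then 0 else k.+1%:R *: (m'%:R *: X m' (X m (expword k b f)))) c)).
  rewrite convCA convZ; apply: eq_conv => m c _.
  rewrite [expword _ _ _]/= (conv_linear (X m)) !convZ.
  apply: eq_conv => m' b _; case: eqP => _ //.
  by rewrite linear0 !scaler0.
move=> a b _; case: eqP => _; first by rewrite scaler0 /conv big1.
rewrite -linearZ_LR IHk linearZ_LR (conv_linear (X a)) convZ.
by apply: eq_conv => m' c _; rewrite linearZ_LR XC.
Qed.

Lemma expseq0 f : expseq X 0 f = f.
Proof. by rewrite (@expseqE 1) // big_ord1 /= fact0 invr1 scale1r. Qed.

(** Differentiating [exp (\sum_m X_m t^m)] with respect to [t]; together with
   the value at [0] this recursion determines the coefficients, which makes
   every identity below an induction. *)
Lemma expseq_rec d f :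
  d%:R *: expseq X d f = conv (fun m b => m%:R *: X m (expseq X b f)) d.
Proof.
rewrite (@expseqE d.+2) // scaler_sumr big_ord_recl /=.
have -> : d%:R *: ((0`!)%:R^-1 *: (if d == 0%N then f else 0)) = 0.
  by case: eqP => [->|_]; rewrite ?scale0r ?scaler0.
rewrite add0r (eq_conv (G := fun m b => \sum_(k < d.+1)
   (k`!%:R : C)^-1 *: (m%:R *: X m (expword k b f)))); last first.
  move=> a b abd; rewrite (@expseqE d.+1); last lia.
  rewrite linear_sum scaler_sumr; apply: eq_bigr => k _.
  by rewrite linearZ !scalerA mulrC.
rewrite /conv exchange_big; apply: eq_bigr => k _ /=.
rewrite -scaler_sumr [X in _ = _ *: X](_ : _ = conv (fun m b => m%:R *: X m (expword k b f)) d) //.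
have -> : d%:R *: (((lift ord0 k)`!)%:R^-1 *:
     conv (fun m b => if m == 0%N then 0 else X m (expword k b f)) d) =
    ((k.+1)`!%:R : C)^-1 *: (d%:R *: expword k.+1 d f).
  by rewrite !scalerA mulrC.
rewrite expword_rec scalerA factS natrM invfM mulrAC mulVf ?mul1r //.
Qed.
End ExpCoef.

Lemma conv_delta (V : nmodType) (m : nat) (G : nat -> V) d :
  conv (fun a b => if a == m then G b else 0) d =
  if (m <= d)%N then G (d - m)%N else 0.
Proof.
rewrite /conv; case: leqP => md.
  rewrite (bigD1 (inord m)) //= inordK ?ltnS // eqxx big1 ?addr0 // => i im.
  by case: eqP => // im'; rewrite -val_eqE /= inordK ?ltnS // im' eqxx in im.
rewrite big1 // => i _; case: eqP => // im.
by move: (ltn_ord i); rewrite im ltnS leqNgt md.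
Qed.

Lemma conv_shift (V : nmodType) (F : nat -> nat -> V) m d :
  (forall a b, (b < m)%N -> F a b = 0) ->
  conv F d = if (m <= d)%N then conv (fun a b => F a (b + m)%N) (d - m) else 0.
Proof.
move=> F0; case: leqP => md; last first.
  by rewrite /conv big1 // => i _; apply: F0; lia.
rewrite {2}/conv (big_ord_widen_cond d.+1 (fun=> true)
   (fun i : nat => F i (d - m - i + m)%N)); last lia.
rewrite big_mkcond; apply: eq_bigr => i _ /=.
case: ltnP => im; first by congr F; lia.
by apply: F0; move: (ltn_ord i); lia.
Qed.

Section ExpSeqTheory.
Variables (C : numFieldType) (F : lmodType C).
Implicit Types (f g : F) (X Y Z D : nat -> {linear F -> F}).

Definition commuting X Y := forall i j g, X i (Y j g) = Y j (X i g).

Lemma natr_scaleI d (u v : F) : (0 < d)%N -> d%:R *: u = d%:R *: v -> u = v.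
Proof. by move=> d0; apply: scalerI; rewrite pnatr_eq0 -lt0n. Qed.

Lemma eq_conv_pos (P Q : nat -> nat -> F) d :
  (forall a b, (0 < a)%N -> (a + b)%N = d -> P a b = Q a b) ->
  conv (fun a b => a%:R *: P a b) d = conv (fun a b => a%:R *: Q a b) d.
Proof.
move=> PQ; apply: eq_conv => -[|a] b abd; first by rewrite !scale0r.
by rewrite PQ.
Qed.

(** The recursion characterises the exponential of a commuting family. *)
Lemma expseq_unique X (E : nat -> F) f : commuting X X ->
  E 0%N = f -> (forall d, d%:R *: E d = conv (fun m b => m%:R *: X m (E b)) d) ->
  forall d, E d = expseq X d f.
Proof.
move=> XC E0 Erec; elim/ltn_ind => -[_|d IHd]; first by rewrite E0 expseq0.
apply: (@natr_scaleI d.+1) => //; rewrite Erec expseq_rec //.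
by apply: eq_conv_pos => a b a0 abd; rewrite IHd //; lia.
Qed.

Lemma expseq_is_linear X d : commuting X X -> linear (expseq X d).
Proof.
move=> XC c f g; elim/ltn_ind: d => -[_|d IHd]; first by rewrite !expseq0.
apply: (@natr_scaleI d.+1) => //; rewrite scalerDr scalerA mulrC -scalerA.
rewrite !expseq_rec // convZ -convD; apply: eq_conv => -[|a] b abd.
  by rewrite !scale0r scaler0 addr0.
by rewrite IHd ?linearP ?scalerDr ?scalerA 1?mulrC //; lia.
Qed.

(** An operator which commutes with every [X m] commutes with the exponential, by
   induction along the recursion. *)
Lemma expseq_comm X (Y : {linear F -> F}) d f : commuting X X ->
  (forall m g, (0 < m)%N -> Y (X m g) = X m (Y g)) ->
  Y (expseq X d f) = expseq X d (Y f).
Proof.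
move=> XC YX; elim/ltn_ind: d => -[_|d IHd]; first by rewrite !expseq0.
apply: (@natr_scaleI d.+1) => //; rewrite -linearZ_LR !expseq_rec //.
rewrite conv_linear; apply: eq_conv => -[|a] b abd.
  by rewrite !scale0r linear0.
by rewrite linearZ_LR YX // IHd //; lia.
Qed.

Lemma expseq_scale X Y (c : C) d f : commuting X X ->
  (forall m g, (0 < m)%N -> Y m g = c ^+ m *: X m g) ->
  expseq Y d f = c ^+ d *: expseq X d f.
Proof.
move=> XC YX; pose Z m : {linear F -> F} := c ^+ m \*: X m.
rewrite (@eq_expseq _ _ Y Z) //.
have ZE m g : Z m g = c ^+ m *: X m g by [].
have ZC : commuting Z Z.
  move=> i j g; rewrite !ZE [X i (_ *: _)]linearZ_LR [X j (_ *: _)]linearZ_LR XC !scalerA.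
  by rewrite mulrC.
apply/esym/(expseq_unique ZC (E := fun d => c ^+ d *: expseq X d f)).
  by rewrite expseq0 scale1r.
move=> {}d; rewrite scalerA mulrC -scalerA expseq_rec // convZ.
apply: eq_conv => a b <-; rewrite ZE [X a (_ *: _)]linearZ_LR !scalerA exprD.
by congr (_ *: _); ring.
Qed.

(** Both sides of [exp (X + Y) = exp X exp Y] satisfy the recursion for [X + Y], by
   the Leibniz rule. *)
Lemma expseqD X Y Z d f : commuting X X -> commuting Y Y -> commuting X Y ->
  (forall m g, (0 < m)%N -> Z m g = X m g + Y m g) ->
  expseq Z d f = conv (fun a b => expseq X a (expseq Y b f)) d.
Proof.
move=> XC YC XY ZXY; pose T m : {linear F -> F} := X m \+ Y m.
rewrite (@eq_expseq _ _ Z T) //.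
have TE m g : T m g = X m g + Y m g by [].
have TC : commuting T T.
  move=> i j g; rewrite !TE [X i (_ + _)]linearD [X j (_ + _)]linearD [Y i (_ + _)]linearD [Y j (_ + _)]linearD XC YC XY -!addrA; congr (_ + _).
  by rewrite addrCA XY.
apply/esym/(expseq_unique TC (E := fun d => conv (fun a b =>
    expseq X a (expseq Y b f)) d)); first by rewrite conv0 !expseq0.
move=> {}d; rewrite -conv_leibniz.
rewrite [RHS](eq_conv (G := fun m c =>
   conv (fun a b => m%:R *: X m (expseq X a (expseq Y b f))) c +
   conv (fun a b => m%:R *: Y m (expseq X a (expseq Y b f))) c)); last first.
  by move=> a b _; rewrite TE scalerDr (conv_linear (X a)) (conv_linear (Y a)) !convZ.
rewrite convD; congr (_ + _).
  rewrite -convA; apply: eq_conv => a b _.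
  by rewrite expseq_rec.
rewrite convCA; apply: eq_conv => a c _.
pose EX := GRing.isLinear.Build C F F _ (expseq X a) (expseq_is_linear a XC).
pose EXl : {linear F -> F} := HB.pack (expseq X a) EX.
rewrite -[c%:R *: _](linearZ_LR EXl) expseq_rec // conv_linear.
apply: eq_conv => m b _; rewrite linearZ_LR /= -(expseq_comm (Y := Y m)) //.
Qed.

(** The value [0] in negative degrees lets the degree run over all integers, so that
   the shifts in the Wick rule need no case distinction. *)
Definition expz X (s : int) f : F := if s is Posz d then expseq X d f else 0.

Lemma expz_is_linear X s : commuting X X -> linear (expz X s).
Proof.
case: s => [d|d] XC; first exact: expseq_is_linear.
by move=> c f g /=; rewrite scaler0 addr0.
Qed.

Lemma expz_neg X (s : int) f : s < 0 -> expz X s f = 0.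
Proof. by case: s. Qed.

(** The recursion of [expseq_rec] for scalars: [phi] is the sequence of coefficients of
   [exp (\sum_m kappa_m t^m)]. *)
Definition scalar_exp (kappa phi : nat -> C) :=
  phi 0%N = 1 /\
  forall d, d%:R * phi d = conv (fun m b => m%:R * kappa m * phi b) d.

Section Wick.
Variables (D X : nat -> {linear F -> F}) (kappa phi : nat -> C).
Hypotheses (DC : commuting D D) (XC : commuting X X).
Hypothesis DX : forall m m' g, (0 < m)%N -> (0 < m')%N ->
  D m (X m' g) = X m' (D m g) + (if m' == m then kappa m *: g else 0).

(** The commutator with [D m] is a derivation, and it sends the exponent
   [\sum_m X_m t^m] to the scalar [kappa_m t^m]. *)
Lemma lower_expz m s g : (0 < m)%N ->
  D m (expz X s g) = expz X s (D m g) + kappa m *: expz X (s - m%:Z) g.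
Proof.
move=> m0; case: s => [d|d]; last first.
  rewrite !expz_neg ?linear0 ?scaler0 ?addr0 //; lia.
elim/ltn_ind: d => -[_|d IHd].
  by rewrite [X in _ + _ *: X]expz_neg ?scaler0 ?addr0 /= ?expseq0 //; lia.
apply: (@natr_scaleI d.+1) => //; rewrite -linearZ_LR {1}/expz expseq_rec //.
rewrite conv_linear (eq_conv (G := fun a b => a%:R *: X a (expseq X b (D m g)) +
  (kappa m *: (a%:R *: X a (expz X (b%:Z - m%:Z) g)) +
   (if a == m then (kappa m * m%:R) *: expseq X b g else 0)))); last first.
  move=> [|a] b abd.
    rewrite !scale0r scaler0 linear0 !add0r; case: eqP => // m0'.
    by rewrite -m0' in m0.
  rewrite linearZ_LR DX // (IHd b); last lia.
  rewrite [X a.+1 (_ + _)]linearD [X a.+1 (_ *: _)]linearZ_LR !scalerDr -addrA.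
  congr (_ + (_ + _)).
    by rewrite !scalerA mulrC.
  by case: eqP => [->|_]; rewrite ?scaler0 // scalerA mulrC.
rewrite !convD conv_delta -expseq_rec // scalerDr; congr (_ + _).
rewrite -convZ (conv_shift (m := m)); last first.
  by move=> a b bm; rewrite expz_neg ?linear0 ?scaler0 //; lia.
case: leqP => md; last first.
  by rewrite expz_neg ?scaler0 ?addr0 //; lia.
rewrite (eq_conv (G := fun a b => a%:R *: X a (expseq X b g))); last first.
  by move=> a b _; rewrite PoszD addrK.
rewrite -expseq_rec // subzn //= !scalerA -scalerDl; congr (_ *: _).
by rewrite -mulrDr -natrD subnK // mulrC.
Qed.

Hypothesis kappaphi : scalar_exp kappa phi.

(** Wick's rule for [exp (\sum_m D_m z^-m)] and [exp (\sum_m X_m w^m)]. *)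
Lemma wick a s g :
  expseq D a (expz X s g) =
  conv (fun k b => phi k *: expz X (s - k%:Z) (expseq D b g)) a.
Proof.
have [phi0 phirec] := kappaphi.
elim/ltn_ind: a s g => -[_|a IHa] s g.
  by rewrite conv0 !expseq0 phi0 scale1r subr0.
apply: (@natr_scaleI a.+1) => //; rewrite expseq_rec //.
rewrite [LHS](eq_conv (G := fun m c => conv (fun k b =>
   (m%:R * phi k) *: expz X (s - k%:Z) (D m (expseq D b g)) +
   (m%:R * kappa m * phi k) *: expz X (s - (m + k)%N%:Z) (expseq D b g)) c));
  last first.
  move=> [|m] c mca.
    rewrite scale0r /conv big1 // => i _.
    by rewrite !mul0r !scale0r addr0.
  rewrite IHa; last lia.
  rewrite (conv_linear (D m.+1)) convZ; apply: eq_conv => k b _.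
  rewrite linearZ_LR lower_expz // scalerDr scalerDr !scalerA.
  congr (_ + _ *: expz _ _ _); first by ring.
  by rewrite addnC PoszD opprD addrA.
rewrite [LHS](eq_conv (fun m c _ => convD _ _ c)) convD -conv_leibniz addrC.
congr (_ + _).
  rewrite -convA; apply: eq_conv => k b _.
  rewrite scalerA phirec /conv scaler_suml; apply: eq_bigr => i _.
  by rewrite subnKC // -ltnS.
rewrite convCA; apply: eq_conv => k c _.
pose EX := GRing.isLinear.Build C F F _ (expz X (s - k%:Z)) (expz_is_linear _ XC).
pose EXl : {linear F -> F} := HB.pack (expz X (s - k%:Z)) EX.
rewrite scalerA mulrC -scalerA -[c%:R *: _](linearZ_LR EXl) expseq_rec //.
rewrite (conv_linear EXl) convZ; apply: eq_conv => m b _.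
by rewrite linearZ_LR !scalerA mulrC.
Qed.

End Wick.
End ExpSeqTheory.

(** * The polynomial Fock space *)

Lemma ccr_linear (K : numFieldType) (V : lmodType K) (D Y : {linear V -> V})
    (a c : K) (f g : V) :
  D (Y f) = Y (D f) + a *: f -> D (Y g) = Y (D g) + a *: g ->
  D (Y (c *: f + g)) = Y (D (c *: f + g)) + a *: (c *: f + g).
Proof.
move=> Df Dg; rewrite !linearP /= Df Dg !scalerDr addrACA.
by rewrite !scalerA [c * _]mulrC.
Qed.

Lemma natr_scaleD (K : numFieldType) (V : lmodType K) (a b : nat) (u v w : V) :
  a%:R *: u = v -> b%:R *: u = w -> (a + b)%:R *: u = v + w.
Proof. by move=> <- <-; rewrite natrD scalerDl. Qed.

Lemma natr_scale_eq (K : numFieldType) (V : lmodType K) (a : nat) (u v : V) :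
  ((0 < a)%N -> u = v) -> a%:R *: u = a%:R *: v.
Proof. by case: a => [_|a ->] //; rewrite !scale0r. Qed.

Section PolynomialFock.
Variables (K : numFieldType) (X : choiceType).
Local Notation F := {malg K[{cmonom X}]}.
Implicit Types (f g : F) (x y : X).

(** The variable [y_x]; [dyv x] below is the partial derivative along it. *)
Definition yv (x : X) : F := << ucm x >>.

Definition dyv (x : X) (f : F) : F :=
  \sum_(m <- msupp f) << (m x)%:R * f@_m *g divcm m (ucm x) >>.

Lemma dyv_coef x f (u : {cmonom X}) :
  (dyv x f)@_u = (u x).+1%:R * f@_(mmul u (ucm x)).
Proof.
rewrite /dyv (raddf_sum (mcoeff u)) /=.
transitivity (\sum_(m <- msupp f) if m == mmul u (ucm x)
    then (u x).+1%:R * f@_(mmul u (ucm x)) else 0).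
  apply: eq_bigr => m _; rewrite mcoeffU.
  case: (eqVneq m (mmul u (ucm x))) => [->|mu].
    rewrite cmM cmUU addn1; suff -> : divcm (mmul u (ucm x)) (ucm x) == u by [].
    by apply/cmP => i; rewrite divcmE cmM addnK.
  case: (eqVneq (m x) 0%N) => [->|mx]; first by rewrite mul0r mul0rn.
  case: eqP => // dm; case/eqP: mu; apply/eqP/cmP => i; rewrite cmM -dm divcmE.
  by rewrite cmU; case: eqP => [<-|_]; lia.
case: (boolP (mmul u (ucm x) \in msupp f)) => uf.
  rewrite (bigD1_seq (mmul u (ucm x))) ?fset_uniq //= eqxx.
  by rewrite big1 ?addr0 // => m /negPf->.
rewrite (mcoeff_outdom uf) mulr0 big1_seq // => m /andP[_ mf].
by case: eqP => // mE; rewrite mE (negPf uf) in mf.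
Qed.

Lemma fcoefD f g u : (f + g)@_u = f@_u + g@_u.
Proof. exact: mcoeffD. Qed.
Lemma fcoefZ (c : K) f u : (c *: f)@_u = c * f@_u.
Proof. exact: mcoeffZ. Qed.
Lemma fcoefP (c : K) f g u : (c *: f + g)@_u = c * f@_u + g@_u.
Proof. by rewrite [LHS]fcoefD; congr (_ + _); exact: fcoefZ. Qed.
Lemma monomZ (c : K) m : << c *g m >> = c *: << m >> :> F.
Proof.
apply/malgP => u; rewrite [RHS]fcoefZ [LHS]mcoeffU [X in _ * X]mcoeffU.
by case: eqP; rewrite ?mulr1 ?mulr0.
Qed.

Lemma dyv_linear x : linear (dyv x : F -> F).
Proof.
move=> c f g; apply/malgP => u.
rewrite [LHS]dyv_coef [RHS]fcoefP [X in _ * X = _]fcoefP.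
rewrite [X in _ = _ * X + _]dyv_coef [X in _ = _ + X]dyv_coef.
by rewrite mulrDr mulrCA.
Qed.

HB.instance Definition _ x :=
  GRing.isLinear.Build K F F _ (dyv x) (dyv_linear x).

Lemma monomM (a b : {cmonom X}) :
  << mmul a b >> = << a >> * << b >> :> F.
Proof. by rewrite malgM_def fgmulUU mulr1. Qed.

Lemma cmonom_ind (P : {cmonom X} -> Prop) :
  P mone -> (forall x m, P m -> P (mmul (ucm x) m)) -> forall m, P m.
Proof.
move=> P1 Px m; have [k] := ubnP (mdeg m).
elim: k m => // k IHk m mk.
case: (fset_0Vmem (finsupp m)) => [m0|[i im]].
  suff -> : m = mone by [].
  by apply/eqP/cmP => i; rewrite cm1; apply/eqP; rewrite cmE_eq0 m0 inE.
have mi : (0 < m i)%N by rewrite lt0n cmE_neq0.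
have mE : m = mmul (ucm i) (divcm m (ucm i)).
  apply/eqP/cmP => j; rewrite cmM divcmE cmU.
  by case: eqP => [<-|_]; lia.
rewrite mE; apply/Px/IHk.
by move: mk; rewrite {1}mE mdegM mdegU; lia.
Qed.

Lemma fock_span (P : F -> Prop) :
  (forall c f g, P f -> P g -> P (c *: f + g)) -> (forall m, P << m >>) ->
  forall f, P f.
Proof.
move=> Plin Pm f; have P1 := Pm mone.
have P0 : P 0 by move: (Plin (-1) _ _ P1 P1); rewrite scaleN1r addNr.
rewrite (monalgE f); apply: (big_ind P); first exact: P0.
  by move=> g h Pg Ph; move: (Plin 1 _ _ Pg Ph); rewrite scale1r.
move=> m _; rewrite monomZ -[X in P X]addr0.
by apply: Plin; [exact: Pm|exact: P0].
Qed.

(** The vacuum and multiplication by variables reach every polynomial. *)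
Lemma fock_ind (P : F -> Prop) :
  (forall c f g, P f -> P g -> P (c *: f + g)) -> P 1 ->
  (forall x f, P f -> P (yv x * f)) -> forall f, P f.
Proof.
move=> Plin P1 Py; apply: (fock_span Plin) => m.
elim/cmonom_ind: m => [|x m Pm]; first exact: P1.
by rewrite monomM; exact: Py.
Qed.

Lemma dyv1 x : dyv x 1 = 0 :> F.
Proof.
apply/malgP => u; rewrite [LHS]dyv_coef [RHS]mcoeff0 mcoeff1.
by rewrite cmM_eq1 cm1_eq1 andbF mulr0.
Qed.

Lemma dyv_monom x (m : {cmonom X}) :
  dyv x << m >> = (m x)%:R *: << divcm m (ucm x) >> :> F.
Proof.
apply/malgP => u; rewrite [LHS]dyv_coef [RHS]fcoefZ.
rewrite [X in _ * X = _]mcoeffU1 [X in _ = _ * X]mcoeffU1.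
case: (eqVneq m (mmul u (ucm x))) => [->|mu].
  rewrite mulr1 cmM cmUU addn1; suff -> : divcm (mmul u (ucm x)) (ucm x) == u by rewrite mulr1.
  by apply/cmP => i; rewrite divcmE cmM addnK.
rewrite mulr0; case: (eqVneq (m x) 0%N) => [->|mx]; first by rewrite mul0r.
case: eqP => [dm|]; last by rewrite mulr0.
case/eqP: mu; apply/eqP/cmP => i; rewrite cmM -dm divcmE.
by rewrite cmU; case: eqP => [<-|_]; lia.
Qed.

Lemma yvMZ y (c : K) f : yv y * (c *: f) = c *: (yv y * f).
Proof.
rewrite -[c *: f]mul_malgC -[c *: (yv y * f)]mul_malgC; exact: mulrCA.
Qed.

Lemma yvMP y (c : K) f g : yv y * (c *: f + g) = c *: (yv y * f) + yv y * g.
Proof. by rewrite mulrDr; congr (_ + _); exact: yvMZ. Qed.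

Definition yvM (y : X) (f : F) : F := yv y * f.

Lemma yvM_linear y : linear (yvM y).
Proof. by move=> c f g; exact: yvMP. Qed.

HB.instance Definition _ y :=
  GRing.isLinear.Build K F F _ (yvM y) (yvM_linear y).

Lemma yvMC x y f : yvM y (yvM x f) = yvM x (yvM y f).
Proof. exact: mulrCA. Qed.

Lemma dyv_yvM x y f : dyv x (yvM y f) = yvM y (dyv x f) + (x == y)%:R *: f.
Proof.
apply: (fock_span (P := fun f =>
  dyv x (yvM y f) = yvM y (dyv x f) + (x == y)%:R *: f)) => [c {}f g Pf Pg|m].
  exact: (ccr_linear c Pf Pg).
rewrite /yvM -monomM [LHS]dyv_monom [dyv x _]dyv_monom yvMZ -monomM.
have -> : (mmul (ucm y) m) x = (m x + (x == y))%N.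
  by rewrite cmM cmU addnC eq_sym.
apply: natr_scaleD.
  apply: natr_scale_eq => mx; congr << _ >>; apply/eqP/cmP => i; rewrite !(divcmE, cmM) !cmU.
  by case: (eqVneq x i) => [<-|_]; lia.
apply: natr_scale_eq; rewrite lt0b => /eqP <-; congr << _ >>; apply/eqP/cmP => i; rewrite divcmE cmM; lia.
Qed.

Lemma fock1_neq0 : (1 : F) != 0.
Proof. exact: oner_neq0. Qed.

End PolynomialFock.

(** All that the calculus of vertex operators uses of the polynomial Fock space: the
   canonical commutation relations and a cyclic vacuum. *)
Record fockModel (K : numFieldType) (X : eqType) := FockModel {
  fspace :> lmodType K;
  cre : X -> {linear fspace -> fspace};
  ann : X -> {linear fspace -> fspace};
  vac : fspace;
  creC : forall x y f, cre x (cre y f) = cre y (cre x f);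
  ann_cre : forall x y f, ann x (cre y f) = cre y (ann x f) + (x == y)%:R *: f;
  ann_vac : forall x, ann x vac = 0;
  vac_neq0 : vac != 0;
  vac_cyclic : forall P : fspace -> Prop,
    (forall c f g, P f -> P g -> P (c *: f + g)) -> P vac ->
    (forall x f, P f -> P (cre x f)) -> forall f, P f
}.

Definition polyFock (K : numFieldType) (X : choiceType) : fockModel K X :=
  @FockModel K X {malg K[{cmonom X}]} (@yvM K X) (@dyv K X) 1
    (fun x y f => yvMC y x f) (@dyv_yvM K X) (@dyv1 K X) (fock1_neq0 K X)
    (@fock_ind K X).

(** * Oscillator exponentials on a Fock space *)

Section ScalarExp.
Variable K : numFieldType.
Implicit Types kappa phi : nat -> K.

Lemma scalar_exp_exists kappa : exists phi, scalar_exp kappa phi.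
Proof.
pose X m : {linear K^o -> K^o} := kappa m \*: idfun.
have XC : commuting X X by move=> i j g; rewrite /= /GRing.scale /=; ring.
exists (fun d => expseq X d (1 : K^o)); split; first by rewrite expseq0.
move=> d; rewrite -[LHS]/(d%:R *: expseq X d (1 : K^o)) expseq_rec //.
by apply: eq_conv => a b _; rewrite /GRing.scale /= mulrA.
Qed.

Lemma eq_scalar_exp kappa kappa' phi :
  (forall m, (0 < m)%N -> kappa m = kappa' m) ->
  scalar_exp kappa phi -> scalar_exp kappa' phi.
Proof.
move=> kk [phi0 phir]; split=> // d; rewrite phir; apply: eq_conv => -[|a] b _.
  by rewrite !mul0r.
by rewrite kk.
Qed.

Lemma scalar_exp_inj kappa kappa' phi :
  scalar_exp kappa phi -> scalar_exp kappa' phi ->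
  forall m, (0 < m)%N -> kappa m = kappa' m.
Proof.
move=> [phi0 phir] [_ phir']; elim/ltn_ind => -[//|m] IHm _.
have := phir m.+1; rewrite phir' /conv [LHS]big_ord_recr [RHS]big_ord_recr /= !subnn phi0 !mulr1.
rewrite (eq_bigr (fun i : 'I_m.+1 => i%:R * kappa i * phi (m.+1 - i)%N)).
  by move/addrI/mulfI=> /(_ _)/esym; apply; rewrite pnatr_eq0.
move=> [[|i] lti] _ /=; first by rewrite !mul0r.
by rewrite IHm.
Qed.

Lemma scalar_exp_first kappa phi d : (0 < d)%N -> scalar_exp kappa phi ->
  (forall m, (0 < m < d)%N -> kappa m = 0) -> phi d = kappa d.
Proof.
case: d => // d _ [phi0 phir] k0.
have d0 : d.+1%:R != 0 :> K by rewrite pnatr_eq0.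
apply: (mulfI d0); rewrite phir /conv big_ord_recr /= subnn phi0 mulr1.
rewrite big1 ?add0r // => -[[|i] lti] _ /=; first by rewrite !mul0r.
by rewrite k0 ?mulr0 ?mul0r.
Qed.
End ScalarExp.

Section Oscillators.
Variables (K : numFieldType) (J : finType) (V : fockModel K (J * nat)%type).
Implicit Types (A : J -> J -> int -> K) (v w : J -> int -> K) (f g : V).

(** Commutation of the annihilators follows from the commutation relations, because
   they kill the cyclic vacuum. *)
Lemma annC x y f : ann V x (ann V y f) = ann V y (ann V x f).
Proof.
elim/vac_cyclic: f => [c f g Pf Pg| |z f Pf].
- by rewrite !linearP /= Pf Pg.
- by rewrite !ann_vac !linear0.
rewrite !ann_cre [ann V x (_ + _)]linearD [ann V y (_ + _)]linearD !ann_cre.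
rewrite [ann V x (_ *: _)]linearZ_LR [ann V y (_ *: _)]linearZ_LR Pf -!addrA.
by congr (_ + _); rewrite addrC.
Qed.

Definition lincomb (T : J -> {linear V -> V}) (c : J -> K) f : V :=
  \sum_l c l *: T l f.

Lemma lincomb_linear T c : linear (lincomb T c).
Proof.
move=> a f g; rewrite /lincomb scaler_sumr -big_split /=; apply: eq_bigr => l _.
by rewrite linearP scalerDr !scalerA mulrC.
Qed.

HB.instance Definition _ T c :=
  GRing.isLinear.Build K V V _ (lincomb T c) (lincomb_linear T c).

Lemma lincombC (T T' : J -> {linear V -> V}) c c' f : (forall l l' g, T l (T' l' g) = T' l' (T l g)) ->
  lincomb T c (lincomb T' c' f) = lincomb T' c' (lincomb T c f).
Proof.
move=> TT'; rewrite /lincomb.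
under eq_bigr do rewrite linear_sum scaler_sumr.
under [RHS]eq_bigr do rewrite linear_sum scaler_sumr.
rewrite exchange_big; apply: eq_bigr => l _; apply: eq_bigr => k _ /=.
by rewrite [T k (_ *: _)]linearZ_LR [T' l (_ *: _)]linearZ_LR TT' !scalerA mulrC.
Qed.

(** The coefficients of [z^m] and [z^-m] in the exponent of a vertex operator
   with oscillator part [v], for [m > 0]. *)
Definition creop v m : {linear V -> V} :=
  lincomb (fun j => cre V (j, m.-1)) (fun j => v j (- m%:Z)).

Definition anncoef A v (m : nat) l : K :=
  m%:R^-1 * \sum_j v j m%:Z * A j l m%:Z.

Definition annop A v m : {linear V -> V} :=
  lincomb (fun l => ann V (l, m.-1)) (anncoef A v m).

(** The coefficients of the exponent of the contraction of two vertex operators with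
   oscillator parts [v] and [w]. *)
Definition wickk A v w (m : nat) : K :=
  m%:R^-1 * \sum_l (\sum_j v j m%:Z * A j l m%:Z) * w l (- m%:Z).

Lemma creopC v w : commuting (creop v) (creop w).
Proof. by move=> i j g; apply: lincombC => l k h; rewrite creC. Qed.

Lemma annopC A v w : commuting (annop A v) (annop A w).
Proof. by move=> i j g; apply: lincombC => l k h; rewrite annC. Qed.

Lemma annop_creop A v w m m' g : (0 < m)%N -> (0 < m')%N ->
  annop A v m (creop w m' g) =
  creop w m' (annop A v m g) + (if m' == m then wickk A v w m *: g else 0).
Proof.
move=> m0 m'0; rewrite /= /lincomb.
under eq_bigr do rewrite linear_sum scaler_sumr.
under [X in _ = X + _]eq_bigr do rewrite linear_sum scaler_sumr.
rewrite [X in _ = X + _]exchange_big /=.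
pose P i j : V := w j (- m'%:Z) *: cre V (j, m'.-1)
     (anncoef A v m i *: ann V (i, m.-1) g).
pose Q (i j : J) : V := if (m' == m) && (i == j) then
   (anncoef A v m i * w i (- m%:Z)) *: g else 0.
transitivity (\sum_i \sum_j (P i j + Q i j)).
  apply: eq_bigr => i _; apply: eq_bigr => j _; rewrite /P /Q.
  rewrite [ann V _ (_ *: _)]linearZ_LR [cre V _ (_ *: _)]linearZ_LR ann_cre.
  rewrite !scalerDr !scalerA [w _ _ * _]mulrC.
  congr (_ + _); rewrite xpair_eqE.
  have -> : (m.-1 == m'.-1) = (m' == m) by apply/eqP/eqP; lia.
  case: (eqVneq m' m) => [->|_]; rewrite ?andbT ?andbF /= ?scale0r ?scaler0 //.
    by case: eqP => [->|_]; rewrite /= ?mulr1 ?mulr0 ?scale0r.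
  by rewrite !mulr0 scale0r.
rewrite (eq_bigr _ (fun i _ => big_split _ _ _ (P i) (Q i))) big_split /=.
congr (_ + _); rewrite {}/Q; case: eqP => _ /=; last first.
  by rewrite big1 // => i _; rewrite big1.
rewrite /wickk mulr_sumr scaler_suml; apply: eq_bigr => i _.
rewrite (bigD1 i) //= eqxx big1 ?addr0 /anncoef ?mulrA // => j /negPf ji.
by rewrite eq_sym ji.
Qed.

Definition cz v (s : int) f : V := expz (creop v) s f.
Definition an A v (t : nat) f : V := expseq (annop A v) t f.

Lemma cz_linear v s : linear (cz v s).
Proof. exact: expz_is_linear (@creopC v v). Qed.
Lemma an_linear A v t : linear (an A v t).
Proof. exact: expseq_is_linear (@annopC A v v). Qed.

HB.instance Definition _ v s :=
  GRing.isLinear.Build K V V _ (cz v s) (cz_linear v s).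
HB.instance Definition _ A v t :=
  GRing.isLinear.Build K V V _ (an A v t) (an_linear A v t).

Lemma cz_neg v (s : int) f : s < 0 -> cz v s f = 0.
Proof. exact: expz_neg. Qed.

Lemma czC v w s s' f : cz v s (cz w s' f) = cz w s' (cz v s f).
Proof.
case: s => s; last by rewrite !(cz_neg _ (s := Negz s)) ?linear0.
case: s' => s'; last by rewrite !(cz_neg _ (s := Negz s')) ?linear0.
apply: (expseq_comm (Y := cz v s)) => [|m g _]; first exact: creopC.
apply/esym; apply: (@expseq_comm _ _ (creop v) (creop w m)) => [|i h _].
  exact: creopC.
exact: creopC.
Qed.

Lemma anC A v w s t f : an A v s (an A w t f) = an A w t (an A v s f).
Proof.
apply: (expseq_comm (Y := an A v s)) => [|m g _]; first exact: annopC.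
apply/esym; apply: (@expseq_comm _ _ (annop A v) (annop A w m)) => [|i h _].
  exact: annopC.
exact: annopC.
Qed.

Lemma an_cz A v w phi a s f : scalar_exp (wickk A v w) phi ->
  an A v a (cz w s f) =
  conv (fun k b => phi k *: cz w (s - k%:Z) (an A v b f)) a.
Proof.
move=> phiP; rewrite /an /cz.
by rewrite (wick (@annopC A v v) (@creopC w w) (@annop_creop A v w) phiP).
Qed.

Lemma an_vac A v t : an A v t (vac V) = if t == 0%N then vac V else 0.
Proof.
case: t => [|t]; first by rewrite /an expseq0.
have an0 i b : annop A v i (an A v b (vac V)) = 0.
  rewrite (@expseq_comm _ _ (annop A v) (annop A v i)); last 2 first.
  - exact: annopC.
  - by move=> m g _; rewrite annopC.
  suff -> : annop A v i (vac V) = 0 by rewrite [LHS](linear0 (an A v b)).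
  by rewrite /= /lincomb big1 // => l _; rewrite ann_vac scaler0.
apply: (@natr_scaleI K V t.+1) => //; rewrite /an expseq_rec; last exact: annopC.
rewrite scaler0 (eq_conv (G := fun _ _ => 0)) ?/conv ?big1 // => a b _.
by rewrite [annop _ _ _ _]an0 scaler0.
Qed.

(** A single creation operator is a coefficient of a vertex operator, so that
   the Wick rule also governs its commutator with annihilators. *)
Definition unit_osc (l : J) (d : nat) : J -> int -> K :=
  fun j m => ((j == l) && (m == - d%:Z))%:R.

Lemma creop_unit l d m f : (0 < d)%N -> (0 < m)%N ->
  creop (unit_osc l d) m f = if m == d then cre V (l, d.-1) f else 0.
Proof.
move=> d0 m0; rewrite /= /lincomb (bigD1 l) //= /unit_osc eqxx /= eqr_opp.
rewrite big1 ?addr0 => [|j /negPf->]; last by rewrite scale0r.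
by rewrite eqz_nat; case: eqP => [->|_]; rewrite ?scale1r ?scale0r.
Qed.

Lemma cz_unit l d f : (0 < d)%N -> cz (unit_osc l d) d%:Z f = cre V (l, d.-1) f.
Proof.
move=> d0; apply: (@natr_scaleI K V d) => //.
rewrite /cz /= expseq_rec; last exact: creopC.
rewrite (eq_conv (G := fun a b => if a == d then d%:R *: cre V (l, d.-1)
   (expseq (creop (unit_osc l d)) b f) else 0)); last first.
  move=> [|a] b abd; first by rewrite scale0r; case: eqP => // d0'; rewrite -d0' in d0.
  by rewrite creop_unit //; case: eqP => [->|_]; rewrite ?scaler0.
by rewrite conv_delta leqnn subnn expseq0.
Qed.

(** Annihilators of high degree kill a given polynomial, so that every sum over the
   modes of a vertex operator is finite. *)
Lemma an_nilp A v f : exists N, forall t, (N <= t)%N -> an A v t f = 0.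
Proof.
elim/vac_cyclic: f => [c f g [N fN] [M gM]| |[l k] f [N fN]].
- exists (maxn N M) => t; rewrite geq_max => /andP[Nt Mt].
  by rewrite linearP /= fN // gM // scaler0 addr0.
- by exists 1%N => -[] // t _; rewrite an_vac.
exists (N + k.+1)%N => t Nt; have [phi phiP] := scalar_exp_exists
  (wickk A v (unit_osc l k.+1)).
rewrite -[cre _ _ _](@cz_unit l k.+1) // (an_cz _ _ _ phiP).
rewrite /conv big1 // => -[i lti] _ /=.
case: (leqP i k.+1) => ik; first by rewrite fN ?linear0 ?scaler0 //; lia.
by rewrite cz_neg ?scaler0 //; lia.
Qed.

Lemma an_cre_vac A v l d : (0 < d)%N ->
  an A v d (cre V (l, d.-1) (vac V)) = anncoef A v d l *: vac V /\
  forall t, (d < t)%N -> an A v t (cre V (l, d.-1) (vac V)) = 0.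
Proof.
move=> d0; have [phi phiP] := scalar_exp_exists (wickk A v (unit_osc l d)).
have H t : an A v t (cre V (l, d.-1) (vac V)) =
    phi t *: cz (unit_osc l d) (d%:Z - t%:Z) (vac V).
  rewrite -cz_unit // (an_cz _ _ _ phiP) convC.
  rewrite (eq_conv (G := fun b k => if b == 0%N then
    phi k *: cz (unit_osc l d) (d%:Z - k%:Z) (vac V) else 0)).
    by rewrite conv_delta subn0.
  by move=> b k _; rewrite an_vac; case: eqP => _ //; rewrite linear0 scaler0.
have wk m : wickk A v (unit_osc l d) m = if m == d then anncoef A v d l else 0.
  rewrite /wickk [X in _ * X](bigD1 l) //= [X in _ + X]big1; last first.
    by move=> j /negPf jl; rewrite /unit_osc jl mulr0.
  rewrite addr0 /unit_osc eqxx /= eqr_opp eqz_nat.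
  by case: eqP => [->|_]; rewrite ?mulr1 // !mulr0.
split=> [|t dt]; last by rewrite H cz_neg ?scaler0 //; lia.
rewrite H subrr /cz /= expseq0 (scalar_exp_first d0 phiP) ?wk ?eqxx // => m.
by rewrite wk => /andP[_ md]; rewrite ltn_eqF.
Qed.

(** In each degree the new coefficients enter linearly, and the products of those of
   lower degree are known by induction; annihilators read off the difference. *)
Lemma cz_vac_inj v w : (forall d : nat, cz v d%:Z (vac V) = cz w d%:Z (vac V)) ->
  forall j (d : nat), (0 < d)%N -> v j (- d%:Z) = w j (- d%:Z).
Proof.
move=> vw j d; elim/ltn_ind: d j => -[//|d] IHd j _.
have main u : d.+1%:R *: cz u d.+1%:Z (vac V) =
    \sum_(i < d.+1) i%:R *: creop u i (cz u (d.+1 - i)%N%:Z (vac V)) +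
    d.+1%:R *: creop u d.+1 (vac V).
  rewrite /cz /= expseq_rec; last exact: creopC.
  by rewrite /conv big_ord_recr /= subnn expseq0.
have := main v; rewrite vw main.
rewrite (eq_bigr (fun i : 'I_d.+1 => i%:R *: creop v i
   (cz v (d.+1 - i)%N%:Z (vac V)))); last first.
  move=> [[|i] lti] _; first by rewrite !scale0r.
  rewrite -vw; congr (_ *: _); rewrite /= /lincomb; apply: eq_bigr => k _.
  by rewrite (IHd i.+1).
move/addrI/natr_scaleI => /(_ isT) /(congr1 (ann V (j, d))).
have annv u : ann V (j, d) (creop u d.+1 (vac V)) = u j (- d.+1%:Z) *: vac V.
  rewrite /= /lincomb linear_sum (bigD1 j) //= big1 ?addr0 => [|k kj].
    by rewrite linearZ_LR ann_cre ann_vac linear0 add0r eqxx scale1r.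
  rewrite linearZ_LR ann_cre ann_vac linear0 add0r xpair_eqE eq_sym (negPf kj).
  by rewrite scale0r scaler0.
rewrite !annv => /eqP; rewrite -subr_eq0 -scalerBl scaler_eq0.
by rewrite (negPf (vac_neq0 V)) orbF subr_eq0 => /eqP.
Qed.

(** [: V(z) W(w) :] on the curve [w = z / c]. *)
Definition fuse v w (c : K) : J -> int -> K := fun j m => v j m + c ^ m * w j m.

Lemma an_fuse A v w c t f :
  an A (fuse v w c) t f = conv (fun a b => c ^+ b *: an A v a (an A w b f)) t.
Proof.
pose Y m : {linear V -> V} := annop A (fun j m => c ^ m * w j m) m.
have YE m g : Y m g = c ^+ m *: annop A w m g.
  rewrite /= /lincomb scaler_sumr; apply: eq_bigr => l _; rewrite scalerA.
  congr (_ *: _); rewrite /anncoef mulrCA; congr (_ * _).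
  by rewrite mulr_sumr; apply: eq_bigr => j _; rewrite mulrA.
rewrite /an (@expseqD _ _ (annop A v) Y); [|exact: annopC..|].
  apply: eq_conv => a b _; rewrite (@expseq_scale _ _ (annop A w) Y c) //.
    by rewrite [LHS](linearZ_LR (an A v a)).
  exact: annopC.
move=> m g _; rewrite /= /lincomb -big_split /=; apply: eq_bigr => l _.
rewrite -scalerDl /anncoef -mulrDr -big_split /=; congr (_ * _ *: _).
by apply: eq_bigr => j _; rewrite mulrDl.
Qed.

Lemma cz_fuse v w c (t : nat) f :
  cz (fuse v w c) t%:Z f =
  conv (fun a b => c ^- b *: cz v a%:Z (cz w b%:Z f)) t.
Proof.
pose Y m : {linear V -> V} := creop (fun j m => c ^ m * w j m) m.
have YE m g : (0 < m)%N -> Y m g = c^-1 ^+ m *: creop w m g.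
  case: m => // m _; rewrite /= /lincomb scaler_sumr; apply: eq_bigr => l _.
  by rewrite scalerA exprVn.
rewrite /cz /= (@expseqD _ _ (creop v) Y); [|exact: creopC..|].
  apply: eq_conv => a b _; rewrite (@expseq_scale _ _ (creop w) Y c^-1) //.
    by rewrite [LHS](linearZ_LR (cz v a%:Z)) exprVn.
  exact: creopC.
move=> m g _; rewrite /= /lincomb -big_split /=; apply: eq_bigr => l _.
by rewrite -scalerDl.
Qed.

End Oscillators.

(** * Modes of vertex operators *)

Arguments cz : simpl never.
Arguments an : simpl never.

Lemma sum_conv_triangle (V : nmodType) (F : nat -> nat -> V) T :
  \sum_(t < T) conv F t = \sum_(k < T) \sum_(c < T - k) F k c.
Proof.
elim: T => [|T IHT]; first by rewrite !big_ord0.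
rewrite big_ord_recr /= IHT [RHS]big_ord_recr /= subSnn big_ord1.
rewrite /conv big_ord_recr /= subnn addrA; congr (_ + _).
rewrite -big_split; apply: eq_bigr => k _ /=.
by rewrite subSn ?big_ord_recr // ltnW.
Qed.

Lemma sum_ord_trunc (V : nmodType) (F : nat -> V) M N :
  (N <= M)%N -> (forall i, (N <= i)%N -> F i = 0) ->
  \sum_(i < M) F i = \sum_(i < N) F i.
Proof.
move=> NM F0; rewrite -(subnKC NM) big_split_ord /= [X in _ + X]big1 ?addr0 //.
by move=> i _; rewrite F0 // leq_addr.
Qed.

Lemma sum_conv_box (V : nmodType) (F : nat -> nat -> V) K N T :
  (K + N <= T)%N -> (forall k c, (K <= k)%N -> F k c = 0) ->
  (forall k c, (N <= c)%N -> F k c = 0) ->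
  \sum_(t < T) conv F t = \sum_(k < K) \sum_(c < N) F k c.
Proof.
move=> KNT FK FN; rewrite sum_conv_triangle.
rewrite (sum_ord_trunc (N := K) (F := fun k => \sum_(c < T - k) F k c)); last 2 first.
- lia.
- by move=> k Kk; rewrite big1 // => c _; rewrite FK.
apply: eq_bigr => k _; apply: (sum_ord_trunc (F := F k)); last exact: FN.
by have := ltn_ord k; lia.
Qed.

Lemma sum_shift (V : nmodType) (G : int -> V) (q S M : nat) :
  (S + q <= M)%N -> (forall m : int, ~~ (0 <= m < S%:Z) -> G m = 0) ->
  \sum_(i < M) G (i%:Z - q%:Z) = \sum_(i < S) G i%:Z.
Proof.
move=> SqM G0; have -> : M = (q + (S + (M - S - q)))%N by lia.
rewrite big_split_ord /= big1 ?add0r; last first.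
  by move=> i _; apply: G0; have := ltn_ord i; lia.
rewrite big_split_ord /= [X in _ + X]big1 ?addr0; last first.
  by move=> i _; apply: G0; lia.
by apply: eq_bigr => i _; congr G; lia.
Qed.

Lemma fsum_param (V : nmodType) (T P : choiceType) (r : seq P) (h : P -> T)
    (S : set T) (F : T -> V) :
  uniq r -> {in r &, injective h} -> (forall p, p \in r -> S (h p)) ->
  (forall t, S t -> F t != 0 -> exists2 p, p \in r & t = h p) ->
  \sum_(t \in S) F t = \sum_(p <- r) F (h p).
Proof.
move=> ur hi rS Sr; rewrite (fsbigE [seq h p | p <- r]).
- rewrite big_map big_seq_cond [RHS]big_seq; apply: eq_bigl => p.
  by case pr: (p \in r) => //=; rewrite mem_set //; exact: rS.
- by rewrite map_inj_in_uniq.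
- by move=> _ /= /mapP[p pr ->]; exact: rS.
move=> t St /negP tr; apply/eqP/negPn/negP => Ft; apply: tr.
by have [p pr ->] := Sr t St Ft; apply: map_f.
Qed.

Lemma fsum_nat (V : nmodType) (F : nat -> V) N :
  (forall k, (N <= k)%N -> F k = 0) ->
  \sum_(k \in [set: nat]) F k = \sum_(k < N) F k.
Proof.
move=> F0; rewrite (fsum_param (r := iota 0 N) (h := id)) ?iota_uniq //.
  by rewrite -[X in iota 0 X]subn0 -/(index_iota _ _) big_mkord.
move=> k _ Fk; exists k => //; rewrite mem_iota add0n /= ltnNge.
by apply: contra Fk => /F0 ->.
Qed.

Lemma fsum_int (V : nmodType) (F : int -> V) (q M : nat) :
  (forall m : int, ~~ (0 <= m + q%:Z < M%:Z) -> F m = 0) ->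
  \sum_(m \in [set: int]) F m = \sum_(i < M) F (i%:Z - q%:Z).
Proof.
move=> F0; rewrite (fsum_param (r := iota 0 M) (h := fun i : nat => i%:Z - q%:Z)).
- by rewrite -[X in iota 0 X]subn0 -/(index_iota _ _) big_mkord.
- exact: iota_uniq.
- by move=> i j _ _; lia.
- by [].
move=> m _ Fm; have mM : 0 <= m + q%:Z < M%:Z.
  by apply: contraT => /F0 m0; rewrite m0 eqxx in Fm.
exists (absz (m + q%:Z)); last lia.
by rewrite mem_iota; lia.
Qed.

Section Modes.
Variables (K : numFieldType) (J : finType) (V : fockModel K (J * nat)%type).
Variable A : J -> J -> int -> K.
Implicit Types (v w : J -> int -> K) (f g : V) (s z e : K) (a b : int).

(** The modes of a vertex operator on one Fock module depend on its symbol only through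
   the oscillator part [v], the scalar [s] of the zero modes and the exponent [z] of the
   leading power. *)
Definition gvm s z v e f : V :=
  s *: \sum_(t \in [set t : nat * nat | z + t.1%:R - t.2%:R = e])
    cz v t.1%:Z (an A v t.2 f).

Definition gnm s z v z' w e e' f : V :=
  s *: \sum_(t \in [set t : (nat * nat) * (nat * nat) |
                 z + t.1.1%:R - t.1.2%:R = e /\ z' + t.2.1%:R - t.2.2%:R = e'])
      cz v t.1.1%:Z (cz w t.2.1%:Z (an A v t.1.2 (an A w t.2.2 f))).

Lemma mode_int z a (t1 t2 : nat) :
  z + t1%:R - t2%:R = z + a%:~R <-> t1%:Z = a + t2%:Z.
Proof.
split=> [/eqP|t1E]; last first.
  by rewrite -[t1%:R]/(t1%:Z%:~R) t1E intrD addrA addrK.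
rewrite -addrA (inj_eq (addrI z)) subr_eq => /eqP t1E.
by apply: (@intr_inj K); rewrite intrD.
Qed.

Lemma gvm_int s z v a N f : (forall t, (N <= t)%N -> an A v t f = 0) ->
  gvm s z v (z + a%:~R) f = s *: \sum_(t < N) cz v (a + t%:Z) (an A v t f).
Proof.
move=> fN; congr (_ *: _).
pose r := [seq t <- iota 0 N | 0 <= a + t%:Z].
rewrite (fsum_param (r := r) (h := fun t => (absz (a + t%:Z), t))).
- rewrite big_filter -[X in iota 0 X]subn0 -/(index_iota _ _) big_mkord.
  rewrite big_mkcond; apply: eq_bigr => t _ /=.
  case: ifP => [at0|/negbT at0]; first by rewrite gez0_abs.
  by rewrite cz_neg //; lia.
- by rewrite filter_uniq ?iota_uniq.
- by move=> t t' _ _ [].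
- by move=> t; rewrite mem_filter => /andP[at0 _] /=; apply/mode_int; lia.
move=> [t1 t2] /= /mode_int t1E F0; exists t2; last by congr pair; lia.
rewrite mem_filter mem_iota /= ltnNge; apply/andP; split; first lia.
by apply: contra F0 => /fN ->; rewrite linear0.
Qed.

Lemma gvm_nonint s z v e f : (forall a, e <> z + a%:~R) -> gvm s z v e f = 0.
Proof.
move=> ez; rewrite /gvm fsbig1 ?scaler0 // => -[t1 t2] /= et.
case: (ez (t1%:Z - t2%:Z)); rewrite -et -addrA; congr (_ + _).
by rewrite intrB.
Qed.

Lemma gnm_int s z v z' w a b N f : (forall t, (N <= t)%N -> an A w t f = 0) ->
  (forall t d, (N <= t)%N -> an A v t (an A w d f) = 0) ->
  gnm s z v z' w (z + a%:~R) (z' + b%:~R) f =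
  s *: \sum_(c < N) \sum_(d < N)
    cz v (a + c%:Z) (cz w (b + d%:Z) (an A v c (an A w d f))).
Proof.
move=> fN gN; congr (_ *: _).
pose r := [seq p <- [seq (c, d) | c <- iota 0 N, d <- iota 0 N] |
            (0 <= a + p.1%:Z) && (0 <= b + p.2%:Z)].
rewrite (fsum_param (r := r)
  (h := fun p : nat * nat => ((absz (a + p.1%:Z), p.1), (absz (b + p.2%:Z), p.2)))).
- rewrite big_filter big_mkcond big_allpairs.
  rewrite -[X in iota 0 X]subn0 -/(index_iota _ _) big_mkord.
  apply: eq_bigr => c _; rewrite big_mkord; apply: eq_bigr => d _ /=.
  case: (ltP (a + c%:Z) 0) => [ac|ac] /=; first by rewrite cz_neg.
  case: (ltP (b + d%:Z) 0) => [bd|bd] /=; first by rewrite [cz w _ _]cz_neg ?linear0.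
  by rewrite !gez0_abs.
- rewrite filter_uniq // allpairs_uniq ?iota_uniq //.
  by move=> [? ?] [? ?] _ _ [-> ->].
- by move=> [c d] [c' d'] _ _ [_ -> _ ->].
- move=> [c d]; rewrite mem_filter /= => /andP[/andP[ac bd] _].
  by split; apply/mode_int; lia.
move=> [[t1 t2] [u1 u2]] /= [/mode_int tE /mode_int uE] F0.
exists (t2, u2); last by rewrite /= -tE -uE.
rewrite mem_filter /=; apply/andP; split; first by apply/andP; split; lia.
apply: allpairs_f; rewrite mem_iota /= ltnNge.
  by apply: contra F0 => t2N; rewrite gN ?linear0.
by apply: contra F0 => u2N; rewrite fN ?linear0.
Qed.

Lemma gnm_nonint1 s z v z' w e e' f :
  (forall a, e <> z + a%:~R) -> gnm s z v z' w e e' f = 0.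
Proof.
move=> ez; rewrite /gnm fsbig1 ?scaler0 // => -[[t1 t2] ?] /= [et _].
case: (ez (t1%:Z - t2%:Z)); rewrite -et -addrA; congr (_ + _).
by rewrite intrB.
Qed.

Lemma gnm_nonint2 s z v z' w e e' f :
  (forall a, e' <> z' + a%:~R) -> gnm s z v z' w e e' f = 0.
Proof.
move=> ez; rewrite /gnm fsbig1 ?scaler0 // => -[? [t1 t2]] /= [_ et].
case: (ez (t1%:Z - t2%:Z)); rewrite -et -addrA; congr (_ + _).
by rewrite intrB.
Qed.

Lemma gnmC s z v z' w e e' f :
  gnm s z v z' w e e' f = gnm s z' w z v e' e f.
Proof.
congr (_ *: _); rewrite (reindex_fsbig (fun t : (nat * nat) * (nat * nat) => (t.2, t.1))
  [set t : (nat * nat) * (nat * nat) | z' + t.1.1%:R - t.1.2%:R = e' /\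
      z + t.2.1%:R - t.2.2%:R = e]).
  by apply: eq_fsbigr => t _ /=; rewrite czC anC.
split=> [t [] //|t t' _ _ [] |[t t'] [/= te te']].
  by case: t t' => [? ?] [? ?] /= -> ->.
by exists (t', t).
Qed.

Lemma mode_intP z e : (exists a, e = z + a%:~R) \/ (forall a, e <> z + a%:~R).
Proof.
case: (pselect (exists a, e = z + a%:~R)) => [?|ne]; first by left.
by right => a ea; apply: ne; exists a.
Qed.

Lemma an_nilp2 v w f : exists N, (forall t, (N <= t)%N -> an A w t f = 0) /\
  (forall t d, (N <= t)%N -> an A v t (an A w d f) = 0).
Proof.
have [N fN] := an_nilp A w f.
have [M fM] : exists M, forall d t, (d < N)%N -> (M <= t)%N ->
    an A v t (an A w d f) = 0.
  elim: {fN}N => [|N [M fM]]; first by exists 0%N.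
  have [M' fM'] := an_nilp A v (an A w N f).
  exists (maxn M M') => d t; rewrite ltnS leq_eqVlt geq_max.
  by case/orP => [/eqP->|dN] /andP[Mt M't]; [exact: fM'|exact: fM].
exists (maxn N M); split=> [t|t d]; rewrite geq_max => /andP[Nt Mt].
  exact: fN.
by case: (ltnP d N) => dN; [exact: fM|rewrite fN ?linear0].
Qed.

(** The Wick rule, summed over the modes; both sides are finite sums after
   [an_nilp2]. *)
Lemma gvm_contraction s z v s' z' w phi e e' f :
  scalar_exp (wickk A v w) phi ->
  gvm s z v e (gvm s' z' w e' f) =
  \sum_(k \in [set: nat]) phi k *:
    gnm (s * s') z v z' w (e + k%:R) (e' - k%:R) f.
Proof.
move=> phiP; have [[b ->{e'}]|ne'] := mode_intP z' e'; last first.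
  rewrite [gvm s' _ _ _ _]gvm_nonint // [RHS]fsbig1 => [|k _]; last first.
    rewrite gnm_nonint2 ?scaler0 // => a ea.
    by apply: (ne' (a + k%:Z)); rewrite intrD addrA -ea subrK.
  by rewrite /gvm fsbig1 ?scaler0 // => t _; rewrite !linear0.
have [[a ->{e}]|ne] := mode_intP z e; last first.
  rewrite gvm_nonint // fsbig1 // => k _; rewrite gnm_nonint1 ?scaler0 // => a ea.
  by apply: (ne (a - k%:Z)); rewrite intrB addrA -ea addrK.
have [N [fN gN]] := an_nilp2 v w f.
rewrite (gvm_int _ _ _ fN).
set g := s' *: _; have [N2 gN2] := an_nilp A v g.
pose M := (absz b + N)%N; pose T := (N2 + (M + N))%N.
have gT t : (T <= t)%N -> an A v t g = 0 by move=> Tt; rewrite gN2 // /T; lia.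
rewrite (gvm_int _ _ _ gT).
pose G d k c := phi k *: cz v (a + (k + c)%N%:Z)
   (cz w (b + d%:Z - k%:Z) (an A v c (an A w d f))).
have -> : \sum_(t < T) cz v (a + t%:Z) (an A v t g) =
    s' *: \sum_(d < N) \sum_(t < T) conv (G d) t.
  rewrite exchange_big scaler_sumr; apply: eq_bigr => t _ /=.
  rewrite [an A v t g]linearZ_LR [cz v _ _]linearZ_LR; congr (_ *: _).
  rewrite (linear_sum (an A v t)) (linear_sum (cz v (a + t%:Z))).
  apply: eq_bigr => d _ /=.
  rewrite (an_cz _ _ _ phiP) (conv_linear (cz v _)); apply: eq_conv => k c <-.
  by rewrite linearZ_LR.
rewrite scalerA (fsum_nat (N := M)); last first.
  move=> k Mk; rewrite -[k%:R]/(k%:Z%:~R) -addrA -intrD -addrA -intrB.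
  rewrite (gnm_int _ _ _ _ _ fN gN) big1 ?scaler0 // => c _.
  rewrite big1 // => d _; rewrite [cz w _ _]cz_neg ?linear0 //.
  by have := ltn_ord d; rewrite /M in Mk; lia.
transitivity ((s * s') *: \sum_(d < N) \sum_(k < M) \sum_(c < N) G d k c).
  congr (_ *: _); apply: eq_bigr => d _; apply: sum_conv_box.
  - by rewrite /T; lia.
  - move=> k c Mk; rewrite /G [cz w _ _]cz_neg ?linear0 ?scaler0 //.
    by have := ltn_ord d; rewrite /M in Mk; lia.
  - by move=> k c Nc; rewrite /G gN ?linear0 ?scaler0.
rewrite exchange_big scaler_sumr; apply: eq_bigr => k _ /=.
rewrite -[k%:R]/(k%:Z%:~R) -addrA -intrD -addrA -intrB.
rewrite (gnm_int _ _ _ _ _ fN gN) exchange_big [RHS]scalerA [phi k * _]mulrC -[RHS]scalerA.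
congr (_ *: _); rewrite scaler_sumr; apply: eq_bigr => c _.
rewrite scaler_sumr; apply: eq_bigr => d _; rewrite /G PoszD.
by congr (_ *: cz _ _ (cz _ _ _)); lia.
Qed.

Lemma gnm_scale s s' z v z' w e e' f :
  gnm (s * s') z v z' w e e' f = s *: gnm s' z v z' w e e' f.
Proof. by rewrite /gnm scalerA. Qed.

(** On the vacuum the coefficient of [z^(zeta-d) w^(zeta'+d)] of a product
   sees only the [d]-th coefficient of the contraction. *)
Lemma gnm_vac s z v z' w (k d : nat) :
  gnm s z v z' w (z - d%:R + k%:R) (z' + d%:R - k%:R) (vac V) =
  if k == d then s *: vac V else 0.
Proof.
have -> : z - d%:R + k%:R = z + (k%:Z - d%:Z)%:~R :> K.
  by rewrite intrB; ring.
have -> : z' + d%:R - k%:R = z' + (d%:Z - k%:Z)%:~R :> K.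
  by rewrite intrB; ring.
rewrite (gnm_int _ _ _ _ _ (N := 1)) => [|t t0|t c t0]; last 2 first.
- by rewrite an_vac; case: t t0.
- by rewrite an_vac; case: eqP => _; rewrite ?linear0 // an_vac; case: t t0.
rewrite !big_ord1 !an_vac !addr0; case: (ltngtP k d) => kd.
- by rewrite cz_neg ?scaler0 //; lia.
- by rewrite [cz w _ _]cz_neg ?linear0 ?scaler0 //; lia.
by rewrite kd subrr /cz /= !expseq0.
Qed.

(** Apply both sides to the vacuum, where [gnm_vac] isolates each coefficient. *)
Lemma gvm_contraction_unique s z v s' z' w s2 c psi phi :
  s2 != 0 -> s * s' = c * s2 -> scalar_exp (wickk A v w) psi ->
  (forall e e' f, gvm s z v e (gvm s' z' w e' f) =
     \sum_(k \in [set: nat]) phi k *: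
       gnm s2 z v z' w (e + k%:R) (e' - k%:R) f) ->
  forall d, phi d = c * psi d.
Proof.
move=> s20 ss psiP phiP d; have := phiP (z - d%:R) (z' + d%:R) (vac V).
rewrite (gvm_contraction _ _ _ _ _ _ _ psiP).
have sumE (chi : nat -> K) s3 : \sum_(k \in [set: nat]) chi k *:
   gnm s3 z v z' w (z - d%:R + k%:R) (z' + d%:R - k%:R) (vac V) =
   chi d *: (s3 *: vac V).
  rewrite (fsum_nat (N := d.+1)); last first.
    by move=> k dk; rewrite gnm_vac; case: eqP => [kd|_]; rewrite ?scaler0 //; lia.
  rewrite big_ord_recr /= gnm_vac eqxx big1 ?add0r // => k _.
  by rewrite gnm_vac ltn_eqF ?scaler0.
rewrite !sumE ss !scalerA => /eqP; rewrite -subr_eq0 -scalerBl scaler_eq0.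
rewrite (negPf (vac_neq0 V)) orbF subr_eq0 mulrA => /eqP/(mulIf s20) <-.
exact: mulrC.
Qed.

(** Putting [w = z / c] in a normal ordered product merges the two exponents. *)
Lemma gnm_fuse s v z w c b f : c != 0 ->
  \sum_(m \in [set: int]) c ^ (m - b) *:
     gnm s 0 v z w m%:~R (z + b%:~R - m%:~R) f =
  gvm s z (fuse v w c) (z + b%:~R) f.
Proof.
move=> c0; have [N [fN gN]] := an_nilp2 v w f.
have [N2 fN2] := an_nilp A (fuse v w c) f.
pose M := (absz b + N + N + N)%N; pose T := (N2 + (N + N))%N.
have fT t : (T <= t)%N -> an A (fuse v w c) t f = 0.
  by move=> Tt; rewrite fN2 //; move: Tt; rewrite /T; lia.
rewrite (gvm_int _ _ _ fT).
have nmE (m : int) : gnm s 0 v z w m%:~R (z + b%:~R - m%:~R) f =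
  s *: \sum_(c < N) \sum_(d < N)
    cz v (m + c%:Z) (cz w (b - m + d%:Z) (an A v c (an A w d f))).
  have m0 : m%:~R = 0 + m%:~R :> K by rewrite add0r.
  by rewrite {1}m0 -[z + _ - _]addrA -intrB (gnm_int _ _ _ _ _ fN gN).
rewrite (fsum_int (q := N) (M := M)); last first.
  move=> m mM; rewrite nmE big1 ?scaler0 // => i _; rewrite big1 // => d _.
  have := ltn_ord i; have := ltn_ord d; rewrite /M in mM => dN iN.
  case: (ltP (m + i%:Z) 0) => mi; first by rewrite cz_neg.
  by rewrite [cz w _ _]cz_neg ?linear0 //; lia.
transitivity (s *: \sum_(i < N) \sum_(d < N) c ^+ d *:
    cz (fuse v w c) (b + (i + d)%N%:Z) (an A v i (an A w d f))).
  rewrite (eq_bigr (fun m : 'I_M => s *: \sum_(i < N) \sum_(d < N)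
     c ^ (m%:Z - N%:Z - b) *: cz v (m%:Z - N%:Z + i%:Z)
        (cz w (b - (m%:Z - N%:Z) + d%:Z) (an A v i (an A w d f)))));
    last first.
    move=> m _; rewrite nmE scalerA mulrC -scalerA; congr (_ *: _).
    rewrite scaler_sumr; apply: eq_bigr => i _; rewrite scaler_sumr.
    exact: eq_bigr.
  rewrite -scaler_sumr; congr (_ *: _).
  rewrite exchange_big; apply: eq_bigr => i _; rewrite exchange_big.
  apply: eq_bigr => d _ /=; set h := an A v i _.
  have := ltn_ord i; have := ltn_ord d => dN iN.
  case: (ltP (b + (i + d)%N%:Z) 0) => bid.
    rewrite [in RHS]cz_neg // scaler0 big1 // => m _.
    case: (ltP (m%:Z - N%:Z + i%:Z) 0) => mi; first by rewrite cz_neg ?scaler0.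
    by rewrite [cz w _ _]cz_neg ?linear0 ?scaler0 //; lia.
  have [S SE] : exists S : nat, b + (i + d)%N%:Z = S%:Z.
    by exists (absz (b + (i + d)%N%:Z)); rewrite gez0_abs.
  rewrite SE cz_fuse scaler_sumr.
  pose G (m : int) := c ^ (m - S%:Z + d%:Z) *: cz v m (cz w (S%:Z - m) h).
  rewrite (eq_bigr (fun m : 'I_M => G (m%:Z - (N - i)%N%:Z))); last first.
    move=> m _; rewrite /G.
    by congr (c ^ _ *: cz _ _ (cz _ _ _)); lia.
  rewrite (sum_shift (S := S.+1)) => [|| m mS]; last 2 first.
  - by rewrite /M; lia.
  - rewrite /G; case: (ltP m 0) => m0; first by rewrite cz_neg ?scaler0.
    by rewrite [cz w _ _]cz_neg ?linear0 ?scaler0 //; lia.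
  apply: eq_bigr => m _; have mS : (m <= S)%N by rewrite -ltnS.
  rewrite /G scalerA; congr (_ *: cz _ _ (cz _ _ _)); last by lia.
  rewrite addrC expfzDr // -exprnP; congr (_ * _).
  by rewrite exprnN; congr (c ^ _); lia.
congr (_ *: _).
pose G (b' d : nat) := c ^+ d *:
  cz (fuse v w c) (b + (b' + d)%N%:Z) (an A v b' (an A w d f)).
rewrite -[LHS]/(\sum_(i < N) \sum_(d < N) G i d) -(@sum_conv_box _ G N N T).
- apply: eq_bigr => t _; rewrite an_fuse (conv_linear (cz _ _)); apply: eq_conv => i d <-.
  by rewrite linearZ_LR.
- by rewrite /T; lia.
- by move=> i d Ni; rewrite /G gN ?linear0 ?scaler0.
- by move=> i d Nd; rewrite /G fN ?linear0 ?scaler0.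
Qed.
End Modes.

(** * Expansions of rational functions *)

Section PowerSeries.
Variable K : numFieldType.
Implicit Types (d : nat -> K) (c p q u : K).

(** A power series which tends to [0] on a disk has no first nonzero
   coefficient: near the centre that term would dominate the others. *)
Lemma power_series_eq0 d (r : K) : 0 < r ->
  (forall u, `|u| < r -> forall eps, 0 < eps -> exists N0, forall N,
     (N0 <= N)%N -> `|\sum_(k < N) d k * u ^+ k| < eps) ->
  forall k, d k = 0.
Proof.
move=> r0 dr; apply: contrapT => /existsNP[k0 /eqP dk0].
have [k dk kmin] := ex_minnP (ex_intro (fun k => d k != 0) k0 dk0).
pose u0 := r / 2; have u00 : 0 < u0 by rewrite divr_gt0.
have u0r : `|u0| < r.
  by rewrite gtr0_norm // /u0 ltr_pdivrMr // ltr_pMr // ltr1n.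
have [M M0 dM] : exists2 M, 0 <= M & forall i, `|d i * u0 ^+ i| <= M.
  have [N0 dN0] := dr _ u0r 1 ltr01.
  have small i : (N0 <= i)%N -> `|d i * u0 ^+ i| <= 2.
    move=> Ni; have -> : d i * u0 ^+ i =
      \sum_(k < i.+1) d k * u0 ^+ k - \sum_(k < i) d k * u0 ^+ k.
      by rewrite big_ord_recr /= addrAC subrr add0r.
    apply: le_trans (ler_normB _ _) _; rewrite -[2]/(1 + 1).
    by apply: lerD; apply/ltW/dN0; [exact: leqW|].
  exists (2 + \sum_(i < N0) `|d i * u0 ^+ i|).
    by apply: addr_ge0 => //; apply: sumr_ge0.
  move=> i; case: (leqP N0 i) => [/small Ni|iN0].
    by apply: le_trans Ni _; rewrite lerDl sumr_ge0.
  rewrite (bigD1 (Ordinal iN0)) //= addrCA lerDl addr_ge0 //.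
  exact: sumr_ge0.
pose c := `|d k * u0 ^+ k|.
have c0 : 0 < c by rewrite normr_gt0 mulf_neq0 // expf_neq0 // gt_eqF.
pose t := c / (4 * (M + c)).
have Mc : 0 < M + c by rewrite ltr_wpDl.
have t0 : 0 < t by rewrite divr_gt0 // mulr_gt0.
have t4 : t <= 4^-1.
  rewrite /t ler_pdivrMr ?mulr_gt0 // mulrA mulVf ?mul1r ?lerDr //.
have tr : `|u0 * t| < r.
  rewrite normrM; apply: le_lt_trans u0r; rewrite ler_piMr //.
  by rewrite gtr0_norm // (le_trans t4) // invf_le1 ?ler1n // ltr0n.
have tN i : `|t ^+ i| = t ^+ i by rewrite ger0_norm // exprn_ge0 // ltW.
have tail N : `|\sum_(i < N) d (k.+1 + i)%N * (u0 * t) ^+ (k.+1 + i)%N|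
    <= M * 2 * t ^+ k.+1.
  apply: le_trans (ler_norm_sum _ _ _) _.
  apply: (@le_trans _ _ (\sum_(i < N) M * t ^+ k.+1 * 2^-1 ^+ i)).
    apply: ler_sum => i _; rewrite exprMn mulrA normrM tN.
    rewrite [t ^+ _]exprD -[X in _ <= X]mulrA; apply: ler_pM => //.
      by rewrite mulr_ge0 // exprn_ge0 // ltW.
    rewrite ler_pM2l ?exprn_gt0 //; apply: lerXn2r; rewrite ?nnegrE ?invr_ge0 ?ltW //.
    by rewrite (le_lt_trans t4) // ltf_pV2 ?posrE // ltr_nat.
  rewrite -mulr_sumr [X in _ <= X]mulrAC ler_wpM2l //.
    by rewrite mulr_ge0 // exprn_ge0 // ltW.
  elim: N => [|N IHN]; first by rewrite big_ord0.
  rewrite big_ord_recl expr0; under eq_bigr do rewrite exprS.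
  rewrite -mulr_sumr -[X in _ <= X]/(1 + 1) lerD2l.
  by rewrite -(ler_pM2l (ltr0n K 2)) mulrA divff ?pnatr_eq0 // mul1r mulr1.
have eps0 : 0 < t ^+ k.+1 * c by rewrite mulr_gt0 // exprn_gt0.
have [N0 HN0] := dr _ tr _ eps0.
have := HN0 (k.+1 + N0)%N (leq_addl _ _); apply/negP; rewrite -real_leNgt //; last first.
  by rewrite ger0_real // ltW.
rewrite big_split_ord /= big_ord_recr /= big1 ?add0r => [|i _]; last first.
  have : d i = 0 by apply/eqP; apply: contraT => /kmin; rewrite leqNgt ltn_ord.
  by move=> ->; rewrite mul0r.
set B := \sum_(i < N0) _; have B2 : `|B| <= M * 2 * t ^+ k.+1 by exact: tail.
apply: le_trans (lerB_normD _ _); rewrite lerBrDr.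
apply: (@le_trans _ _ (t ^+ k.+1 * c + M * 2 * t ^+ k.+1)); first by rewrite lerD2l.
have -> : `|d k * (u0 * t) ^+ k| = c * t ^+ k by rewrite exprMn mulrA normrM tN.
have -> : t ^+ k.+1 * c + M * 2 * t ^+ k.+1 = (t * (c + M * 2)) * t ^+ k.
  by rewrite exprS; ring.
rewrite ler_pM2r ?exprn_gt0 // /t -mulrA ler_piMr ?(ltW c0) //.
rewrite mulrC ler_pdivrMr ?mulr_gt0 // mul1r.
have -> : 4 * (M + c) = (c + M * 2) + (M * 2 + 3 * c) by ring.
by rewrite lerDl addr_ge0 // mulr_ge0 // ltW.
Qed.

(** The coefficients of [(1 - p t) / (1 - q t)]. *)
Definition ratc p q (k : nat) : K :=
  if k is k'.+1 then q ^+ k - p * q ^+ k' else 1.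

(** Both sides have the logarithmic derivative [q / (1 - q t) - p / (1 - p t)]. *)
Lemma ratc_exp p q :
  scalar_exp (fun m => m%:R^-1 * (q ^+ m - p ^+ m)) (ratc p q).
Proof.
split=> // -[|d]; first by rewrite conv0 !mul0r.
transitivity (conv (fun m b => (q ^+ m - p ^+ m) * ratc p q b) d.+1); last first.
  apply: eq_conv => -[|m] b _; first by rewrite !expr0 subrr mulr0 !mul0r.
  by rewrite mulVKf ?pnatr_eq0 //.
rewrite /conv big_ord_recl big_ord_recr /= subnn !expr0 subrr mul0r add0r mulr1.
rewrite (eq_bigr (fun i : 'I_d => (q ^+ d.+1 - p * q ^+ d) +
   (p ^+ i.+2 * q ^+ (d.+1 - i.+2)%N - p ^+ i.+1 * q ^+ (d.+1 - i.+1)%N)));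
   last first.
  move=> i _; have /subnKC := ltn_ord i; set j := (d - i.+1)%N => dE.
  rewrite /bump /= !add1n.
  have -> : (d.+1 - i.+1)%N = j.+1 by lia.
  have -> : (d.+1 - i.+2)%N = j by lia.
  have qE : q ^+ d = q ^+ i.+1 * q ^+ j by rewrite -exprD dE.
  by rewrite /= !exprS qE !exprS; ring.
rewrite big_split /= sumr_const card_ord.
rewrite -(big_mkord xpredT (fun i => p ^+ i.+2 * q ^+ (d.+1 - i.+2)%N -
   p ^+ i.+1 * q ^+ (d.+1 - i.+1)%N)).
rewrite (telescope_sumr (fun i => p ^+ i.+1 * q ^+ (d.+1 - i.+1)%N)) //.
rewrite /bump /= add1n subnn expr0 subSS subn0 -mulr_natl -natr1.
by rewrite !exprS; ring.
Qed.

Lemma ratc_partial p q u N : (1 - q * u) * \sum_(k < N.+1) ratc p q k * u ^+ k =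
  1 - p * u - (q - p) * u * (q * u) ^+ N.
Proof.
elim: N => [|N IHN]; first by rewrite big_ord1 /= !expr0; ring.
by rewrite big_ord_recr /= mulrDr IHN !exprS !exprMn; ring.
Qed.

End PowerSeries.

Section ComplexSeries.
Variable R : realType.
Local Notation C := R[i].

Lemma half_powers (a eps : C) : 0 < eps ->
  exists N0, forall N, (N0 <= N)%N -> `|a| * 2^-1 ^+ N < eps.
Proof.
move=> eps0; have [r r0 rE] : exists2 r : R, 0 < r & eps = r%:C%C.
  move: eps0; case: eps => x y; rewrite ltcE /= => /andP[/eqP yE x0].
  by exists x => //; apply/eqP; rewrite eq_complex /= eqxx yE eqxx.
have [b b0 bE] : exists2 b : R, 0 <= b & `|a| = b%:C%C.
  have : 0 <= `|a| by [].
  case: `|a| => x y; rewrite lecE /= => /andP[/eqP yE x0].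
  by exists x => //; apply/eqP; rewrite eq_complex /= eqxx yE eqxx.
have /archi_boundP : 0 <= b / r by rewrite divr_ge0 // ltW.
set N0 := Num.bound _ => bN0; exists N0 => N N0N; rewrite bE rE.
rewrite exprVn ltr_pdivrMr ?exprn_gt0 //.
have -> : r%:C%C * 2 ^+ N = (r * 2 ^+ N)%:C%C by rewrite rmorphM rmorphXn rmorph_nat.
rewrite ltcR mulrC -ltr_pdivrMr //; apply: lt_le_trans bN0 _.
rewrite -natrX ler_nat; apply: leq_trans N0N _; exact/ltnW/ltn_expl.
Qed.

Lemma expands_dist (phi : nat -> C) rho : expands_to phi rho ->
  exists2 eps : C, 0 < eps & forall u, `|u| < eps ->
    forall e, 0 < e -> exists N0, forall N, (N0 <= N)%N ->
      `|rho 1 u - \sum_(k < N) phi k * u ^+ k| < e.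
Proof.
move=> [eps eps0 H]; exists eps => // u ue e e0.
have := H 1 u (oner_neq0 _); rewrite normr1 mulr1 divr1 => /(_ ue).
move/cvgrPdist_lt => /(_ e e0) [N0 _ HN0]; exists N0 => N NN.
by have := HN0 N NN; rewrite /series /= big_mkord.
Qed.

Lemma expands_to_unique (phi psi : nat -> C) rho :
  expands_to phi rho -> expands_to psi rho -> phi =1 psi.
Proof.
move=> /expands_dist[r1 r10 H1] /expands_dist[r2 r20 H2] k.
apply/eqP; rewrite -subr_eq0; apply/eqP; move: k.
apply: (@power_series_eq0 _ (fun k => phi k - psi k) (r1 * (r2 / (r1 + r2)))).
  by rewrite mulr_gt0 // divr_gt0 // addr_gt0.
have r12 : 0 < r1 + r2 by rewrite addr_gt0.
move=> u ur e e0; have e20 : 0 < e / 2 by rewrite divr_gt0.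
have ur1 : `|u| < r1.
  apply: lt_le_trans ur _; rewrite ler_piMr ?(ltW r10) //.
  by rewrite ler_pdivrMr // mul1r lerDr ltW.
have ur2 : `|u| < r2.
  apply: lt_le_trans ur _; rewrite mulrCA ler_piMr ?(ltW r20) //.
  by rewrite ler_pdivrMr // mul1r lerDl ltW.
have [N1 HN1] := H1 u ur1 _ e20; have [N2 HN2] := H2 u ur2 _ e20.
exists (maxn N1 N2) => N; rewrite geq_max => /andP[N1N N2N].
under eq_bigr do rewrite mulrBl; rewrite sumrB.
rewrite -(subrK (rho 1 u) (\sum_(i < N) phi i * u ^+ i)) -addrA.
apply: le_lt_trans (ler_normD _ _) _; rewrite [X in _ < X](splitr e).
by apply: ltrD; [rewrite distrC; exact: HN1|exact: HN2].
Qed.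

Lemma ratc_expands (c p q : C) rho :
  (forall z w, z != 0 -> z != q * w -> rho z w = c * ((z - p * w) / (z - q * w))) ->
  expands_to (fun k => c * ratc p q k) rho.
Proof.
move=> rhoE; have q1 : 0 < `|q| + 1 by rewrite ltr_wpDl.
exists ((2 * (`|q| + 1))^-1); first by rewrite invr_gt0 mulr_gt0.
move=> z w z0 wz; set u := w / z.
have uq : `|q * u| <= 2^-1.
  rewrite normrM /u normf_div; have z00 : 0 < `|z| by rewrite normr_gt0.
  rewrite mulrA ler_pdivrMr //.
  apply: (@le_trans _ _ ((`|q| + 1) * ((2 * (`|q| + 1))^-1 * `|z|))).
    by apply: ler_pM => //; [rewrite lerDl|exact: ltW].
  rewrite le_eqVlt; apply/orP; left; apply/eqP.
  have qn : `|q| + 1 != 0 by rewrite gt_eqF.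
  by move: (`|q| + 1) (`|z|) qn => a b a0; field.
have qu1 : 1 - q * u != 0.
  rewrite subr_eq0 eq_sym; apply/eqP => qu; move: uq; rewrite qu normr1.
  have h1 : 2^-1 < 1 :> C by rewrite invf_lt1 // ltr1n.
  by move=> /(lt_le_trans h1); rewrite ltxx.
have zqw : z != q * w.
  apply: contra qu1 => /eqP zE; rewrite /u mulrA -zE divff // subrr //.
have rE : rho z w = c * ((1 - p * u) / (1 - q * u)).
  rewrite rhoE //; congr (_ * _).
  have -> : z - p * w = z * (1 - p * u) by rewrite /u; field.
  have -> : z - q * w = z * (1 - q * u) by rewrite /u; field.
  by rewrite -mulf_div divff // mul1r.
apply/cvgrPdist_lt => e e0.
have [N0 HN0] := half_powers (c * ((q - p) * u / (1 - q * u))) e0.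
exists N0.+1 => // -[|N] //= NN.
have -> : series (fun k => c * ratc p q k * u ^+ k : C^o) N.+1 =
    c * ((1 - p * u - (q - p) * u * (q * u) ^+ N) / (1 - q * u)).
  rewrite /series /= big_mkord -ratc_partial mulrAC divff // mul1r mulr_sumr.
  by apply: eq_bigr => k _; rewrite mulrA.
rewrite rE -mulrBr -mulrBl opprB addrC subrK.
have -> : c * ((q - p) * u * (q * u) ^+ N / (1 - q * u)) =
   c * ((q - p) * u / (1 - q * u)) * (q * u) ^+ N by ring.
rewrite normrM normrX; apply: le_lt_trans (HN0 N NN).
by rewrite ler_wpM2l // lerXn2r // ?nnegrE // invr_ge0.
Qed.
End ComplexSeries.

(** * Delta functions and the modes of the currents *)

Section BilateralSum.
Variables (K : numFieldType) (V : lmodType K).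

(** The two expansions of [(w - z/p) / (w - z/q)] differ by a multiple of
   [delta(q w / z)]. *)
Lemma sum_bilateral (p q : K) (M : nat) (G : int -> V) : p != 0 -> q != 0 ->
  (forall m : int, (M <= absz m)%N -> G m = 0) ->
  \sum_(k \in [set: nat]) (q / p * ratc p q k) *: G k%:Z -
  \sum_(k \in [set: nat]) ratc p^-1 q^-1 k *: G (- k%:Z) =
  (q / p - 1) *: \sum_(m \in [set: int]) q ^ m *: G m.
Proof.
move=> p0 q0 G0.
rewrite (fsum_nat (N := M.+1)) => [|k Mk]; last by rewrite G0 ?scaler0 // ltnW.
rewrite (fsum_nat (N := M.+1)) => [|k Mk]; last first.
  by rewrite G0 ?scaler0 // abszN ltnW.
rewrite (fsum_int (q := M) (M := (M + M.+1)%N)); last first.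
  by move=> m mM; rewrite G0 ?scaler0 //; lia.
set c := q / p; pose H (m : int) : V := (c - 1) *: (q ^ m *: G m).
rewrite scaler_sumr -[RHS]/(\sum_(i < M + M.+1) H (i%:Z - M%:Z)).
have -> : \sum_(i < M + M.+1) H (i%:Z - M%:Z) =
    \sum_(i < M) H (- i.+1%:Z) + (H 0 + \sum_(i < M) H i.+1%:Z).
  rewrite big_split_ord; congr (_ + _).
    rewrite (reindex_inj rev_ord_inj); apply: eq_bigr => i _ /=.
    by congr H; have := ltn_ord i; lia.
  rewrite (eq_bigr (fun i : 'I_M.+1 => H i%:Z)) => [|i _]; last first.
    by rewrite /= PoszD addrC addKr.
  by rewrite big_ord_recl; congr (_ + _); apply: eq_bigr => i _; rewrite lift0.
have -> : \sum_(k < M.+1) (c * ratc p q k) *: G k%:Z =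
    c *: G 0 + \sum_(i < M) H i.+1%:Z.
  rewrite big_ord_recl mulr1; congr (_ + _); apply: eq_bigr => i _.
  rewrite lift0 /H scalerA; congr (_ *: _).
  by rewrite /= -exprnP exprS /c; field.
have -> : \sum_(k < M.+1) ratc p^-1 q^-1 k *: G (- k%:Z) =
    G 0 - \sum_(i < M) H (- i.+1%:Z).
  rewrite big_ord_recl oppr0 scale1r -sumrN; congr (_ + _); apply: eq_bigr => i _.
  rewrite lift0 /H scalerA -scaleNr; congr (_ *: _).
  by rewrite /= -exprz_inv -exprnP !exprS /c; field; rewrite p0 q0.
rewrite opprB /H expr0z !scale1r scalerBl scale1r.
rewrite [RHS]addrC [c *: _ - _ + _]addrAC -[RHS]addrA; congr (_ + _).
by rewrite addrC.
Qed.
End BilateralSum.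

Section ComplexExp.
Variable R : realType.
Local Notation C := R[i].
Implicit Types z l : C.

Lemma cexpD z l : cexp (z + l) = cexp z * cexp l.
Proof.
case: z => a b; case: l => c d; apply/eqP; rewrite eq_complex /=.
rewrite expRD cosD sinD; apply/andP; split; apply/eqP; ring.
Qed.

Lemma cexp0 : cexp 0 = 1 :> C.
Proof.
by apply/eqP; rewrite eq_complex /= expR0 cos0 sin0 mul1r mulr0 !eqxx.
Qed.

Lemma cexp_neq0 z : cexp z != 0.
Proof.
apply/eqP => z0; have := cexp0; rewrite -(subrr z) cexpD z0 mul0r => /eqP.
by rewrite eq_sym oner_eq0.
Qed.

Lemma cexpN z : cexp (- z) = (cexp z)^-1.
Proof.
apply: (mulfI (cexp_neq0 z)); rewrite -cexpD subrr cexp0 divff //.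
exact: cexp_neq0.
Qed.

Lemma cexpMz (m : int) l : cexp (m%:~R * l) = cexp l ^ m.
Proof.
have nat (k : nat) : cexp (k%:R * l) = cexp l ^+ k.
  elim: k => [|k IHk]; first by rewrite mul0r cexp0.
  by rewrite -natr1 mulrDl mul1r cexpD IHk exprSr.
case: m => k; first by rewrite -exprnP -nat.
by rewrite NegzE rmorphN mulNr cexpN nat exprnN.
Qed.

Lemma norm_cexp z : `|cexp z| = (expR (complex.Re z))%:C%C.
Proof.
case: z => a b; rewrite normc_def /=; congr (_ %:C)%C.
rewrite !exprMn -mulrDr cos2Dsin2 mulr1 sqrtr_sqr ger0_norm //.
Qed.

(** Otherwise a suitable [mu] gives the value [cexp 1], of modulus greater than [1],
   while [mu = 0] gives [1]. *)
Lemma cexp_const (J : finType) (c : J -> C) (k : C) :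
  (forall mu : J -> C, cexp (\sum_j c j * mu j) = k) -> forall j, c j = 0.
Proof.
move=> ck j; apply/eqP/negPn/negP => cj.
have k1 : k = 1 by rewrite -(ck (fun=> 0)) big1 ?cexp0 // => i _; rewrite mulr0.
have := ck (fun i => if i == j then (c j)^-1 else 0).
rewrite (bigD1 j) //= eqxx divff // big1 ?addr0 => [|i /negPf->]; last by rewrite mulr0.
rewrite k1 => /(congr1 Num.norm); rewrite norm_cexp normr1 => /(congr1 (@complex.Re R)).
by rewrite /= => /eqP; rewrite gt_eqF // expR_gt1.
Qed.
End ComplexExp.

Section CurrentModes.
Variables (R : realType) (n : nat).
Local Notation C := R[i].
Local Notation I := 'I_n.+1.
Local Notation PF := (polyFock C (I * nat)%type).
Implicit Types (A : I -> I -> int -> C) (mu : I -> C) (V W : vertex R n).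

Lemma lincomb_exchange (K : numFieldType) (U : lmodType K) (v : I -> K) (c : K)
  (a : I -> I -> K) (T : I -> U) :
  \sum_j v j *: (c *: \sum_l a j l *: T l) = \sum_l (c * \sum_j v j * a j l) *: T l.
Proof.
under eq_bigr do rewrite scalerA scaler_sumr.
rewrite exchange_big; apply: eq_bigr => l _.
rewrite mulr_sumr scaler_suml; apply: eq_bigr => j _.
by rewrite scalerA; congr (_ *: _); ring.
Qed.

Lemma creatE A V mu (t : nat) f : creat A V mu t f = cz (V := PF) (vosc V) t%:Z f.
Proof.
have H m (g : PF) : (0 < m)%N -> (\sum_j vosc V j (- m%:Z) *:
    heis A mu j (- m%:Z) g : PF) = creop PF (vosc V) m g.
  case: m => [m0|m _]; first by exfalso; rewrite ltnn in m0.
  exact: erefl.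
exact: (@eq_expseq C PF (fun m g => \sum_j vosc V j (- m%:Z) *:
  heis A mu j (- m%:Z) g) (creop PF (vosc V)) t f H).
Qed.

Lemma annihE A V mu t f : annih A V mu t f = an (V := PF) A (vosc V) t f.
Proof.
have H m (g : PF) : (0 < m)%N -> (\sum_j vosc V j m%:Z *:
    heis A mu j m%:Z g : PF) = annop PF A (vosc V) m g.
  case: m => [m0|m _]; first by exfalso; rewrite ltnn in m0.
  exact: (@lincomb_exchange C PF (fun j => vosc V j m.+1%:Z) (m.+1%:R^-1)
    (fun j l => A j l m.+1%:Z) (fun l => ann PF (l, m) g)).
exact: (@eq_expseq C PF (fun m g => \sum_j vosc V j m%:Z *:
  heis A mu j m%:Z g) (annop PF A (vosc V)) t f H).
Qed.

Lemma vmodeE A V mu e f : vmode A V mu e f =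
  gvm (V := PF) A (cexp (\sum_j vexp V j * mu j)) (zdeg V mu) (vosc V) e f.
Proof.
have E : (fun t : nat * nat => creat A V mu t.1 (annih A V mu t.2 f)) =
    (fun t => cz (V := PF) (vosc V) t.1%:Z (an (V := PF) A (vosc V) t.2 f)).
  apply: funext => t; etransitivity; first exact: creatE.
  exact: (congr1 (cz (V := PF) (vosc V) t.1%:Z) (annihE _ _ _ _ _)).
exact: (congr1 (fun F : nat * nat -> PF => cexp (\sum_j vexp V j * mu j) *:
  \sum_(t \in [set t : nat * nat | zdeg V mu + t.1%:R - t.2%:R = e]) F t) E).
Qed.

Lemma nmodeE A V W mu e e' f : nmode A V W mu e e' f =
  gnm (V := PF) A (cexp (\sum_j (vexp V j + vexp W j) * mu j))
    (zdeg V mu) (vosc V) (zdeg W mu) (vosc W) e e' f.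
Proof.
have E : (fun t : (nat * nat) * (nat * nat) =>
    creat A V mu t.1.1 (creat A W mu t.2.1
      (annih A V mu t.1.2 (annih A W mu t.2.2 f)))) =
    (fun t => cz (V := PF) (vosc V) t.1.1%:Z (cz (V := PF) (vosc W) t.2.1%:Z
      (an (V := PF) A (vosc V) t.1.2 (an (V := PF) A (vosc W) t.2.2 f)))).
  apply: funext => t; etransitivity; first exact: creatE.
  apply: (congr1 (cz (V := PF) (vosc V) t.1.1%:Z)).
  etransitivity; first exact: creatE.
  apply: (congr1 (cz (V := PF) (vosc W) t.2.1%:Z)).
  etransitivity; first exact: annihE.
  exact: (congr1 (an (V := PF) A (vosc V) t.1.2) (annihE _ _ _ _ _)).
exact: (congr1 (fun F : (nat * nat) * (nat * nat) -> PF =>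
  cexp (\sum_j (vexp V j + vexp W j) * mu j) *:
  \sum_(t \in [set t : (nat * nat) * (nat * nat) |
                 zdeg V mu + t.1.1%:R - t.1.2%:R = e /\
                 zdeg W mu + t.2.1%:R - t.2.2%:R = e']) F t) E).
Qed.

End CurrentModes.

(** * The commutator of mutually local vertex operators *)

Section ModesLinear.
Variables (K : numFieldType) (J : finType) (V : fockModel K (J * nat)%type).
Variable A : J -> J -> int -> K.

Lemma gvm_linear (s z : K) v (e : K) : linear (gvm (V := V) A s z v e).
Proof.
move=> c f g; have [[a ->]|ne] := mode_intP z e; last first.
  by rewrite !gvm_nonint // scaler0 addr0.
have [N fN] := an_nilp A v f; have [M gM] := an_nilp A v g.
have fT t : (maxn N M <= t)%N -> an A v t f = 0.
  by rewrite geq_max => /andP[Nt _]; exact: fN.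
have gT t : (maxn N M <= t)%N -> an A v t g = 0.
  by rewrite geq_max => /andP[_ Mt]; exact: gM.
have hT t : (maxn N M <= t)%N -> an A v t (c *: f + g) = 0.
  by move=> Tt; rewrite [LHS](an_linear A v t c) fT // gT // scaler0 addr0.
rewrite (gvm_int _ _ _ fT) (gvm_int _ _ _ gT) (gvm_int _ _ _ hT).
rewrite [c *: (s *: _)]scalerA [c * s]mulrC -scalerA -scalerDr; congr (_ *: _).
rewrite scaler_sumr -big_split; apply: eq_bigr => t _.
by rewrite (an_linear A v t c) [LHS](cz_linear v (a + t%:Z) c).
Qed.

HB.instance Definition _ s z v e :=
  GRing.isLinear.Build K V V _ (gvm (V := V) A s z v e) (gvm_linear s z v e).

Lemma gnm_bounded (s z z' : K) v w (m : int) (e : K) f :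
  exists M : nat, forall k : int, (M <= absz k)%N ->
    gnm (V := V) A s z v z' w (z + m%:~R + k%:~R) (e - k%:~R) f = 0.
Proof.
have [[b ->]|ne] := mode_intP z' e; last first.
  exists 0%N => k _; rewrite gnm_nonint2 // => a ea; apply: (ne (a + k)).
  by rewrite intrD addrA -ea subrK.
have [N [fN gN]] := an_nilp2 A v w f.
exists (absz m + absz b + N)%N => k Mk.
rewrite -addrA -intrD -addrA -intrB (gnm_int _ _ _ _ _ fN gN).
rewrite big1 ?scaler0 // => c _; rewrite big1 // => d _.
have := ltn_ord c; have := ltn_ord d => dN cN.
case: (ltP (m + k + c%:Z) 0) => mk; first by rewrite cz_neg.
by rewrite [cz w _ _]cz_neg ?linear0 //; lia.
Qed.
End ModesLinear.

Section Commutator.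
Variables (R : realType) (J : finType).
Local Notation C := R[i].
Variable V : fockModel C (J * nat)%type.
Variable A : J -> J -> int -> C.

(** The two products are contractions with the two expansions of the same rational
   function; their difference is a delta function by [sum_bilateral], on whose support
   the normal ordered product fuses into a single vertex operator. *)
Lemma commutator (s s' s2 s3 z : C) v w (p q l : C) (m : int) (e : C) (f : V) :
  p != 0 -> q = cexp l ->
  (forall k, (0 < k)%N -> wickk A v w k = k%:R^-1 * (q ^+ k - p ^+ k)) ->
  (forall k, (0 < k)%N -> wickk A w v k = k%:R^-1 * (q^-1 ^+ k - p^-1 ^+ k)) ->
  s * s' = q / p * s2 -> s' * s3 = s2 ->
  gvm A s 0 v m%:~R (gvm A s' z w e f) - gvm A s' z w e (gvm A s3 0 v m%:~R f) =
  (q / p - 1) *: (cexp (e * l) *: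
     gvm A (s2 * cexp (- z * l)) z (fuse v w q) (m%:~R + e) f).
Proof.
move=> p0 ql vw wv ss ss3; have q0 : q != 0 by rewrite ql cexp_neq0.
have vwP : scalar_exp (wickk A v w) (ratc p q).
  by apply: eq_scalar_exp (ratc_exp p q) => k /vw.
have wvP : scalar_exp (wickk A w v) (ratc p^-1 q^-1).
  by apply: eq_scalar_exp (ratc_exp p^-1 q^-1) => k /wv.
pose G (k : int) : V := gnm A s2 0 v z w (m%:~R + k%:~R) (e - k%:~R) f.
rewrite (gvm_contraction _ _ _ _ _ _ _ vwP) (gvm_contraction _ _ _ _ _ _ _ wvP).
have [M GM] := gnm_bounded A s2 0 z v w m e f.
have G0 (k : int) : (M <= absz k)%N -> G k = 0.
  by move=> /GM; rewrite add0r.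
transitivity ((q / p - 1) *: \sum_(k \in [set: int]) q ^ k *: G k).
  etransitivity; last exact: (sum_bilateral p0 q0 G0).
  apply: (congr2 (fun a b : V => a - b)); apply: eq_fsbigr => k _.
    by rewrite ss gnm_scale scalerA [_ * ratc _ _ _]mulrC.
  by rewrite ss3 gnmC /G rmorphN /= opprK.
congr (_ *: _); have [[b bE]|ne] := mode_intP z (m%:~R + e); last first.
  rewrite gvm_nonint // scaler0 fsbig1 // => k _; rewrite /G gnm_nonint2 ?scaler0 //.
  move=> a ea; apply: (ne (a + k + m)).
  have -> : e = z + a%:~R + k%:~R by rewrite -ea subrK.
  by rewrite !intrD; ring.
have eE : e = z + (b - m)%:~R by rewrite intrB addrA -bE addrC addKr.
rewrite bE.
have -> : gvm A (s2 * cexp (- z * l)) z (fuse v w q) (z + b%:~R) f =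
    cexp (- z * l) *: gvm A s2 z (fuse v w q) (z + b%:~R) f.
  by rewrite /gvm scalerA mulrC.
rewrite scalerA -cexpD.
have -> : e * l + - z * l = (b - m)%:~R * l by rewrite eE; ring.
rewrite cexpMz -ql -(gnm_fuse _ _ _ _ _ _ _ q0).
rewrite [LHS](reindex_fsbigT (fun k : int => k - m)); last first.
  by exists (fun k => k + m) => k; rewrite ?subrK ?addrK.
have [M2 GM2] : exists M2, forall k : int, (M2 <= absz k)%N -> G (k - m) = 0.
  by exists (M + absz m)%N => k Mk; apply: G0; lia.
have GE (k : int) : gnm A s2 0 v z w k%:~R (z + b%:~R - k%:~R) f = G (k - m).
  by rewrite /G -bE intrB; congr (gnm _ _ _ _ _ _ _ _ _); ring.
pose N := (M2 + M2.+1)%N.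
have out (k : int) : ~~ (0 <= k + M2%:Z < N%:Z) -> G (k - m) = 0.
  by move=> kN; apply: GM2; rewrite /N in kN; lia.
rewrite (fsum_int (q := M2) (M := N)); last by move=> k /out ->; rewrite scaler0.
rewrite (fsum_int (q := M2) (M := N)); last first.
  by move=> k /out; rewrite GE => ->; rewrite scaler0.
rewrite scaler_sumr; apply: eq_bigr => i _; rewrite GE [RHS]scalerA.
have -> : q ^ (b - m) * q ^ (i%:Z - M2%:Z - b) = q ^ (i%:Z - M2%:Z - m).
  by rewrite -expfzDr //; congr (q ^ _); ring.
by [].
Qed.
End Commutator.

(** * Mutual Locality and Symmetry as equations between the parameters *)

Lemma sum_commutator_linear (K : pzRingType) (V : lmodType K) (I : finType)
    (S : {linear V -> V}) (g : I -> K) (T T' r : I -> V) :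
  (forall i, T i - S (T' i) = r i) ->
  \sum_i g i *: T i - S (\sum_i g i *: T' i) = \sum_i g i *: r i.
Proof.
move=> Tr; rewrite linear_sum -sumrB; apply: eq_bigr => i _.
by rewrite linearZ_LR -scalerBr Tr.
Qed.

Section T1Commutator.
Variables (R : realType) (J I : finType).
Local Notation C := R[i].
Variable V : fockModel C (J * nat)%type.
Variable A : J -> J -> int -> C.

Lemma sum_commutator (g s s2 s3 p q l : I -> C) (v : I -> J -> int -> C)
    (s' z : C) w (m : int) (e : C) (f : V) :
  (forall i, p i != 0) -> (forall i, q i = cexp (l i)) ->
  (forall i k, (0 < k)%N ->
     wickk A (v i) w k = k%:R^-1 * (q i ^+ k - p i ^+ k)) ->
  (forall i k, (0 < k)%N ->
     wickk A w (v i) k = k%:R^-1 * ((q i)^-1 ^+ k - (p i)^-1 ^+ k)) ->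
  (forall i, s i * s' = q i / p i * s2 i) -> (forall i, s' * s3 i = s2 i) ->
  \sum_i g i *: gvm A (s i) 0 (v i) m%:~R (gvm A s' z w e f) -
    gvm A s' z w e (\sum_i g i *: gvm A (s3 i) 0 (v i) m%:~R f) =
  \sum_i (g i * (q i / p i - 1)) *: (cexp (e * l i) *:
     gvm A (s2 i * cexp (- z * l i)) z (fuse (v i) w (q i)) (m%:~R + e) f).
Proof.
move=> p0 ql vw wv ss ss3.
etransitivity; first apply: (@sum_commutator_linear _ V I
  (GRing.Linear.clone _ _ _ _ (gvm A s' z w e) _) g _ _ _
  (fun i => commutator z m e f (p0 i) (ql i) (vw i) (wv i) (ss i) (ss3 i))).
by apply: eq_bigr => i _; rewrite [LHS]scalerA.
Qed.
End T1Commutator.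

Section ContractionSeries.
Variables (R : realType) (n : nat).
Local Notation C := R[i].
Local Notation I := 'I_n.+1.
Local Notation PF := (polyFock C (I * nat)%type).
Implicit Types (A : I -> I -> int -> C) (mu : I -> C) (V W : vertex R n).

(** The coefficients of a contraction are determined by their effect on the vacuum, so
   the given series must be the one of the Wick rule. *)
Lemma contractionE A V W (c0 : C) psi phi :
  (forall mu, zdeg V (wshift A W mu) = zdeg V mu) ->
  (forall mu, \sum_j vexp V j * wshift A W mu j = \sum_j vexp V j * mu j + c0) ->
  scalar_exp (wickk A (vosc V) (vosc W)) psi ->
  Defs.contraction A V W phi <-> phi =1 (fun k => cexp c0 * psi k).
Proof.
move=> zV hV psiP.
pose s mu := cexp (\sum_j vexp V j * mu j) * cexp c0.
pose s' mu := cexp (\sum_j vexp W j * mu j).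
pose s2 mu := cexp (\sum_j (vexp V j + vexp W j) * mu j).
have ss mu : s mu * s' mu = cexp c0 * s2 mu.
  rewrite /s /s' /s2; under [in RHS]eq_bigr do rewrite mulrDl.
  by rewrite big_split /= cexpD; ring.
have LE mu e e' f : vmode A V (wshift A W mu) e (vmode A W mu e' f) =
    gvm (V := PF) A (s mu) (zdeg V mu) (vosc V) e
      (gvm (V := PF) A (s' mu) (zdeg W mu) (vosc W) e' f).
  rewrite [LHS]vmodeE zV hV cexpD; exact: (congr1 _ (vmodeE _ _ _ _ _)).
have RE mu e e' f (chi : nat -> C) :
    \sum_(k \in [set: nat]) chi k *: nmode A V W mu (e + k%:R) (e' - k%:R) f =
    \sum_(k \in [set: nat]) chi k *: gnm (V := PF) A (s2 mu) (zdeg V mu) (vosc V)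
      (zdeg W mu) (vosc W) (e + k%:R) (e' - k%:R) f.
  have E : (fun k : nat => nmode A V W mu (e + k%:R) (e' - k%:R) f) =
    (fun k => gnm (V := PF) A (s2 mu) (zdeg V mu) (vosc V)
      (zdeg W mu) (vosc W) (e + k%:R) (e' - k%:R) f).
    by apply: funext => k; exact: nmodeE.
  exact: (congr1 (fun F : nat -> PF => \sum_(k \in [set: nat]) chi k *: F k) E).
split=> [phiP|phiE].
  apply: (@gvm_contraction_unique _ _ PF A (s (fun=> 0)) (zdeg V (fun=> 0))
    (vosc V) (s' (fun=> 0)) (zdeg W (fun=> 0)) (vosc W) (s2 (fun=> 0))) => //.
  - exact: cexp_neq0.
  - move=> e e' f; etransitivity; first by symmetry; exact: LE.
    by etransitivity; first exact: phiP; exact: RE.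
move=> mu e e' f; etransitivity; first exact: LE.
etransitivity; last by symmetry; exact: RE.
etransitivity; first exact: (@gvm_contraction C I PF A (s mu) (zdeg V mu)
  (vosc V) (s' mu) (zdeg W mu) (vosc W) psi e e' f psiP).
have E : (fun k : nat => psi k *: gnm (V := PF) A (s mu * s' mu) (zdeg V mu)
    (vosc V) (zdeg W mu) (vosc W) (e + k%:R) (e' - k%:R) f) =
  (fun k => phi k *: gnm (V := PF) A (s2 mu) (zdeg V mu)
    (vosc V) (zdeg W mu) (vosc W) (e + k%:R) (e' - k%:R) f).
  apply: funext => k; rewrite ss phiE gnm_scale scalerA.
  by rewrite [psi k * _]mulrC.
exact: (congr1 (fun F : nat -> PF => \sum_(k \in [set: nat]) F k) E).
Qed.

End ContractionSeries.

Section ParameterEquations.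
Variables (R : realType) (n : nat) (P : params R n).
Local Notation C := R[i].
Local Notation I := 'I_n.+1.
Local Notation PF := (polyFock C (I * nat)%type).
Local Notation A := (hA P).
Local Notation q := (qq P).
Local Notation p := (pp P).
Implicit Types (mu : I -> C).

Definition sosc (j : I) : I -> int -> C := fun l m => if l == j then sS P j m else 0.

Lemma sosc_eq j m : sosc j j m = sS P j m.
Proof. by rewrite /sosc eqxx. Qed.

Lemma sosc_neq j l m : l != j -> sosc j l m = 0.
Proof. by rewrite /sosc => /negPf->. Qed.

Definition sXs (k l : I) (m : int) : C := sS P k m * A k l m * sS P l (- m).

Definition lamA (i : 'I_n.+2) (j : I) (m : int) : C := \sum_k lam P i k m * A k j m.

Definition locality_eqs : Prop := forall i j,
  [/\ cexp (lamA i j 0) = q i j / p i j,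
      forall m : nat, (0 < m)%N ->
        lamA i j m%:Z * sS P j (- m%:Z) = q i j ^+ m - p i j ^+ m
    & forall m : nat, (0 < m)%N ->
        sS P j m%:Z * (\sum_l A j l m%:Z * lam P i l (- m%:Z)) =
        (q i j)^-1 ^+ m - (p i j)^-1 ^+ m].

Lemma wick_lam_s i j m : wickk A (lam P i) (sosc j) m =
  m%:R^-1 * (lamA i j m%:Z * sS P j (- m%:Z)).
Proof.
rewrite /wickk; congr (_ * _); rewrite (bigD1 j) //= sosc_eq.
by rewrite [X in _ + X]big1 ?addr0 // => l lj; rewrite sosc_neq ?mulr0.
Qed.

Lemma sum_sosc k l m : \sum_j sosc k j m * A j l m = sS P k m * A k l m.
Proof.
rewrite (bigD1 k) //= sosc_eq big1 ?addr0 // => j jk.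
by rewrite sosc_neq ?mul0r.
Qed.

Lemma wick_s_lam i j m : wickk A (sosc j) (lam P i) m =
  m%:R^-1 * (sS P j m%:Z * (\sum_l A j l m%:Z * lam P i l (- m%:Z))).
Proof.
rewrite /wickk; congr (_ * _); rewrite mulr_sumr; apply: eq_bigr => l _.
by rewrite sum_sosc mulrA.
Qed.

Lemma wick_s_s k l m : wickk A (sosc k) (sosc l) m = m%:R^-1 * sXs k l m%:Z.
Proof.
rewrite /wickk; congr (_ * _); rewrite (bigD1 l) //= sum_sosc sosc_eq.
by rewrite [X in _ + X]big1 ?addr0 // => j jl; rewrite sosc_neq ?mulr0.
Qed.

Lemma wshift_Lambda i mu : wshift A (Lambda P i) mu = mu.
Proof.
by apply: funext => k; rewrite /wshift big1 ?addr0 // => j _; rewrite mul0r.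
Qed.

Lemma wshift_S j mu k : wshift A (S_ P j) mu k = mu k + A k j 0.
Proof.
rewrite /wshift (bigD1 j) //= eqxx mul1r big1 ?addr0 // => l /negPf->.
by rewrite mul0r.
Qed.

Lemma wshift_St j mu : wshift A (St_ P j) mu = mu.
Proof.
apply: funext => k; rewrite /wshift big1 ?addr0 // => l _ /=.
by rewrite subrr mul0r.
Qed.

Lemma zdeg_Lambda i mu : zdeg (Lambda P i) mu = 0.
Proof. by rewrite /zdeg add0r big1 // => j _; rewrite mul0r. Qed.

Lemma zdeg_S j mu : zdeg (S_ P j) mu = A j j 0 / 2 + mu j.
Proof.
rewrite /zdeg /= (bigD1 j) //= eqxx mul1r big1 ?addr0 // => l /negPf->.
by rewrite mul0r.
Qed.

Lemma pp_neq0 i j : p i j != 0. Proof. exact: cexp_neq0. Qed.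
Lemma qq_neq0 i j : q i j != 0. Proof. exact: cexp_neq0. Qed.

Lemma lam_wshift i j mu : \sum_k lam P i k 0 * wshift A (S_ P j) mu k =
  \sum_k lam P i k 0 * mu k + lamA i j 0.
Proof.
by rewrite -big_split; apply: eq_bigr => k _; rewrite wshift_S mulrDr.
Qed.

Lemma contraction_lam_s i j phi psi :
  scalar_exp (wickk A (lam P i) (sosc j)) psi ->
  Defs.contraction A (Lambda P i) (S_ P j) phi <->
  phi =1 (fun k => cexp (lamA i j 0) * psi k).
Proof.
move=> psiP; apply: contractionE => // mu; last exact: lam_wshift.
by rewrite !zdeg_Lambda.
Qed.

Lemma contraction_s_lam i j phi psi :
  scalar_exp (wickk A (sosc j) (lam P i)) psi ->
  Defs.contraction A (S_ P j) (Lambda P i) phi <-> phi =1 psi.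
Proof.
move=> psiP.
have -> : (phi =1 psi) = (phi =1 (fun k => cexp 0 * psi k)).
  by congr (_ =1 _); apply: funext => k; rewrite cexp0 mul1r.
apply: contractionE => // mu; first by rewrite wshift_Lambda.
by rewrite wshift_Lambda addr0.
Qed.

Lemma contraction_s_s k l phi psi :
  scalar_exp (wickk A (sosc k) (sosc l)) psi ->
  Defs.contraction A (St_ P k) (St_ P l) phi <-> phi =1 psi.
Proof.
move=> psiP.
have -> : (phi =1 psi) = (phi =1 (fun k => cexp 0 * psi k)).
  by congr (_ =1 _); apply: funext => i; rewrite cexp0 mul1r.
apply: contractionE => // mu; first by rewrite wshift_St.
by rewrite wshift_St addr0.
Qed.

Arguments contraction_lam_s : clear implicits.
Arguments contraction_s_lam : clear implicits.
Arguments contraction_s_s : clear implicits.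

Lemma natr_cancel (m : nat) (x y : C) : (0 < m)%N ->
  m%:R^-1 * x = m%:R^-1 * y -> x = y.
Proof. by move=> m0; apply: mulfI; rewrite invr_eq0 pnatr_eq0 -lt0n. Qed.

Lemma ratio_lam_s i j z w : z != 0 -> z != q i j * w ->
  (w - z / p i j) / (w - z / q i j) =
  q i j / p i j * ((z - p i j * w) / (z - q i j * w)).
Proof.
move=> z0 zq; have p0 := pp_neq0 i j; have q0 := qq_neq0 i j.
have zq0 : z - q i j * w != 0 by rewrite subr_eq0.
have -> : w - z / p i j = - (z - p i j * w) / p i j by field.
have -> : w - z / q i j = - (z - q i j * w) / q i j by field.
by field; rewrite p0 q0 zq0.
Qed.

Lemma ratio_s_lam i j z w : w != 0 -> w != (q i j)^-1 * z ->
  (w - z / p i j) / (w - z / q i j) =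
  1 * ((w - (p i j)^-1 * z) / (w - (q i j)^-1 * z)).
Proof. by move=> _ _; rewrite mul1r ![_^-1 * z]mulrC. Qed.

(** A rational function has a unique expansion, and a series with constant term [1]
   determines its exponent; so locality fixes the exponents of the two contractions. *)
Lemma mutual_localityP : mutual_locality P <-> locality_eqs.
Proof.
split=> H i j.
  have [phi [psi [phiC psiC phiE psiE]]] := H i j.
  have [chi chiP] := scalar_exp_exists (wickk A (lam P i) (sosc j)).
  have [xi xiP] := scalar_exp_exists (wickk A (sosc j) (lam P i)).
  have {phiC}phiE1 := (contraction_lam_s i j phi chi chiP).1 phiC.
  have {psiC}psiE1 := (contraction_s_lam i j psi xi xiP).1 psiC.
  have phiR := expands_to_unique phiE (ratc_expands (@ratio_lam_s i j)).
  have psiR := expands_to_unique psiE (ratc_expands (fun w z => @ratio_s_lam i j z w)).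
  have c0E : cexp (lamA i j 0) = q i j / p i j.
    by have := phiR 0%N; rewrite phiE1 chiP.1 !mulr1.
  have chiR : chi =1 ratc (p i j) (q i j).
    move=> k; apply: (mulfI (cexp_neq0 (lamA i j 0))).
    by rewrite -phiE1 phiR c0E.
  have xiR : xi =1 ratc (p i j)^-1 (q i j)^-1.
    by move=> k; rewrite -psiE1 psiR mul1r.
  split=> // m m0; apply: (natr_cancel m0).
    have rE := ratc_exp (p i j) (q i j); rewrite -(funext chiR) in rE.
    by rewrite -wick_lam_s; exact: (scalar_exp_inj chiP rE m0).
  have rE := ratc_exp (p i j)^-1 (q i j)^-1; rewrite -(funext xiR) in rE.
  by rewrite -wick_s_lam; exact: (scalar_exp_inj xiP rE m0).
have [c0E ls sl] := H i j.
exists (fun k => q i j / p i j * ratc (p i j) (q i j) k),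
  (fun k => 1 * ratc (p i j)^-1 (q i j)^-1 k).
split.
- apply/(contraction_lam_s i j _ (ratc (p i j) (q i j))).
    apply: eq_scalar_exp (ratc_exp _ _) => m m0.
    by rewrite wick_lam_s ls.
  by move=> k; rewrite c0E.
- apply/(contraction_s_lam i j _ (ratc (p i j)^-1 (q i j)^-1)).
    apply: eq_scalar_exp (ratc_exp _ _) => m m0.
    by rewrite wick_s_lam sl.
  by move=> k; rewrite mul1r.
- exact: (ratc_expands (@ratio_lam_s i j)).
- exact: (ratc_expands (fun w z => @ratio_s_lam i j z w)).
Qed.

Lemma delta_exp : scalar_exp (fun=> 0 : C) (fun m => (m == 0%N)%:R).
Proof.
split=> // d; rewrite /conv big1 => [|i _]; last by rewrite mulr0 mul0r.
by case: d => [|d]; rewrite ?mul0r // mulr0.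
Qed.

Definition far (k l : I) := (k + 2 <= l)%N || (l + 2 <= k)%N.

Lemma symmetryP : symmetry P <->
  (forall k l (m : nat), (0 < m)%N -> sXs k l m%:Z = sXs l k m%:Z) /\
  (forall k l (m : nat), far k l -> (0 < m)%N -> sXs k l m%:Z = 0).
Proof.
split=> [[sym sfar]|[sym sfar]].
  split=> [k l m m0|k l m kl m0]; apply: (natr_cancel m0); rewrite -!wick_s_s.
    have [phi [klP lkP]] := sym k l.
    have [chi chiP] := scalar_exp_exists (wickk A (sosc k) (sosc l)).
    have [xi xiP] := scalar_exp_exists (wickk A (sosc l) (sosc k)).
    have E1 := (contraction_s_s k l phi chi chiP).1 klP.
    have E2 := (contraction_s_s l k phi xi xiP).1 lkP.
    have chixi : chi = xi by apply: funext => i; rewrite -E1 E2.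
    by rewrite -chixi in xiP; exact: (scalar_exp_inj chiP xiP m0).
  have [chi chiP] := scalar_exp_exists (wickk A (sosc k) (sosc l)).
  have E1 := (contraction_s_s k l _ chi chiP).1 (sfar k l kl).
  have chiE : chi = (fun m => (m == 0%N)%:R) by apply: funext => i; rewrite -E1.
  by rewrite mulr0; rewrite chiE in chiP; exact: (scalar_exp_inj chiP delta_exp m0).
split=> k l.
  have [chi chiP] := scalar_exp_exists (wickk A (sosc k) (sosc l)).
  exists chi; split; first exact/(contraction_s_s k l chi chi chiP).
  apply/(contraction_s_s l k chi chi) => //.
  by apply: eq_scalar_exp chiP => m m0; rewrite !wick_s_s sym.
move=> kl; apply/(contraction_s_s k l _ (fun m => (m == 0%N)%:R)) => //.
apply: eq_scalar_exp delta_exp => m m0.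
by rewrite wick_s_s sfar ?mulr0.
Qed.

(** The current [: Lambda_i(z) S_j(z / q_ij) :]. *)
Definition Ucur (i : 'I_n.+2) (j : I) mu (e : C) (f : fock R n) : PF :=
  gvm (V := PF) A (cexp (\sum_k lam P i k 0 * mu k) *
      cexp (- zdeg (S_ P j) mu * logq P i j))
    (zdeg (S_ P j) mu) (fuse (lam P i) (sosc j) (q i j)) e f.

(** Only the delta function at [z = q_ij w] survives from each pair
   [Lambda_i], [S_j]. *)
Lemma commutator_modes : locality_eqs -> forall j mu (m : int) (e : C) f,
  T1mode P (wshift A (S_ P j) mu) m%:~R (vmode A (S_ P j) mu e f)
      - vmode A (S_ P j) mu e (T1mode P mu m%:~R f) =
  \sum_i (gT P i * (q i j / p i j - 1)) *:
    (cexp (e * logq P i j) *: Ucur i j mu (m%:~R + e) f).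
Proof.
move=> loc j mu m e f.
pose s i := cexp (\sum_k lam P i k 0 * mu k) * cexp (lamA i j 0).
pose s3 i := cexp (\sum_k lam P i k 0 * mu k).
pose s' := cexp (\sum_k vexp (S_ P j) k * mu k).
have s'1 : s' = 1 by rewrite /s' big1 ?cexp0 // => k _; rewrite mul0r.
have LE i h : vmode A (Lambda P i) (wshift A (S_ P j) mu) m%:~R h =
    gvm (V := PF) A (s i) 0 (lam P i) m%:~R h.
  by rewrite [LHS]vmodeE zdeg_Lambda lam_wshift cexpD.
have LE3 i h : vmode A (Lambda P i) mu m%:~R h =
    gvm (V := PF) A (s3 i) 0 (lam P i) m%:~R h.
  by rewrite [LHS]vmodeE zdeg_Lambda.
have SE h : vmode A (S_ P j) mu e h =
    gvm (V := PF) A s' (zdeg (S_ P j) mu) (sosc j) e h by exact: vmodeE.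
have T1 h : T1mode P (wshift A (S_ P j) mu) m%:~R h =
    \sum_i gT P i *: gvm (V := PF) A (s i) 0 (lam P i) m%:~R h.
  exact: (congr1 (fun F : 'I_n.+2 -> PF => \sum_i gT P i *: F i)
    (funext (fun i => LE i h))).
have T3 h : T1mode P mu m%:~R h =
    \sum_i gT P i *: gvm (V := PF) A (s3 i) 0 (lam P i) m%:~R h.
  exact: (congr1 (fun F : 'I_n.+2 -> PF => \sum_i gT P i *: F i)
    (funext (fun i => LE3 i h))).
etransitivity.
  apply: (congr2 (fun a b : PF => a - b)).
    by etransitivity; first exact: T1; rewrite SE; reflexivity.
  by etransitivity; first exact: SE; rewrite T3; reflexivity.
apply: (@sum_commutator R _ _ PF A (gT P) s s3 s3 (fun i => p i j) (fun i => q i j)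
  (fun i => logq P i j) (lam P) s' (zdeg (S_ P j) mu) (sosc j) m e f).
- by move=> i; exact: pp_neq0.
- by [].
- by move=> i k k0; rewrite wick_lam_s; have [_ -> //] := loc i j.
- by move=> i k k0; rewrite wick_s_lam; have [_ _ -> //] := loc i j.
- by move=> i; rewrite s'1 mulr1 /s /s3 mulrC; have [-> _ _] := loc i j.
- by move=> i; rewrite s'1 mul1r.
Qed.
End ParameterEquations.

(** * A vertex operator determines its symbol *)

Section Separation.
Variables (K : numFieldType).

(** The relations extend from powers to all polynomials; one that vanishes at all but one
   of the points isolates a summand. *)
Lemma vandermonde_sum (V : lmodType K) (N : nat) (x : 'I_N -> K) (W : 'I_N -> V) :
  injective x -> (forall k : nat, \sum_i x i ^+ k *: W i = 0) -> forall i, W i = 0.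
Proof.
move=> xi H i.
have polyH (r : {poly K}) : \sum_k r.[x k] *: W k = 0.
  transitivity (\sum_(j < size r) r`_j *: \sum_k x k ^+ j *: W k); last first.
    by rewrite big1 // => j _; rewrite H scaler0.
  under [RHS]eq_bigr do rewrite scaler_sumr.
  rewrite exchange_big; apply: eq_bigr => k _ /=.
  rewrite horner_coef scaler_suml; apply: eq_bigr => j _.
  by rewrite scalerA.
(* The polynomial that vanishes at all points but [x i]. *)
pose r : {poly K} := \prod_(k | k != i) ('X - (x k)%:P).
have r0 k : k != i -> r.[x k] = 0.
  by move=> ki; rewrite horner_prod (bigD1 k) //= !hornerE subrr mul0r.
have ri : r.[x i] != 0.
  rewrite horner_prod; apply/prodf_neq0 => k ki.
  by rewrite !hornerE subr_eq0 (inj_eq xi) eq_sym.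
have := polyH r; rewrite (bigD1 i) //= big1 ?addr0 => [|k ki]; last first.
  by rewrite r0 // scale0r.
by move/eqP; rewrite scaler_eq0 (negPf ri) => /eqP.
Qed.

Variables (J : finType) (V : fockModel K (J * nat)%type).
Variable A : J -> J -> int -> K.

Lemma gvm_vac s z u : gvm (V := V) A s z u z (vac V) = s *: vac V.
Proof.
have -> : gvm A s z u z (vac V) = gvm A s z u (z + 0%:~R) (vac V) by rewrite addr0.
rewrite (gvm_int _ _ _ (N := 1)) => [|t t0]; last by rewrite an_vac; case: t t0.
by rewrite big_ord1 an_vac addr0 /cz /= expseq0.
Qed.

Lemma gvm_vac_cre s z u (d : nat) :
  gvm (V := V) A s z u (z + d%:Z%:~R) (vac V) = s *: cz u d%:Z (vac V).
Proof.
rewrite (gvm_int _ _ _ (N := 1)) => [|t t0]; last by rewrite an_vac; case: t t0.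
by rewrite big_ord1 an_vac addr0.
Qed.

(** The states with one oscillator see the annihilation part linearly. *)
Lemma gvm_cre_vac s z u l (d : nat) : (0 < d)%N ->
  gvm (V := V) A s z u (z + (- d%:Z)%:~R) (cre V (l, d.-1) (vac V)) =
  s *: (anncoef A u d l *: vac V).
Proof.
move=> d0; have [H1 H2] := an_cre_vac V A u l d0.
rewrite (gvm_int _ _ _ (N := d.+1)); last by move=> t dt; exact: H2.
rewrite big_ord_recr /= H1 addNr big1 ?add0r => [|t _]; first by rewrite /cz /= expseq0.
by rewrite cz_neg //; have := ltn_ord t; lia.
Qed.

(** A vertex operator determines its symbol, because the pairing [A] is
   nondegenerate. *)
Lemma gvm_inj s1 s2 z u1 u2 : s1 != 0 ->
  (forall d : nat, (0 < d)%N -> forall c : J -> K,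
     (forall l, \sum_j c j * A j l d%:Z = 0) -> forall j, c j = 0) ->
  (forall e f, gvm (V := V) A s1 z u1 e f = gvm (V := V) A s2 z u2 e f) ->
  s1 = s2 /\ forall j (m : int), m != 0 -> u1 j m = u2 j m.
Proof.
move=> s10 Anondeg H.
have sE : s1 = s2.
  have := H z (vac V); rewrite !gvm_vac => /eqP; rewrite -subr_eq0 -scalerBl.
  by rewrite scaler_eq0 (negPf (vac_neq0 V)) orbF subr_eq0 => /eqP.
split=> // j; case=> [[//|d]|d] _.
  apply/eqP; rewrite -subr_eq0; apply/eqP.
  apply: (Anondeg d.+1 isT (fun j => u1 j d.+1%:Z - u2 j d.+1%:Z)) => l.
  have := H (z + (- d.+1%:Z)%:~R) (cre V (l, d) (vac V)).
  rewrite !(@gvm_cre_vac _ _ _ _ d.+1) // -sE => /(scalerI s10)/eqP.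
  rewrite -subr_eq0 -scalerBl scaler_eq0 (negPf (vac_neq0 V)) orbF.
  rewrite /anncoef -mulrBr mulf_eq0 invr_eq0 pnatr_eq0 /= -sumrB => /eqP H0; rewrite -[RHS]H0.
  by apply: eq_bigr => k _; rewrite mulrBl.
rewrite NegzE; apply: (cz_vac_inj (V := V)) => // {}d.
by have := H (z + d%:Z%:~R) (vac V); rewrite !gvm_vac_cre -sE => /(scalerI s10).
Qed.

End Separation.

Section FuseCurrent.
Variables (R : realType) (J : finType).
Local Notation C := R[i].
Variable V : fockModel C (J * nat)%type.
Variable A : J -> J -> int -> C.

Lemma fuse_current s v z w l e f :
  \sum_(m \in [set: int]) cexp (- (e - m%:~R) * l) *:
     gnm (V := V) A s 0 v z w m%:~R (e - m%:~R) f =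
  gvm A (s * cexp (- z * l)) z (fuse v w (cexp l)) e f.
Proof.
have [[b ->]|ne] := mode_intP z e; last first.
  rewrite gvm_nonint // fsbig1 // => m _; rewrite gnm_nonint2 ?scaler0 // => a ea.
  by apply: (ne (a + m)); rewrite intrD addrA -ea subrK.
rewrite -(gnm_fuse _ _ _ _ _ _ _ (cexp_neq0 l)); apply: eq_fsbigr => m _.
have -> : - (z + b%:~R - m%:~R) * l = (m - b)%:~R * l + - z * l.
  by rewrite intrB; ring.
by rewrite cexpD cexpMz -scalerA -gnm_scale [cexp _ * s]mulrC.
Qed.
End FuseCurrent.

Section CommutatorModes.
Variables (R : realType) (n : nat) (P : params R n).
Local Notation C := R[i].
Local Notation I := 'I_n.+1.
Local Notation PF := (polyFock C (I * nat)%type).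
Local Notation A := (hA P).
Local Notation q := (qq P).
Local Notation p := (pp P).
Implicit Types (mu : I -> C) (J : I).

(** The two summands [Lambda_j], [Lambda_(j+1)] of [T_1] which do not commute
   with [S_j]. *)
Definition lo J : 'I_n.+2 := ix J.+1.
Definition hi J : 'I_n.+2 := ix J.+2.

Lemma loE J : lo J = J :> nat.
Proof. by rewrite /lo /ix inordK //= (ltn_trans (ltn_ord J)). Qed.

Lemma hiE J : hi J = J.+1 :> nat.
Proof. by rewrite /hi /ix inordK //= ltnS. Qed.

Lemma lo_neq_hi J : lo J != hi J.
Proof. by rewrite -val_eqE /= loE hiE ltn_eqF. Qed.

Definition kappa i J : C := gT P i * (q i J / p i J - 1).

Lemma BcurrentE J mu e f :
  Bcurrent P J mu e f = kappa (lo J) J *: Ucur P (lo J) J mu e f.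
Proof.
have E : (fun m : int => cexp (- (e - m%:~R) * logq P (lo J) J) *:
    nmode A (Lambda P (lo J)) (S_ P J) mu m%:~R (e - m%:~R) f) =
  (fun m : int => cexp (- (e - m%:~R) * logq P (lo J) J) *:
    gnm (V := PF) A (cexp (\sum_k lam P (lo J) k 0 * mu k)) 0 (lam P (lo J))
      (zdeg (S_ P J) mu) (sosc P J) m%:~R (e - m%:~R) f).
  apply: funext => m; apply: (congr1 (fun h : PF => cexp _ *: h)).
  rewrite [LHS]nmodeE zdeg_Lambda.
  by under eq_bigr do rewrite addr0.
etransitivity.
  exact: (congr1 (fun F : int -> PF => kappa (lo J) J *:
    \sum_(m \in [set: int]) F m) E).
exact: (congr1 (fun h : PF => kappa (lo J) J *: h)
  (@fuse_current R _ PF A (cexp (\sum_k lam P (lo J) k 0 * mu k)) (lam P (lo J))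
    (zdeg (S_ P J) mu) (sosc P J) (logq P (lo J) J) e f)).
Qed.

(** The equations of [commutativity] at a fixed total degree [E] of [z^m w^e]. The
   index [m] then enters through powers of the points [q_ij] alone, which is what
   separates the delta functions. *)
Definition comm_eq (B : currents R n) J mu (E : C) f : Prop := forall m : int,
  \sum_i kappa i J *: (cexp ((E - m%:~R) * logq P i J) *: Ucur P i J mu E f) =
  cexp ((E - m%:~R) * logq P (lo J) J) *: (B J mu E f : PF)
  - cexp ((E - m%:~R) * logq P (hi J) J) *: (B J mu E f : PF).

Lemma commutativityE B : locality_eqs P ->
  commutativity P B <-> forall J mu E f, comm_eq B J mu E f.
Proof.
move=> loc; split=> [comm J mu E f m|H j /andP[j1 jn] mu m e f].
  have JB : (1 <= J.+1 <= n.+1)%N by rewrite /= ltn_ord.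
  have H := comm J.+1 JB mu m (E - m%:~R) f.
  have JE : ix J.+1 = J by rewrite /ix inord_val.
  rewrite JE in H; have := commutator_modes loc J mu m (E - m%:~R) f.
  have mE : m%:~R + (E - m%:~R) = E by rewrite addrC subrK.
  rewrite mE => H'; rewrite /delta_mul mE in H.
  by etransitivity; first (symmetry; exact: H'); exact: H.
pose J : I := ix j; have jE : j = J.+1 by rewrite /J /ix inordK ?prednK // ltnS -ltnS prednK.
have H' := H J mu (m%:~R + e) f m; rewrite /comm_eq in H'.
have me : m%:~R + e - m%:~R = e by rewrite addrC addKr.
have loJ : lo J = ix j by rewrite /lo -jE.
have hiJ : hi J = ix j.+1 by rewrite /hi -jE.
rewrite loJ hiJ me in H'.
etransitivity; first exact: (commutator_modes loc J mu m e f).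
exact: H'.
Qed.

End CommutatorModes.

(** * Commutativity as equations between the parameters *)

Section DeltaSeparation.
Variables (R : realType).
Local Notation C := R[i].

Section TwoPoints.
Variables (V : lmodType C) (N : nat) (lq c : 'I_N -> C) (E : C).
Variables (U : 'I_N -> V) (B : V) (i1 i2 : 'I_N).
Hypothesis i12 : i1 != i2.

Let D i : V := (i == i1)%:R *: B - (i == i2)%:R *: B.

Let DE (x : 'I_N -> C) : \sum_i x i *: D i = x i1 *: B - x i2 *: B.
Proof.
rewrite (bigD1 i1) //= (bigD1 i2) 1?eq_sym //= big1 => [|i /andP[/negPf ii1 /negPf ii2]].
  rewrite /D !eqxx (negPf i12) eq_sym (negPf i12) !scale0r !scale1r subr0 sub0r.
  by rewrite addr0 scalerN.
by rewrite /D ii1 ii2 !scale0r subrr scaler0.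
Qed.

Lemma comm_join :
  c i1 *: U i1 = B -> c i2 *: U i2 = - B ->
  (forall i, i != i1 -> i != i2 -> c i *: U i = 0) ->
  forall m : int, \sum_i c i *: (cexp ((E - m%:~R) * lq i) *: U i) =
     cexp ((E - m%:~R) * lq i1) *: B - cexp ((E - m%:~R) * lq i2) *: B.
Proof.
move=> H1 H2 H0 m.
rewrite -(DE (fun i => cexp ((E - m%:~R) * lq i))); apply: eq_bigr => i _.
rewrite scalerA mulrC -scalerA; congr (_ *: _); rewrite /D.
case: (eqVneq i i1) => [->|ii1].
  by rewrite (negPf i12) scale1r scale0r subr0.
case: (eqVneq i i2) => [->|ii2]; first by rewrite scale0r scale1r sub0r.
by rewrite !scale0r subrr H0.
Qed.

(** The delta functions at distinct points are linearly independent. *)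
Lemma comm_separate : injective (fun i => cexp (lq i)) ->
  (forall m : int, \sum_i c i *: (cexp ((E - m%:~R) * lq i) *: U i) =
     cexp ((E - m%:~R) * lq i1) *: B - cexp ((E - m%:~R) * lq i2) *: B) ->
  [/\ c i1 *: U i1 = B, c i2 *: U i2 = - B &
      forall i, i != i1 -> i != i2 -> c i *: U i = 0].
Proof.
move=> qinj H.
have cE (m : int) i : cexp ((E - m%:~R) * lq i) = cexp (lq i) ^ (- m) * cexp (E * lq i).
  by rewrite mulrBl addrC -mulNr -rmorphN cexpD cexpMz.
have W0 : forall i, cexp (E * lq i) *: (c i *: U i - D i) = 0.
  apply: (vandermonde_sum (x := fun i => cexp (lq i))) => // k.
  have := H (- k%:Z); rewrite -(DE (fun i => cexp ((E - (- k%:Z)%:~R) * lq i))).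
  move/eqP; rewrite -subr_eq0 -sumrB => /eqP H'; rewrite -[RHS]H'.
  apply: eq_bigr => i _; rewrite cE opprK -exprnP !scalerBr !scalerA.
  by congr (_ *: _ - _); ring.
have {}W0 i : c i *: U i = D i.
  apply/eqP; rewrite -subr_eq0; have /eqP := W0 i.
  by rewrite scaler_eq0 (negPf (cexp_neq0 _)).
split=> [||i ii1 ii2]; rewrite W0 /D.
- by rewrite eqxx (negPf i12) scale1r scale0r subr0.
- by rewrite eqxx eq_sym (negPf i12) scale1r scale0r sub0r.
- by rewrite (negPf ii1) (negPf ii2) !scale0r subrr.
Qed.
End TwoPoints.

End DeltaSeparation.

Section ModesExt.
Variables (K : numFieldType) (J : finType) (V : fockModel K (J * nat)%type).
Variable A : J -> J -> int -> K.
Implicit Types (u : J -> int -> K).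

Lemma gvm_ext s z u1 u2 e f : (forall j (m : int), m != 0 -> u1 j m = u2 j m) ->
  gvm (V := V) A s z u1 e f = gvm A s z u2 e f.
Proof.
move=> uE; have czE d (g : V) : cz u1 d g = cz u2 d g.
  case: d => d //; apply: eq_expseq => m h m0; apply: eq_bigr => j _.
  by rewrite uE //; lia.
have anE t (g : V) : an A u1 t g = an A u2 t g.
  apply: eq_expseq => m h m0; apply: eq_bigr => l _; congr (_ * _ *: _).
  by apply: eq_bigr => j _; rewrite uE //; lia.
by congr (_ *: _); apply: eq_fsbigr => t _; rewrite czE anE.
Qed.

Lemma gvm_smul k s z u e f : k *: gvm (V := V) A s z u e f = gvm A (k * s) z u e f.
Proof. by rewrite /gvm scalerA. Qed.

Lemma gvm_opp s z u e f : - gvm (V := V) A s z u e f = gvm A (- s) z u e f.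
Proof. by rewrite /gvm scaleNr. Qed.

Lemma gvm_prop k1 k2 s1 s2 z u1 u2 e f : k1 * s1 = - (k2 * s2) ->
  (forall j (m : int), m != 0 -> u1 j m = u2 j m) ->
  k1 *: gvm (V := V) A s1 z u1 e f = - (k2 *: gvm A s2 z u2 e f).
Proof.
by move=> ks uE; rewrite !gvm_smul gvm_opp ks; exact: gvm_ext.
Qed.

Lemma gvm_prop_inj k1 k2 s1 s2 z u1 u2 : k1 * s1 != 0 ->
  (forall d : nat, (0 < d)%N -> forall c : J -> K,
     (forall l, \sum_j c j * A j l d%:Z = 0) -> forall j, c j = 0) ->
  (forall e f, k1 *: gvm (V := V) A s1 z u1 e f = - (k2 *: gvm A s2 z u2 e f)) ->
  k1 * s1 = - (k2 * s2) /\ forall j (m : int), m != 0 -> u1 j m = u2 j m.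
Proof.
move=> ks Anondeg H; apply: (gvm_inj (V := V) (z := z) ks Anondeg) => e f.
by rewrite -gvm_opp -!gvm_smul H.
Qed.
End ModesExt.

Lemma fuse_shift (K : comPzRingType) (b : bool) (s x y l : K) :
  (if b then s * (x - y) else 0) + l + y * (if b then s else 0) =
  l + x * (if b then s else 0).
Proof. by case: b; ring. Qed.

Lemma fuse_unshift (K : comPzRingType) (b : bool) (s x y l l' : K) :
  l + x * (if b then s else 0) = l' + y * (if b then s else 0) ->
  l - l' = if b then s * (y - x) else 0.
Proof.
case: b => e; last by move: e; rewrite !mulr0 !addr0 => ->; rewrite subrr.
have -> : l = l' + y * s - x * s by rewrite -e addrK.
by ring.
Qed.

Section Commutativity.
Variables (R : realType) (n : nat) (P : params R n).
Local Notation C := R[i].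
Local Notation I := 'I_n.+1.
Local Notation PF := (polyFock C (I * nat)%type).
Local Notation A := (hA P).
Local Notation q := (qq P).
Local Notation p := (pp P).
Implicit Types (mu : I -> C) (J : I).

(** The relations between the symbols of [Lambda_j], [Lambda_(j+1)] and [S_j]
   which make the two delta functions carry the same current. *)
Definition diff_eqs J : Prop :=
  [/\ forall i, i != lo J -> i != hi J -> kappa P i J = 0,
      forall k (m : int), m != 0 -> lam P (hi J) k m - lam P (lo J) k m =
        if k == J then sS P J m * (q (lo J) J ^ m - q (hi J) J ^ m) else 0,
      forall k, lam P (hi J) k 0 - lam P (lo J) k 0 =
        if k == J then logq P (hi J) J - logq P (lo J) J else 0
    & kappa P (lo J) J * cexp (- (A J J 0 / 2) * logq P (lo J) J) =
      - (kappa P (hi J) J * cexp (- (A J J 0 / 2) * logq P (hi J) J))].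

Definition Uscal i J mu : C :=
  cexp (\sum_k lam P i k 0 * mu k) * cexp (- zdeg (S_ P J) mu * logq P i J).

Definition zmode i J k : C := lam P i k 0 - if k == J then logq P i J else 0.

Lemma UscalE i J mu : Uscal i J mu =
  cexp (- (A J J 0 / 2) * logq P i J) * cexp (\sum_k zmode i J k * mu k).
Proof.
rewrite /Uscal -!cexpD zdeg_S; congr cexp.
rewrite [X in _ = _ + X](eq_bigr (fun k => lam P i k 0 * mu k +
   - (if k == J then logq P i J else 0) * mu k)); last by move=> k _; rewrite mulrDl.
rewrite big_split /= [X in _ = _ + (_ + X)](bigD1 J) //= eqxx.
rewrite [X in _ = _ + (_ + (_ + X))]big1; first by ring.
by move=> k /negPf->; rewrite oppr0 mul0r.
Qed.

Lemma Uscal_neq0 i J mu : Uscal i J mu != 0.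
Proof. by rewrite mulf_neq0 ?cexp_neq0. Qed.

Lemma diff_eqs_current J : diff_eqs J -> forall mu E f,
  (kappa P (hi J) J *: Ucur P (hi J) J mu E f : PF) =
  - (kappa P (lo J) J *: Ucur P (lo J) J mu E f : PF).
Proof.
move=> [_ Dm D0 Dk] mu E f.
have lamE : forall k, zmode (hi J) J k = zmode (lo J) J k.
  move=> k; rewrite /zmode; have := D0 k; case: (k == J) => Dk0; last first.
    by move/eqP: Dk0; rewrite subr_eq0 => /eqP ->.
  have -> : lam P (hi J) k 0 = (logq P (hi J) J - logq P (lo J) J) + lam P (lo J) k 0.
    by rewrite -Dk0 subrK.
  by ring.
have fE : forall k (m : int), m != 0 ->
    fuse (lam P (hi J)) (sosc P J) (q (hi J) J) k m =
    fuse (lam P (lo J)) (sosc P J) (q (lo J) J) k m.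
  move=> k m m0; have := Dm k m m0; rewrite /fuse /sosc.
  by move=> /eqP; rewrite subr_eq => /eqP ->; exact: fuse_shift.
apply: (@gvm_prop _ _ PF) => //; rewrite -/(Uscal (hi J) J mu) -/(Uscal (lo J) J mu).
rewrite !UscalE (eq_bigr _ (fun k _ => congr1 (fun x => x * mu k) (lamE k))).
by rewrite [X in _ = - X]mulrA Dk [X in _ = - X]mulNr opprK [LHS]mulrA.
Qed.

Lemma Ucur_neq0 i J mu : (Ucur P i J mu (zdeg (S_ P J) mu) (vac PF) : PF) != 0.
Proof.
have -> : (Ucur P i J mu (zdeg (S_ P J) mu) (vac PF) : PF) =
    Uscal i J mu *: vac PF by exact: gvm_vac.
by rewrite scaler_eq0 negb_or Uscal_neq0 vac_neq0.
Qed.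

(** By [diff_eqs] the two surviving currents are opposite to each other, whence the
   difference of two delta functions. *)
Lemma commutativity_suff : locality_eqs P -> (forall J, diff_eqs J) ->
  commutativity P (Bcurrent P).
Proof.
move=> loc deq; apply/(commutativityE _ loc) => J mu E f.
have [D0 _ _ _] := deq J.
apply: (@comm_join R PF _ (fun i => logq P i J) (fun i => kappa P i J) E
  (fun i => Ucur P i J mu E f) (Bcurrent P J mu E f) _ _ (lo_neq_hi J)).
- by symmetry; exact: BcurrentE.
- etransitivity; first exact: diff_eqs_current.
  by apply: (congr1 (fun h : PF => - h)); symmetry; exact: BcurrentE.
- by move=> i i1 i2; rewrite D0 // scale0r.
Qed.

Section Injective.
Hypothesis loc : locality_eqs P.
Hypothesis qinj : injective (fun ij : 'I_n.+2 * 'I_n.+1 => q ij.1 ij.2).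

Lemma qinj1 J : injective (fun i => cexp (logq P i J)).
Proof. by move=> i i' qE; have [] := @qinj (i, J) (i', J) qE. Qed.

Lemma commutativity_split B : commutativity P B -> forall J mu E (f : fock R n),
  [/\ (kappa P (lo J) J *: Ucur P (lo J) J mu E f : PF) = B J mu E f,
      (kappa P (hi J) J *: Ucur P (hi J) J mu E f : PF) = - (B J mu E f : PF) &
      forall i, i != lo J -> i != hi J ->
        (kappa P i J *: Ucur P i J mu E f : PF) = 0].
Proof.
move=> /(commutativityE B loc) H J mu E f.
exact: (@comm_separate R PF _ (fun i => logq P i J)
  (fun i => kappa P i J) E (fun i => Ucur P i J mu E f) (B J mu E f) _ _
  (lo_neq_hi J) (@qinj1 J) (H J mu E f)).
Qed.

Lemma commutativity_unique B : commutativity P B ->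
  forall J mu E f, B J mu E f = Bcurrent P J mu E f.
Proof.
move=> comm J mu E f; have [<- _ _] := commutativity_split comm J mu E f.
by symmetry; exact: BcurrentE.
Qed.

Lemma nondegenerate (M : I -> I -> C) : \det (\matrix_(i, j) M i j) != 0 ->
  forall c : I -> C, (forall l, \sum_j c j * M j l = 0) -> forall j, c j = 0.
Proof.
move=> M0 c cM j; have Mu : (\matrix_(i, j) M i j) \in unitmx.
  by rewrite unitmxE unitfE M0.
have c0 : (\row_j c j) *m (\matrix_(i, j) M i j) = 0.
  by apply/rowP => l; rewrite !mxE -[RHS](cM l); apply: eq_bigr => k _; rewrite !mxE.
have := congr1 (mulmx^~ (invmx (\matrix_(i, j) M i j))) c0.
by rewrite mulmxK // mul0mx => /rowP/(_ j); rewrite !mxE.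
Qed.

(** The currents at [q_jj] and [q_(j+1,j)] are opposite vertex operators, hence they have
   the same oscillators and zero modes; nonvanishing of the currents keeps both
   residues away from [0]. *)
Lemma commutativity_nec B : (forall m : int, \det (\matrix_(i, j) A i j m) != 0) ->
  commutativity P B -> currents_nonzero B ->
  forall J, [/\ diff_eqs J, kappa P (lo J) J != 0 & kappa P (hi J) J != 0].
Proof.
move=> Adet comm Bnz J.
have H mu E f := commutativity_split comm J mu E f.
have [klo khi] : kappa P (lo J) J != 0 /\ kappa P (hi J) J != 0.
  have [mu [E [f Bf]]] := Bnz J; have [H1 H2 _] := H mu E f.
  split; apply: contra Bf => /eqP k0; apply/eqP.
    by rewrite -H1 k0; exact: (scale0r (Ucur P (lo J) J mu E f : PF)).
  have B0 : - (B J mu E f : PF) = 0.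
    by rewrite -H2 k0; exact: (scale0r (Ucur P (hi J) J mu E f : PF)).
  by rewrite -[LHS](opprK (B J mu E f : PF)) B0; exact: (@oppr0 PF).
split=> //.
have Anondeg d (_ : (0 < d)%N) := nondegenerate (Adet d%:Z).
have prop mu : kappa P (hi J) J * Uscal (hi J) J mu =
      - (kappa P (lo J) J * Uscal (lo J) J mu) /\ forall j (m : int), m != 0 ->
      fuse (lam P (hi J)) (sosc P J) (q (hi J) J) j m =
      fuse (lam P (lo J)) (sosc P J) (q (lo J) J) j m.
  apply: (@gvm_prop_inj _ _ PF A _ _ _ _ (zdeg (S_ P J) mu)).
  - by rewrite mulf_neq0 // Uscal_neq0.
  - exact: Anondeg.
  - move=> e f; have [H1 H2 _] := H mu e f.
    etransitivity; first exact: H2.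
    by apply: (congr1 (fun h : PF => - h)); symmetry.
have zE : forall k, zmode (hi J) J k = zmode (lo J) J k.
  have cst := @cexp_const R _ (fun k => zmode (hi J) J k - zmode (lo J) J k)
    (- (kappa P (lo J) J * cexp (- (A J J 0 / 2) * logq P (lo J) J)) /
     (kappa P (hi J) J * cexp (- (A J J 0 / 2) * logq P (hi J) J))).
  move=> k; apply/eqP; rewrite -subr_eq0; apply/eqP; apply: cst => mu.
  have [+ _] := prop mu; rewrite !UscalE.
  have -> : \sum_k (zmode (hi J) J k - zmode (lo J) J k) * mu k =
     \sum_k zmode (hi J) J k * mu k - \sum_k zmode (lo J) J k * mu k.
    by rewrite -sumrB; apply: eq_bigr => l _; rewrite mulrBl.
  rewrite cexpD cexpN !mulrA => e1.
  have nz : kappa P (hi J) J * cexp (- (A J J 0 / 2) * logq P (hi J) J) != 0.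
    by rewrite mulf_neq0 // cexp_neq0.
  apply/eqP; rewrite eq_sym eqr_div ?nz ?cexp_neq0 //.
  by rewrite mulNr -e1 mulrC.
split.
- move=> i i1 i2; have [_ _ H0] := H (fun=> 0) (zdeg (S_ P J) (fun=> 0)) (vac PF).
  have /eqP := H0 i i1 i2; rewrite scaler_eq0 => /orP[/eqP //|/eqP U0].
  by have := Ucur_neq0 i J (fun=> 0); rewrite U0 eqxx.
- move=> k m m0; have [_ /(_ k m m0)] := prop (fun=> 0); rewrite /fuse /sosc.
  exact: fuse_unshift.
- move=> k; have := zE k; rewrite /zmode; case: (k == J) => e1; last first.
    by move: e1; rewrite !subr0 => ->; rewrite subrr.
  by apply/eqP; rewrite subr_eq -(inj_eq (addIr (- logq P (hi J) J))) e1; apply/eqP; ring.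
- have [+ _] := prop (fun=> 0); rewrite !UscalE.
  rewrite !big1 ?cexp0 ?mulr1; first by move=> ->; rewrite opprK.
    by move=> k _; rewrite mulr0.
  by move=> k _; rewrite mulr0.
Qed.

End Injective.
End Commutativity.

(** * Addition theorems *)

Section HyperbolicIdentities.
Variables (K : numFieldType) (e : K -> K).
Hypothesis eD : forall a b, e (a + b) = e a * e b.
Hypothesis e0 : e 0 = 1.

Lemma mexp_neq0 a : e a != 0.
Proof.
apply/eqP => a0; have := e0; rewrite -(subrr a) eD a0 mul0r => /eqP.
by rewrite eq_sym oner_eq0.
Qed.

Lemma mexpN a : e (- a) = (e a)^-1.
Proof.
apply: (mulfI (mexp_neq0 a)); rewrite -eD subrr e0 divff //.
exact: mexp_neq0.
Qed.

(** Twice the hyperbolic sine, [e] standing for [v |-> exp (m v)]. *)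
Definition sh (v : K) : K := e v - e (- v).

Lemma sh2 v : sh v * e v = e (2 * v) - 1.
Proof.
have -> : 2 * v = v + v by ring.
by rewrite /sh mulrBl -!eD addNr e0.
Qed.

Lemma sh_neq0 v : (sh v != 0) = (e (2 * v) != 1).
Proof.
by rewrite -[e _ == 1]subr_eq0 -sh2 mulf_eq0 (negPf (mexp_neq0 v)) orbF.
Qed.

Lemma ch_neq0 d : sh (2 * d) != 0 -> e d + e (- d) != 0.
Proof.
have -> : sh (2 * d) = (e d + e (- d)) * sh d.
  have -> : 2 * d = d + d by ring.
  by rewrite /sh opprD !eD; ring.
by rewrite mulf_eq0 negb_or => /andP[].
Qed.

Variable h : K.
Hypothesis h0 : sh h != 0.

Let eh1 : 1 - e (2 * h) != 0.
Proof. by rewrite subr_eq0 eq_sym -sh_neq0. Qed.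

(** The value of [s_(j-1)(m) A_(j-1,j)(m) s_j(-m)], with [d] the logarithm of
   [q_jj / q_(j-1,j-1)] and [2 h] that of [q_(j+1,j) / q_jj]. *)
Definition chX (d : K) : K := sh (h - d) / sh h.
(** The value of [s_j(m) s_j(-m)], in the notation of [chX] and with [d'] the next [d]. *)
Definition chS (d d' : K) : K :=
  (e (2 * h - 2 * d) - e (2 * d')) / (1 - e (2 * h)) - 1.

Lemma chS_flip d d' : d + d' = h -> chS d d' = -1.
Proof.
move=> dh; rewrite /chS; have -> : 2 * h - 2 * d = 2 * d' by rewrite -dh; ring.
by rewrite subrr mul0r sub0r.
Qed.

Lemma chS_same d : chS d d = - (sh (h - d) * (e d + e (- d)) / sh h).
Proof.
have E1 : 2 * h - 2 * d = h + h - d - d by ring.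
have E2 : 2 * h = h + h by ring.
have E3 : 2 * d = d + d by ring.
have := eh1; have := h0; rewrite /chS /sh E1 E2 E3.
rewrite !(opprD, opprK, eD, mexpN).
have := mexp_neq0 h; have := mexp_neq0 d; move: (e h) (e d) => t x x0 t0.
move=> t1 t2; field; rewrite t2 x0 t0 /=.
have -> : t * t - 1 = (t - t^-1) * t by field.
by rewrite mulf_neq0.
Qed.

(** When [d + d' = h] the middle coefficient is [-1], and otherwise it is the one of
   [chS_same]; the identity is an addition theorem in both cases. *)
Lemma sh_recurrence v d d' : d + d' = h \/ d' = d ->
  sh (v + d) * chX d + sh v * chS d d' + sh (v - d') * chX d' = 0.
Proof.
case=> [dh|->].
  rewrite chS_flip // /chX -dh.
  have -> : d + d' - d = d' by ring.
  have -> : d + d' - d' = d by ring.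
  have := h0; rewrite -dh /sh !(opprD, opprK, eD, mexpN).
  have := mexp_neq0 d; have := mexp_neq0 d'; have := mexp_neq0 v.
  move: (e v) (e d) (e d') => w x y w0 y0 x0 s0.
  field; rewrite w0 y0 x0 /=.
  have -> : (x * y) ^+ 2 - 1 = (x * y - x^-1 * y^-1) * (x * y) by field; rewrite x0 y0.
  by rewrite -invfM andbT mulf_neq0 ?s0 ?mulf_neq0.
rewrite chS_same /chX.
have := h0; rewrite /sh !(opprD, opprK, eD, mexpN).
have := mexp_neq0 d; have := mexp_neq0 h; have := mexp_neq0 v.
move: (e v) (e d) (e h) => w x t w0 t0 x0 s0.
field; rewrite w0 t0 x0 /=.
have -> : t ^+ 2 - 1 = (t - t^-1) * t by field.
by rewrite mulf_neq0.
Qed.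

(** The difference [q_jj^m - q_(j+1,j)^m] at [q_jj = exp a]: the step from row [j] to row
   [j + 1] of the coefficients of the [Lambda_i]. *)
Definition jump (a : K) : K := e a * (1 - e (2 * h)).

Lemma jump_diag a d d' :
  (e (a + 2 * h) - e (a + 2 * d')) - (e a - e (a + 2 * h - 2 * d)) =
  jump a * chS d d'.
Proof.
rewrite /jump /chS -[a + _ - _]addrA !eD.
by move: (e a) (e (2 * h)) (e (2 * d')) (e (2 * h - 2 * d)) eh1 => x y z w y0; field.
Qed.

Lemma jump_next a d : e (a + d) - e (a + d + 2 * h - 2 * d) = jump a * chX d.
Proof.
have -> : a + d + 2 * h - 2 * d = a + h + h - d by ring.
rewrite /jump /chX; have := h0; have -> : 2 * h = h + h by ring.
rewrite /sh !(opprD, opprK, eD, mexpN).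
have := mexp_neq0 d; have := mexp_neq0 h; have := mexp_neq0 a.
move: (e a) (e d) (e h) => w x t w0 t0 x0 s0.
field; rewrite t0 x0 /=.
have -> : t ^+ 2 - 1 = (t - t^-1) * t by field.
by rewrite mulf_neq0.
Qed.

Lemma jump_prev a d : - (e (a + 2 * h) - e (a + 2 * d)) = jump (a + d) * chX d.
Proof.
rewrite /jump /chX; have := h0; have -> : 2 * h = h + h by ring.
have -> : 2 * d = d + d by ring.
rewrite /sh !(opprD, opprK, eD, mexpN).
have := mexp_neq0 d; have := mexp_neq0 h; have := mexp_neq0 a.
move: (e a) (e d) (e h) => w x t w0 t0 x0 s0.
field; rewrite t0 x0 /=.
have -> : t ^+ 2 - 1 = (t - t^-1) * t by field.
by rewrite mulf_neq0.
Qed.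

Lemma first_row a d v : sh v != 0 ->
  - (e a * sh h * e (h - d) / sh v * sh v * chX d) = e a - e (a + 2 * h - 2 * d).
Proof.
move=> v0; rewrite divfK // /chX.
have -> : a + 2 * h - 2 * d = a + h + h - d - d by ring.
have := h0; rewrite /sh !(opprD, opprK, eD, mexpN).
have := mexp_neq0 d; have := mexp_neq0 h; have := mexp_neq0 a.
move: (e a) (e d) (e h) => w x t w0 t0 x0 s0.
field; rewrite t0 x0 /=.
have -> : t ^+ 2 - 1 = (t - t^-1) * t by field.
by rewrite mulf_neq0.
Qed.

(** The step between rows of [lambda] is what the two cases of its explicit formula
   differ by. *)
Lemma branch_jump a f v d : sh (f + v) != 0 ->
  - (e (a + h + (f + v) - d) * sh f) - e (a + h - d) * sh v =
  (jump (a + f - d)) / sh h * sh (f + v).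
Proof.
move=> fv; rewrite /jump; have := h0; have -> : 2 * h = h + h by ring.
move: fv; rewrite /sh !(opprD, opprK, eD, mexpN).
have := mexp_neq0 d; have := mexp_neq0 h; have := mexp_neq0 a.
have := mexp_neq0 f; have := mexp_neq0 v.
move: (e a) (e d) (e h) (e f) (e v) => w x t y z z0 y0 w0 t0 x0 _ s0.
field; rewrite t0 x0 y0 z0 /=.
have -> : t ^+ 2 - 1 = (t - t^-1) * t by field.
by rewrite mulf_neq0.
Qed.

(** Both factors [e(2 v) - 1] are hyperbolic sines up to the common power [e (d - h)]. *)
Lemma g_ratio g g' d d' :
  g * (e (2 * d - 2 * h) - 1) =
    - (g' * (e (2 * h - 2 * d') - 1) * e (d + d' - 2 * h)) <->
  g' * sh (h - d') = g * sh (h - d).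
Proof.
have -> : g * (e (2 * d - 2 * h) - 1) = - (g * sh (h - d) * e (d - h)).
  have -> : 2 * d - 2 * h = (d - h) + (d - h) by ring.
  have := mexpN (h - d); rewrite opprB => hd; rewrite (eD (d - h) (d - h)) /sh opprB hd.
  by have := mexp_neq0 (h - d); move: (e (h - d)) => x x0; field.
have -> : - (g' * (e (2 * h - 2 * d') - 1) * e (d + d' - 2 * h)) =
    - (g' * sh (h - d') * e (d - h)).
  have -> : d + d' - 2 * h = (d - h) + (d' - h) by ring.
  have -> : 2 * h - 2 * d' = (h - d') + (h - d') by ring.
  rewrite (eD (h - d') (h - d')) (eD (d - h) (d' - h)) /sh opprB.
  have := mexpN (h - d'); rewrite opprB => ->.
  by have := mexp_neq0 (h - d'); move: (e (h - d')) (e (d - h)) => x y x0; field.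
split=> [/oppr_inj/(mulIf (mexp_neq0 _)) -> //|-> //].
Qed.
End HyperbolicIdentities.

(** * The normal form of the parameters *)

Section Tridiagonal.
Variables (K : comPzRingType) (n : nat).

(** The window of three terms, without those which lie outside the range of summation. *)
Lemma sum_tri (G : nat -> K) l : (l < n.+1)%N ->
  (forall k, k != l -> k != l.+1 -> k != l.+2 -> G k = 0) ->
  \sum_(k < n.+1) G k.+1 = G l + G l.+1 + G l.+2 - G 0%N - G n.+2.
Proof.
move=> ln G0.
have E1 : \sum_(k < n.+3) G k = G 0%N + \sum_(k < n.+1) G k.+1 + G n.+2.
  by rewrite big_ord_recl big_ord_recr /= addrA; congr (_ + _ + G _).
have ll : (l < n.+3)%N by lia.
have l1 : (l.+1 < n.+3)%N by lia.
have l2 : (l.+2 < n.+3)%N by lia.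
have E2 : \sum_(k < n.+3) G k = G l + G l.+1 + G l.+2.
  rewrite (bigD1 (Ordinal ll)) //= (bigD1 (Ordinal l1)) /=; last by rewrite -val_eqE /=; lia.
  rewrite (bigD1 (Ordinal l2)) /=; last by rewrite -!val_eqE /=; lia.
  rewrite big1 ?addr0 ?addrA // => k; rewrite -!val_eqE /= => /andP[/andP[k1 k2] k3].
  exact: G0.
by rewrite -E2 E1; ring.
Qed.

(** Summation of a tridiagonal system: a solution of the homogeneous
   recurrence accounts for the first row, and every further row differs by one
   entry. *)
Lemma rows_solve (lm X T : nat -> nat -> K) (Y D : nat -> K) :
  (forall k l, k.+1 != l -> k != l -> k != l.+1 -> X k l = 0) ->
  (forall l, (l < n.+1)%N ->
     Y l * X l l.+1 + Y l.+1 * X l.+1 l.+1 + Y l.+2 * X l.+2 l.+1 = 0) ->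
  Y n.+2 = 0 ->
  (forall l, (l < n.+1)%N -> - (Y 0%N * X 0%N l.+1) = T 1%N l.+1) ->
  (forall i l, (i < n.+1)%N -> (l < n.+1)%N ->
     T i.+2 l.+1 - T i.+1 l.+1 = D i.+1 * X i.+1 l.+1) ->
  (forall k, (k < n.+1)%N -> lm 1%N k.+1 = Y k.+1) ->
  (forall i k, (i < n.+1)%N -> (k < n.+1)%N ->
     lm i.+2 k.+1 = lm i.+1 k.+1 + (if k == i then D i.+1 else 0)) ->
  forall i l, (i < n.+2)%N -> (l < n.+1)%N ->
    \sum_(k < n.+1) lm i.+1 k.+1 * X k.+1 l.+1 = T i.+1 l.+1.
Proof.
move=> X0 rec Yn T1 TD lm1 lmD; elim=> [|i IHi] l il ln.
  rewrite (eq_bigr (fun k : 'I_n.+1 => Y k.+1 * X k.+1 l.+1)); last first.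
    by move=> k _; rewrite lm1.
  rewrite (sum_tri (G := fun k => Y k * X k l.+1) ln) => [|k k1 k2 k3].
    by rewrite rec // Yn mul0r subr0 sub0r T1.
  by rewrite X0 ?mulr0 // eqSS.
rewrite (eq_bigr (fun k : 'I_n.+1 => lm i.+1 k.+1 * X k.+1 l.+1 +
   (if k == i :> nat then D i.+1 else 0) * X k.+1 l.+1)); last first.
  by move=> k _; rewrite lmD // mulrDl.
rewrite big_split /= IHi //; last by lia.
have iN : (i < n.+1)%N by [].
rewrite (bigD1 (Ordinal iN)) //= eqxx big1 ?addr0.
  by rewrite -TD // addrC subrK.
by move=> k; rewrite -val_eqE /= => /negPf ->; rewrite mul0r.
Qed.
End Tridiagonal.

Lemma tri0_identity (K : comPzRingType) (c v d d' h : K) :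
  d + d' = h \/ d' = d ->
  - (c * (v + d)) * (d - h) + - (c * v) * (2 * h - d - d')
  + - (c * (v - d')) * (d' - h) = 0.
Proof. by case=> [<-|->]; ring. Qed.

Section JumpIdentities.
Variables (K : comPzRingType) (h d d' : K).
Lemma jump0_diag : (2 * h - 2 * d') * h - (2 * d - 2 * h) * h =
  2 * h * (2 * h - d - d').
Proof. by ring. Qed.
Lemma jump0_up : (2 * d - 2 * h) * h - 0 * h = 2 * h * (d - h).
Proof. by ring. Qed.
Lemma jump0_down : 0 * h - (2 * h - 2 * d) * h = 2 * h * (d - h).
Proof. by ring. Qed.
End JumpIdentities.

Section NormalForm.
Variables (R : realType) (n : nat).
Local Notation C := R[i].
Local Notation I := 'I_n.+1.

Definition em (m : int) (v : C) : C := cexp (m%:~R * v).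

Lemma emD m a b : em m (a + b) = em m a * em m b.
Proof. by rewrite /em mulrDr cexpD. Qed.

Lemma em0 m : em m 0 = 1.
Proof. by rewrite /em mulr0 cexp0. Qed.

Lemma em_exp m v : em m v = cexp v ^ m.
Proof. exact: cexpMz. Qed.

Lemma ix_val (k : nat) : (k < n.+1)%N -> (@ix n k.+1 : nat) = k.
Proof. by move=> kn; rewrite /ix inordK. Qed.

Lemma ix_ord (k : I) : ix k.+1 = k.
Proof. by rewrite /ix inord_val. Qed.

Lemma ix_eq (k l : nat) : (k < n.+1)%N -> (l < n.+1)%N ->
  (@ix n k.+1 == @ix n l.+1) = (k == l).
Proof. by move=> kn ln; rewrite -val_eqE /= !ix_val. Qed.

Section Profile.
Variables (delta : nat -> C) (h a1 : C).

(** [q_jj = exp (apos j)], and [delta] is the sequence of the exponents of the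
   successive quotients. *)
Definition apos (j : nat) : C := a1 + \sum_(2 <= i < j.+1) delta i.
(** The sums of the exponents beyond [k]; [sh (Etail k)] solves the tridiagonal
   system and vanishes at the right end. *)
Definition Etail (k : nat) : C := \sum_(k.+1 <= i < n.+3) delta i.

Lemma apos1 : apos 1 = a1.
Proof. by rewrite /apos big_geq // addr0. Qed.

Lemma aposS j : apos j.+2 = apos j.+1 + delta j.+2.
Proof. by rewrite /apos big_nat_recr //= addrA. Qed.

Lemma EtailS k : (k < n.+2)%N -> Etail k = Etail k.+1 + delta k.+1.
Proof.
move=> kn; rewrite /Etail big_ltn; last by lia.
exact: addrC.
Qed.

Lemma Etail_end : Etail n.+2 = 0.
Proof. by rewrite /Etail big_geq. Qed.

(** The matrix [s_k(m) A_kl(m) s_l(-m)], with one more row at either end, where it is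
   continued by the same formula. *)
Definition Xext (m : int) (k l : nat) : C :=
  if k.+1 == l then chX (em m) h (delta l)
  else if k == l then chS (em m) h (delta k) (delta k.+1)
  else if k == l.+1 then chX (em m) h (delta k) else 0.

Definition Xext0 (k l : nat) : C :=
  if k.+1 == l then delta l - h
  else if k == l then 2 * h - delta k - delta k.+1
  else if k == l.+1 then delta k - h else 0.

(** The quotients [lambda_(1,k)(m) / s_k(m)]; the constant is fixed by the first
   equation of the system, see [first_row]. *)
Definition yrow (m : int) (k : nat) : C :=
  em m a1 * sh (em m) h * em m (h - delta 1) / sh (em m) (Etail 0)
  * sh (em m) (Etail k).

Definition yrow0 (k : nat) : C := - (2 * h / Etail 0 * Etail k).

Definition logq_nf (i j : nat) : C := if i == j then apos j else apos j + 2 * h.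
Definition logp_nf (i j : nat) : C :=
  if i == j then apos j + 2 * h - 2 * delta j else apos j + 2 * delta j.+1.

Definition logs_form (P : params R n) : Prop :=
  forall i j, (i < n.+2)%N -> (j < n.+1)%N ->
    if (i == j) || (i == j.+1) then
      logq P (ix i.+1) (ix j.+1) = logq_nf i.+1 j.+1 /\
      logp P (ix i.+1) (ix j.+1) = logp_nf i.+1 j.+1
    else logp P (ix i.+1) (ix j.+1) = logq P (ix i.+1) (ix j.+1).

(** The solution of the functional equations, in terms of [delta], [h], [a1]. *)
Record normal_form (P : params R n) : Prop := NormalForm {
  nf_logs : logs_form P;
  nf_X : forall k l (m : int), (k < n.+1)%N -> (l < n.+1)%N -> m != 0 ->
    sXs P (ix k.+1) (ix l.+1) m = Xext m k.+1 l.+1;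
  nf_A0 : forall k l, (k < n.+1)%N -> (l < n.+1)%N ->
    hA P (ix k.+1) (ix l.+1) 0 * h = Xext0 k.+1 l.+1;
  nf_lam1 : forall k, (k < n.+1)%N ->
    lam P (ix 1) (ix k.+1) 0 = yrow0 k.+1 /\
    forall m : int, m != 0 ->
      lam P (ix 1) (ix k.+1) m = sS P (ix k.+1) m * yrow m k.+1;
  nf_lamS : forall i k, (i < n.+1)%N -> (k < n.+1)%N ->
    lam P (ix i.+2) (ix k.+1) 0 = lam P (ix i.+1) (ix k.+1) 0 +
      (if k == i then 2 * h else 0) /\
    forall m : int, m != 0 ->
      lam P (ix i.+2) (ix k.+1) m = lam P (ix i.+1) (ix k.+1) m +
        (if k == i then sS P (ix k.+1) m * jump (em m) h (apos i.+1) else 0);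
  nf_g : forall i, (i < n.+1)%N ->
    gT P (ix i.+2) * sh (em 1) (h - delta i.+2) =
    gT P (ix i.+1) * sh (em 1) (h - delta i.+1)
}.

(** [delta_j + delta_(j+1) = h] is the case [A_jj(0) = 1]. *)
Definition flips : Prop := forall j, (j < n.+1)%N ->
  delta j.+1 + delta j.+2 = h \/ delta j.+2 = delta j.+1.

Hypothesis flip : flips.
Hypothesis shh : forall m : int, m != 0 -> sh (em m) h != 0.
Hypothesis shE : forall m : int, m != 0 -> sh (em m) (Etail 0) != 0.

(** The right-hand sides [q_il^m - p_il^m] of the locality equations. *)
Definition Tq (m : int) (i l : nat) : C :=
  if (i == l) || (i == l.+1) then em m (logq_nf i l) - em m (logp_nf i l) else 0.

Definition Tq0 (i l : nat) : C :=
  if (i == l) || (i == l.+1) then logq_nf i l - logp_nf i l else 0.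

Lemma Xext_far m k l : k.+1 != l -> k != l -> k != l.+1 -> Xext m k l = 0.
Proof. by rewrite /Xext => /negPf-> /negPf-> /negPf->. Qed.

Lemma Xext0_far k l : k.+1 != l -> k != l -> k != l.+1 -> Xext0 k l = 0.
Proof. by rewrite /Xext0 => /negPf-> /negPf-> /negPf->. Qed.

Lemma Xext_up m l : Xext m l l.+1 = chX (em m) h (delta l.+1).
Proof. by rewrite /Xext eqxx. Qed.
Lemma Xext_diag m l : Xext m l l = chS (em m) h (delta l) (delta l.+1).
Proof. by rewrite /Xext eqn_leq ltnn eqxx. Qed.
Lemma Xext_down m l : Xext m l.+1 l = chX (em m) h (delta l.+1).
Proof.
rewrite /Xext eqxx; have /negPf-> : l.+2 != l by lia.
by have /negPf-> : l.+1 != l by lia.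
Qed.

Lemma Xext0_up l : Xext0 l l.+1 = delta l.+1 - h.
Proof. by rewrite /Xext0 eqxx. Qed.
Lemma Xext0_diag l : Xext0 l l = 2 * h - delta l - delta l.+1.
Proof. by rewrite /Xext0 eqn_leq ltnn eqxx. Qed.
Lemma Xext0_down l : Xext0 l.+1 l = delta l.+1 - h.
Proof.
rewrite /Xext0 eqxx; have /negPf-> : l.+2 != l by lia.
by have /negPf-> : l.+1 != l by lia.
Qed.

Lemma logq_nf_diag j : logq_nf j j = apos j.
Proof. by rewrite /logq_nf eqxx. Qed.
Lemma logq_nf_next j : logq_nf j.+1 j = apos j + 2 * h.
Proof. by rewrite /logq_nf gtn_eqF. Qed.
Lemma logp_nf_diag j : logp_nf j j = apos j + 2 * h - 2 * delta j.
Proof. by rewrite /logp_nf eqxx. Qed.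
Lemma logp_nf_next j : logp_nf j.+1 j = apos j + 2 * delta j.+1.
Proof. by rewrite /logp_nf gtn_eqF. Qed.

Lemma Tq_diag m l : Tq m l l = em m (apos l) - em m (apos l + 2 * h - 2 * delta l).
Proof. by rewrite /Tq eqxx logq_nf_diag logp_nf_diag. Qed.
Lemma Tq_next m l :
  Tq m l.+1 l = em m (apos l + 2 * h) - em m (apos l + 2 * delta l.+1).
Proof. by rewrite /Tq eqxx orbT logq_nf_next logp_nf_next. Qed.
Lemma Tq_far m i l : i != l -> i != l.+1 -> Tq m i l = 0.
Proof. by rewrite /Tq => /negPf-> /negPf->. Qed.

Lemma Tq0_diag l : Tq0 l l = 2 * delta l - 2 * h.
Proof.
rewrite /Tq0 eqxx logq_nf_diag logp_nf_diag /=.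
by rewrite -[apos l + _ - _]addrA opprD addrA subrr sub0r opprB.
Qed.
Lemma Tq0_next l : Tq0 l.+1 l = 2 * h - 2 * delta l.+1.
Proof.
rewrite /Tq0 eqxx orbT logq_nf_next logp_nf_next.
by rewrite opprD addrACA subrr add0r.
Qed.
Lemma Tq0_far i l : i != l -> i != l.+1 -> Tq0 i l = 0.
Proof. by rewrite /Tq0 => /negPf-> /negPf->. Qed.

Lemma logs_Tq P i l m : logs_form P -> (i < n.+2)%N -> (l < n.+1)%N ->
  Tq m i.+1 l.+1 = qq P (ix i.+1) (ix l.+1) ^ m - pp P (ix i.+1) (ix l.+1) ^ m.
Proof.
move=> lg i_n ln; have := lg _ _ i_n ln; rewrite /Tq !eqSS /qq /pp.
case: ifP => [_ [-> ->]|_ ->]; last by rewrite subrr.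
by rewrite !em_exp.
Qed.

Lemma logs_Tq0 P i l : logs_form P -> (i < n.+2)%N -> (l < n.+1)%N ->
  Tq0 i.+1 l.+1 =
  logq P (ix i.+1) (ix l.+1) - logp P (ix i.+1) (ix l.+1).
Proof.
move=> lg i_n ln; have := lg _ _ i_n ln; rewrite /Tq0 !eqSS.
by case: ifP => [_ [-> ->]|_ ->]; last by rewrite subrr.
Qed.

Lemma row_tri m l : m != 0 -> (l < n.+1)%N ->
  yrow m l * Xext m l l.+1 + yrow m l.+1 * Xext m l.+1 l.+1 +
  yrow m l.+2 * Xext m l.+2 l.+1 = 0.
Proof.
move=> m0 ln; rewrite Xext_up Xext_diag Xext_down /yrow.
have E1 : Etail l.+2 = Etail l.+1 - delta l.+2 by rewrite (@EtailS l.+1) // addrK.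
have E2 : Etail l = Etail l.+1 + delta l.+1 by rewrite (@EtailS l) // ltnW.
have rec := sh_recurrence (emD m) (em0 m) (shh m0) (Etail l.+1) (flip ln).
by rewrite -!mulrA -!mulrDr E1 E2 rec !mulr0.
Qed.

Lemma row_start m l : m != 0 -> (l < n.+1)%N ->
  - (yrow m 0 * Xext m 0 l.+1) = Tq m 1 l.+1.
Proof.
move=> m0 ln; case: l ln => [|l] ln; last first.
  by rewrite Xext_far // mulr0 oppr0 Tq_far.
rewrite Xext_up Tq_diag apos1 /yrow.
exact: (first_row (emD m) (em0 m) (shh m0) a1 (delta 1) (shE m0)).
Qed.

Lemma row_jump m i l : m != 0 -> (i < n.+1)%N -> (l < n.+1)%N ->
  Tq m i.+2 l.+1 - Tq m i.+1 l.+1 = jump (em m) h (apos i.+1) * Xext m i.+1 l.+1.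
Proof.
move=> m0 i_n ln; case: (eqVneq i l) => [->|il].
  rewrite Tq_next Tq_diag Xext_diag.
  exact: (jump_diag (emD m) (em0 m) (shh m0)).
case: (eqVneq i.+1 l) => [<-|il1].
  rewrite Tq_diag [X in _ - X]Tq_far ?subr0 ?Xext_up ?aposS; try lia.
  exact: (jump_next (emD m) (em0 m) (shh m0)).
case: (eqVneq l.+1 i) => [<-|li].
  rewrite Tq_next Tq_far ?Xext_down ?aposS ?sub0r; try lia.
  exact: (jump_prev (emD m) (em0 m) (shh m0)).
by rewrite Xext_far ?mulr0 ?Tq_far ?subrr //; lia.
Qed.

Lemma row_tri0 l : (l < n.+1)%N ->
  yrow0 l * Xext0 l l.+1 + yrow0 l.+1 * Xext0 l.+1 l.+1 +
  yrow0 l.+2 * Xext0 l.+2 l.+1 = 0.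
Proof.
move=> ln; rewrite Xext0_up Xext0_diag Xext0_down /yrow0.
have E1 : Etail l.+2 = Etail l.+1 - delta l.+2 by rewrite (@EtailS l.+1) // addrK.
have E2 : Etail l = Etail l.+1 + delta l.+1 by rewrite (@EtailS l) // ltnW.
by rewrite E1 E2; exact: (tri0_identity _ _ (flip ln)).
Qed.

Lemma row_jump0 i l : (i < n.+1)%N -> (l < n.+1)%N ->
  Tq0 i.+2 l.+1 * h - Tq0 i.+1 l.+1 * h = 2 * h * Xext0 i.+1 l.+1.
Proof.
move=> i_n ln; case: (eqVneq i l) => [->|il].
  by rewrite Tq0_next Tq0_diag Xext0_diag; exact: jump0_diag.
case: (eqVneq i.+1 l) => [<-|il1].
  rewrite Tq0_diag [Tq0 i.+1 _]Tq0_far ?Xext0_up; try lia.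
  exact: jump0_up.
case: (eqVneq l.+1 i) => [<-|li].
  rewrite Tq0_next [Tq0 l.+3 _]Tq0_far ?Xext0_down; try lia.
  exact: jump0_down.
by rewrite Xext0_far ?mulr0 ?Tq0_far ?mul0r ?subrr //; lia.
Qed.

Lemma row_start0 l : Etail 0 != 0 -> (l < n.+1)%N -> - (yrow0 0 * Xext0 0 l.+1) = Tq0 1 l.+1 * h.
Proof.
move=> Et0 ln; case: l ln => [|l] ln; last first.
  by rewrite Xext0_far // mulr0 oppr0 Tq0_far // mul0r.
rewrite Xext0_up Tq0_diag /yrow0 divfK // mulNr opprK.
by rewrite -mulrBr mulrAC.
Qed.

End Profile.
End NormalForm.

(** * The normal form solves the functional equations *)

Lemma neg_swap (K : comPzRingType) (x y z w : K) :
  - (x * y * z) * w = - (x * y * (w * z)).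
Proof. by ring. Qed.

Lemma heisenberg_sym (R : realType) n (A : 'I_n.+1 -> 'I_n.+1 -> int -> R[i]) :
  heisenberg A -> forall k l (m : int), m != 0 -> A k l m = A l k (- m).
Proof.
case=> A1 A2 _ k l m m0; have [->|kl] := eqVneq k l; last exact: A2.
by rewrite !A1 ?oppr_eq0.
Qed.

Lemma logs_form_at (R : realType) n delta (h a1 : R[i]) (P : params R n) J :
  logs_form delta h a1 P ->
  [/\ logq P (lo J) J = apos delta a1 J.+1,
      logp P (lo J) J = apos delta a1 J.+1 + 2 * h - 2 * delta J.+1,
      logq P (hi J) J = apos delta a1 J.+1 + 2 * h &
      logp P (hi J) J = apos delta a1 J.+1 + 2 * delta J.+2].
Proof.
move=> lg; have Jn := ltn_ord J.
have := lg J J (ltnW Jn) Jn; have := lg J.+1 J Jn Jn.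
rewrite !eqxx orbT ix_ord /= logq_nf_diag logp_nf_diag logq_nf_next logp_nf_next.
by move=> [? ?] [? ?].
Qed.

(** The common factor [exp (- A_jj(0) a_j / 2)] of the two residues cancels, which leaves
   the equation of [g_ratio]. *)
Lemma kappa_balance (R : realType) n delta (h a1 : R[i]) (P : params R n) J :
  logs_form delta h a1 P -> hA P J J 0 * h = 2 * h - delta J.+1 - delta J.+2 ->
  kappa P (lo J) J * cexp (- (hA P J J 0 / 2) * logq P (lo J) J) =
      - (kappa P (hi J) J * cexp (- (hA P J J 0 / 2) * logq P (hi J) J)) <->
  gT P (hi J) * sh (em 1) (h - delta J.+2) = gT P (lo J) * sh (em 1) (h - delta J.+1).
Proof.
move=> lg A0; have [e1 e2 e3 e4] := logs_form_at J lg.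
rewrite -(g_ratio (emD (R := R) 1) (em0 R 1)).
rewrite /kappa /pp /qq e1 e2 e3 e4 -!cexpN -!cexpD.
have -> : apos delta a1 J.+1 - (apos delta a1 J.+1 + 2 * h - 2 * delta J.+1) =
   2 * delta J.+1 - 2 * h by ring.
have -> : apos delta a1 J.+1 + 2 * h - (apos delta a1 J.+1 + 2 * delta J.+2) =
   2 * h - 2 * delta J.+2 by ring.
have -> : - (hA P J J 0 / 2) * (apos delta a1 J.+1 + 2 * h) =
   - (hA P J J 0 / 2) * apos delta a1 J.+1 + (delta J.+1 + delta J.+2 - 2 * h).
  rewrite mulrDr; congr (_ + _); rewrite mulNr mulrA divfK ?pnatr_eq0 // A0.
  by ring.
have em1 v : em 1 v = cexp v by rewrite /em mul1r.
rewrite !em1 (cexpD (- (hA P J J 0 / 2) * _)); split=> [e|->]; last exact: neg_swap.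
apply: (mulIf (cexp_neq0 (- (hA P J J 0 / 2) * apos delta a1 J.+1))).
by rewrite e; symmetry; exact: neg_swap.
Qed.

Section NormalFormSolves.
Variables (R : realType) (n : nat) (P : params R n).
Local Notation C := R[i].
Variables (delta : nat -> C) (h a1 : C).
Hypothesis nf : normal_form delta h a1 P.

Lemma Xext_sym m k l : Xext delta h m k l = Xext delta h m l k.
Proof.
case: (eqVneq k l) => [->//|kl]; case: (eqVneq k.+1 l) => [<-|k1].
  by rewrite Xext_up Xext_down.
case: (eqVneq l.+1 k) => [<-|l1]; first by rewrite Xext_up Xext_down.
by rewrite !Xext_far // eq_sym.
Qed.

Lemma normal_form_symmetry : symmetry P.
Proof.
apply/symmetryP; split=> k l => [m m0|m fkl m0]; rewrite -[k]ix_ord -[l]ix_ord.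
  by rewrite !(nf_X nf) //; [exact: Xext_sym|lia|lia].
rewrite (nf_X nf) //; last by lia.
by have := fkl; rewrite /far => f; apply: Xext_far; lia.
Qed.

Hypothesis flip : flips n delta h.
Hypothesis h0 : h != 0.
Hypothesis Et0 : Etail n delta 0 != 0.
Hypothesis shh : forall m : int, m != 0 -> sh (em m) h != 0.
Hypothesis shE : forall m : int, m != 0 -> sh (em m) (Etail n delta 0) != 0.
Hypothesis A_sym : forall k l (m : int), m != 0 -> hA P k l m = hA P l k (- m).

(** The quotients [lambda_ik(m) / s_k(m)]: the first row, increased by the steps passed
   so far. *)
Definition lrow (m : int) (i k : nat) : C :=
  yrow n delta h a1 m k + (if (k < i)%N then jump (em m) h (apos delta a1 k) else 0).
Definition lrow0 (i k : nat) : C :=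
  yrow0 n delta h k + (if (k < i)%N then 2 * h else 0).

Lemma lrowS m i k : lrow m i.+2 k.+1 =
  lrow m i.+1 k.+1 + (if k == i then jump (em m) h (apos delta a1 i.+1) else 0).
Proof.
rewrite /lrow -addrA; congr (_ + _); rewrite !ltnS leq_eqVlt.
by case: eqP => [->|_] /=; rewrite ?ltnn ?add0r ?addr0.
Qed.

Lemma lrow0S i k : lrow0 i.+2 k.+1 = lrow0 i.+1 k.+1 + (if k == i then 2 * h else 0).
Proof.
rewrite /lrow0 -addrA; congr (_ + _); rewrite !ltnS leq_eqVlt.
by case: eqP => [->|_] /=; rewrite ?ltnn ?add0r ?addr0.
Qed.

Lemma lrow1 m k : lrow m 1 k.+1 = yrow n delta h a1 m k.+1.
Proof. by rewrite /lrow ltnS ltn0 addr0. Qed.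

Lemma lrow01 k : lrow0 1 k.+1 = yrow0 n delta h k.+1.
Proof. by rewrite /lrow0 ltnS ltn0 addr0. Qed.

Lemma lam_lrow i k (m : int) : (i < n.+2)%N -> (k < n.+1)%N -> m != 0 ->
  lam P (ix i.+1) (ix k.+1) m = sS P (ix k.+1) m * lrow m i.+1 k.+1.
Proof.
move=> + kn m0; elim: i => [|i IHi] i_n.
  by have [_ ->] := nf_lam1 nf kn => //; rewrite lrow1.
have [_ /(_ m m0) ->] := @nf_lamS _ _ _ _ _ _ nf i k i_n kn.
rewrite IHi; last exact: ltnW.
by rewrite lrowS [RHS]mulrDr; case: (k == i); rewrite ?mulr0.
Qed.

Lemma lam_lrow0 i k : (i < n.+2)%N -> (k < n.+1)%N ->
  lam P (ix i.+1) (ix k.+1) 0 = lrow0 i.+1 k.+1.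
Proof.
move=> + kn; elim: i => [|i IHi] i_n.
  by have [-> _] := nf_lam1 nf kn; rewrite lrow01.
have [-> _] := @nf_lamS _ _ _ _ _ _ nf i k i_n kn.
by rewrite IHi ?lrow0S // ltnW.
Qed.

Lemma lrow_sum i l (m : int) : (i < n.+2)%N -> (l < n.+1)%N -> m != 0 ->
  \sum_(k < n.+1) lrow m i.+1 k.+1 * Xext delta h m k.+1 l.+1 =
  Tq delta h a1 m i.+1 l.+1.
Proof.
move=> i_n ln m0.
apply: (@rows_solve _ n (lrow m) (Xext delta h m) (Tq delta h a1 m) (yrow n delta h a1 m)
  (fun k => jump (em m) h (apos delta a1 k)) _ _ _ _ _ _ _ i l i_n ln).
- exact: Xext_far.
- by move=> l' l'n; exact: row_tri.
- by rewrite /yrow Etail_end /sh oppr0 subrr mulr0.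
- by move=> l' l'n; exact: row_start.
- by move=> i' l' i'n l'n; exact: (row_jump _ _ shh m0 i'n l'n).
- by move=> k kn; rewrite lrow1.
- by move=> i' k i'n kn; rewrite lrowS.
Qed.

Lemma lrow0_sum i l : (i < n.+2)%N -> (l < n.+1)%N ->
  \sum_(k < n.+1) lrow0 i.+1 k.+1 * Xext0 delta h k.+1 l.+1 =
  Tq0 delta h a1 i.+1 l.+1 * h.
Proof.
move=> i_n ln; apply: (@rows_solve _ n lrow0 (Xext0 delta h)
  (fun i l => Tq0 delta h a1 i l * h) (yrow0 n delta h)
  (fun=> 2 * h) _ _ _ _ _ _ _ i l i_n ln).
- exact: Xext0_far.
- by move=> l' l'n; exact: row_tri0.
- by rewrite /yrow0 Etail_end mulr0 oppr0.
- by move=> l' l'n; exact: row_start0.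
- by move=> i' l' i'n l'n; exact: (row_jump0 delta h a1 i'n l'n).
- by move=> k kn; rewrite lrow01.
- by move=> i' k i'n kn; rewrite lrow0S.
Qed.

Let lamA_rows i l (m : int) : (i < n.+2)%N -> (l < n.+1)%N -> m != 0 ->
  lamA P (ix i.+1) (ix l.+1) m * sS P (ix l.+1) (- m) = Tq delta h a1 m i.+1 l.+1.
Proof.
move=> i_n ln m0; rewrite -lrow_sum // /lamA mulr_suml; apply: eq_bigr => k _.
rewrite -[k in LHS]ix_ord lam_lrow // -(nf_X nf) // /sXs.
by rewrite -!mulrA mulrCA.
Qed.

Let lamA_rows0 i l : (i < n.+2)%N -> (l < n.+1)%N ->
  lamA P (ix i.+1) (ix l.+1) 0 = Tq0 delta h a1 i.+1 l.+1.
Proof.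
move=> i_n ln; apply: (mulIf h0).
rewrite -lrow0_sum // /lamA mulr_suml; apply: eq_bigr => k _.
by rewrite -[k in LHS]ix_ord lam_lrow0 // -(nf_A0 nf) // mulrA.
Qed.

Let logs_Tq i l m := @logs_Tq R n delta h a1 P i l m (nf_logs nf).
Let logs_Tq0 i l := @logs_Tq0 R n delta h a1 P i l (nf_logs nf).

Lemma normal_form_locality : locality_eqs P.
Proof.
move=> i j; rewrite -(ix_ord i) -(ix_ord j).
have i_n := ltn_ord i; have jn := ltn_ord j.
split=> [|m m0|m m0].
- by rewrite lamA_rows0 // logs_Tq0 // cexpD cexpN.
- by rewrite lamA_rows ?logs_Tq //; lia.
- have mN : - m%:Z != 0 by lia.
  have := lamA_rows i_n jn mN; rewrite logs_Tq // opprK.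
  have eN (x : C) : x ^ (- m%:Z) = x^-1 ^+ m by rewrite -exprz_inv.
  rewrite !eN => <-.
  rewrite mulrC; congr (_ * _); apply: eq_bigr => l _; rewrite mulrC.
  by rewrite (A_sym (ix j.+1) l (m := m%:Z)) //; lia.
Qed.

Lemma normal_form_diff J : diff_eqs P J.
Proof.
have Jn := ltn_ord J.
have loJ : lo J = ix J.+1 by [].
have hiJ : hi J = ix J.+2 by [].
have JJ := ix_ord J.
have [e1 e2 e3 e4] := logs_form_at J (nf_logs nf).
split.
- move=> i i1 i2; have := nf_logs nf (i := i) (j := J) (ltn_ord i) Jn.
  rewrite !ix_ord; case: ifP => [|_ e].
    move: i1 i2; rewrite -!val_eqE /= loE hiE => /negPf-> /negPf-> //.
  by rewrite /kappa /pp /qq e divff ?cexp_neq0 // subrr mulr0.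
- move=> k m m0; rewrite -[k]ix_ord loJ hiJ.
  have [_ /(_ m m0) ->] := @nf_lamS _ _ _ _ _ _ nf J k Jn (ltn_ord k).
  rewrite addrC addKr ix_ord val_eqE; case: eqP => // ->.
  rewrite /qq -loJ -hiJ e1 e3 /jump -!em_exp emD; congr (_ * _).
  by rewrite mulrBr mulr1.
- move=> k; rewrite -[k]ix_ord loJ hiJ.
  have [-> _] := @nf_lamS _ _ _ _ _ _ nf J k Jn (ltn_ord k).
  rewrite addrC addKr ix_ord val_eqE; case: eqP => // _.
  by rewrite -loJ -hiJ e1 e3 addrC addKr.
- apply/kappa_balance; first exact: nf_logs nf.
  + have := @nf_A0 _ _ _ _ _ _ nf J J Jn Jn; by rewrite Xext0_diag JJ.
  + exact: (@nf_g _ _ _ _ _ _ nf J Jn).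
Qed.

Lemma normal_form_commutativity : commutativity P (Bcurrent P).
Proof. exact: commutativity_suff normal_form_locality normal_form_diff. Qed.

Lemma normal_form_mutual_locality : mutual_locality P.
Proof. exact/mutual_localityP/normal_form_locality. Qed.

End NormalFormSolves.

(** * Necessity: the logarithms of the points *)

Section ExponentEquations.
Variables (K : fieldType).
Implicit Types A B C D X : K.

(** The two values of [X] agree, and inverting the exponentials multiplies the quotient
   [(C - D) / (A - B)] by [A B / (C D)]. *)
Lemma even_diag A B C D X : A != 0 -> B != 0 -> C != 0 -> D != 0 ->
  (A - B) * X = (B - D) - (A - C) ->
  (A^-1 - B^-1) * X = (B^-1 - D^-1) - (A^-1 - C^-1) ->
  C = D \/ A * B = C * D.
Proof.
move=> A0 B0 C0 D0 e1 e2.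
have : (C - D) * (A * B - C * D) = 0.
  (* [A * B] times the second equation, plus the first one. *)
  have -> : (C - D) * (A * B - C * D) = C * D *
      (A * B * ((A^-1 - B^-1) * X - ((B^-1 - D^-1) - (A^-1 - C^-1))) +
       ((A - B) * X - ((B - D) - (A - C)))) by field; rewrite A0 B0 C0 D0.
  by rewrite e2 e1 !subrr mulr0 addr0 mulr0.
move/eqP; rewrite mulf_eq0 !subr_eq0 => /orP[] /eqP; tauto.
Qed.

(** The same argument as for [even_diag], for a neighbouring pair of currents. *)
Lemma even_next A B A' C X : A != 0 -> B != 0 -> A' != 0 -> C != 0 -> A' != C ->
  (A - B) * X = A' - C -> (A^-1 - B^-1) * X = A'^-1 - C^-1 -> A * B = A' * C.
Proof.
move=> A0 B0 A0' C0 AC e1 e2.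
have : (A' - C) * (A * B - A' * C) = 0.
  have -> : (A' - C) * (A * B - A' * C) = - (A * B * A' * C) *
    ((A'^-1 - C^-1) + (A' - C) / (A * B)) by field; rewrite A0 B0 A0' C0.
  rewrite -e2 -e1; have -> : (A^-1 - B^-1) * X + (A - B) * X / (A * B) = 0.
    by field; rewrite A0 B0.
  by rewrite mulr0.
by move/eqP; rewrite mulf_eq0 !subr_eq0 (negPf AC) => /eqP.
Qed.

(** The value of [X] is eliminated between the equations of two neighbouring currents. *)
Lemma neighbours A B A' B' C' D X : A' != 0 -> B != 0 ->
  (A - B) * X = A' - C' -> (A' - B') * X = D - B ->
  A * B = A' * C' -> A' * B' = B * D ->
  A' * B = A * B' \/ A' * A' = B * B.
Proof.
move=> A0' B0 e1 e2 e3 e4.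
have : (A' * B - A * B') * (A' * A' - B * B) = 0.
  (* The product of the first two equations, reduced by the last two. *)
  have -> : (A' * B - A * B') * (A' * A' - B * B) =
    A' * B * (A' - B') * (A' - C') - A' * B * (A - B) * (D - B)
    - B * (A' - B') * (A * B - A' * C') - A' * (A - B) * (A' * B' - B * D) by ring.
  rewrite -e1 -e2 e3 e4 !subrr !mulr0 !subr0.
  by rewrite -!mulrA [(A' - B') * _]mulrCA subrr.
by move/eqP; rewrite mulf_eq0 !subr_eq0 => /orP[] /eqP; tauto.
Qed.
End ExponentEquations.

Section Necessity.
Variables (R : realType) (n : nat).
Local Notation C := R[i].
Local Notation I := 'I_n.+1.

(** The hypotheses of the necessity part, after translation into equations. *)
Record functional_system (P : params R n) : Prop := FunctionalSystem {
  sys_heis : heisenberg (hA P);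
  sys_loc : locality_eqs P;
  sys_diff : forall J, diff_eqs P J;
  sys_lo : forall J, kappa P (lo J) J != 0;
  sys_hi : forall J, kappa P (hi J) J != 0;
  sys_sym : forall k l (m : nat), (0 < m)%N -> sXs P k l m = sXs P l k m;
  sys_coh : coherent_logs P;
  sys_inj : injective (fun ij : 'I_n.+2 * 'I_n.+1 => qq P ij.1 ij.2)
}.

Variable P : params R n.
Local Notation p := (pp P).
Local Notation q := (qq P).
Hypothesis sys : functional_system P.

Let Asym := heisenberg_sym (sys_heis sys).

Lemma locality_int i j (m : int) : m != 0 ->
  lamA P i j m * sS P j (- m) = q i j ^ m - p i j ^ m.
Proof.
have [_ H1 H2] := sys_loc sys i j; case: m => k k0; first by rewrite H1 //; lia.
rewrite NegzE opprK.
have eN (x : C) : x ^ (- k.+1%:Z) = x^-1 ^+ k.+1 by rewrite -exprz_inv.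
rewrite !eN -H2 // mulrC; congr (_ * _); apply: eq_bigr => l _.
by rewrite mulrC (Asym j l (m := k.+1%:Z)).
Qed.

Lemma sXs_opp k l (m : int) : m != 0 -> sXs P k l (- m) = sXs P l k m.
Proof.
by move=> m0; rewrite /sXs opprK (Asym l k m0) mulrC [sS P k _ * _]mulrC mulrA.
Qed.

Lemma sXs_sym k l (m : int) : m != 0 -> sXs P k l m = sXs P l k m.
Proof.
case: m => [m|m] m0; first by rewrite (sys_sym sys) //; lia.
by rewrite NegzE !sXs_opp // (sys_sym sys).
Qed.

Lemma sXs_even k l (m : int) : m != 0 -> sXs P k l (- m) = sXs P k l m.
Proof. by move=> m0; rewrite sXs_opp // sXs_sym. Qed.

(** The locality equation of row [j + 1] minus the one of row [j]: only the column [j] of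
   the coefficients changes, so a single product [s A s] remains. *)
Lemma jump_rel J l (m : int) : m != 0 ->
  (q (lo J) J ^ m - q (hi J) J ^ m) * sXs P J l m =
  (q (hi J) l ^ m - p (hi J) l ^ m) - (q (lo J) l ^ m - p (lo J) l ^ m).
Proof.
move=> m0; rewrite -(locality_int (hi J) l m0) -(locality_int (lo J) l m0).
rewrite -mulrBl /lamA -sumrB.
have [_ dm _ _] := sys_diff sys J.
rewrite (bigD1 J) //= big1 ?addr0 => [|k kJ].
  by rewrite -mulrBl dm // eqxx /sXs !mulrA [_ * sS P J m]mulrC.
by rewrite -mulrBl dm // (negPf kJ) mul0r.
Qed.

(** The same for the zero modes, through the logarithms. *)
Lemma jump_rel0 J l : (logq P (hi J) J - logq P (lo J) J) * hA P J l 0 =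
  (logq P (hi J) l - logp P (hi J) l) - (logq P (lo J) l - logp P (lo J) l).
Proof.
have [_ _ c3] := sys_coh sys; rewrite -!c3 -sumrB.
have [_ _ d0 _] := sys_diff sys J.
rewrite (bigD1 J) //= big1 ?addr0 => [|k kJ].
  by rewrite -mulrBl d0 // eqxx.
by rewrite -mulrBl d0 // (negPf kJ) mul0r.
Qed.

Lemma pq_lo J : p (lo J) J <> q (lo J) J.
Proof.
move=> e; have := sys_lo sys J.
by rewrite /kappa e divff ?qq_neq0 // subrr mulr0 eqxx.
Qed.

Lemma pq_hi J : p (hi J) J <> q (hi J) J.
Proof.
move=> e; have := sys_hi sys J.
by rewrite /kappa e divff ?qq_neq0 // subrr mulr0 eqxx.
Qed.

Lemma gT_neq0 i : gT P i != 0.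
Proof.
have glo J : gT P (lo J) != 0.
  by apply: contra (sys_lo sys J) => /eqP g0; rewrite /kappa g0 mul0r.
have ghi J : gT P (hi J) != 0.
  by apply: contra (sys_hi sys J) => /eqP g0; rewrite /kappa g0 mul0r.
have [i0|i0] := leqP i n.
  have -> : i = lo (ix i.+1).
    by apply: val_inj; rewrite /= loE ix_val.
  exact: glo.
have -> : i = hi (ix n.+1).
  by apply: val_inj; rewrite /= hiE ix_val //; have := ltn_ord i; lia.
exact: ghi.
Qed.

Lemma logs_far i J : i != lo J -> i != hi J -> logp P i J = logq P i J.
Proof.
move=> i1 i2; have [_ c2 _] := sys_coh sys; apply: c2.
have [/(_ i i1 i2) k0 _ _ _] := sys_diff sys J.
move/eqP: k0; rewrite /kappa mulf_eq0 (negPf (gT_neq0 i)) /= subr_eq0 => /eqP e.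
by have := congr1 ( *%R^~ (p i J)) e; rewrite mul1r divfK ?pp_neq0.
Qed.

Let gen_qlo J : genuine_log P (logq P (lo J) J).
Proof. by exists (lo J), J; split; [exact: pq_lo|right]. Qed.
Let gen_qhi J : genuine_log P (logq P (hi J) J).
Proof. by exists (hi J), J; split; [exact: pq_hi|right]. Qed.
Let gen_plo J : genuine_log P (logp P (lo J) J).
Proof. by exists (lo J), J; split; [exact: pq_lo|left]. Qed.
Let gen_phi J : genuine_log P (logp P (hi J) J).
Proof. by exists (hi J), J; split; [exact: pq_hi|left]. Qed.

(** [s_j(m) s_j(-m)] takes the same value at [1] and [-1], see [even_diag]. *)
Lemma logs_diag J :
  logp P (lo J) J = logp P (hi J) J \/
  logq P (lo J) J + logq P (hi J) J = logp P (lo J) J + logp P (hi J) J.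
Proof.
have [c1 _ _] := sys_coh sys.
have := even_diag (qq_neq0 P (lo J) J) (qq_neq0 P (hi J) J)
  (pp_neq0 P (lo J) J) (pp_neq0 P (hi J) J)
  (jump_rel J J (m := 1) isT).
have := jump_rel J J (m := -1) isT; rewrite sXs_even // => e /(_ e) [e1|e1].
  left; apply: (addIr (logp P (lo J) J)).
  by apply: c1 => //; rewrite -/(pp P _ _) e1.
by right; apply: c1.
Qed.

Variables (J J' : I).
Hypothesis JJ' : J' = J.+1 :> nat.

Let hiJ : hi J = lo J'.
Proof. by apply: val_inj; rewrite /= hiE loE JJ'. Qed.

Let far_lo : logp P (lo J) J' = logq P (lo J) J'.
Proof.
apply: logs_far; apply/eqP => /(congr1 (fun i => val i)) /=; rewrite ?loE ?hiE; lia.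
Qed.
Let far_hi : logp P (hi J') J = logq P (hi J') J.
Proof.
apply: logs_far; apply/eqP => /(congr1 (fun i => val i)) /=; rewrite ?loE ?hiE; lia.
Qed.

Let next_rel (m : int) : m != 0 ->
  (q (lo J) J ^ m - q (hi J) J ^ m) * sXs P J J' m =
  q (lo J') J' ^ m - p (lo J') J' ^ m.
Proof.
move=> m0; rewrite (jump_rel J J' m0).
have -> : p (lo J) J' = q (lo J) J' by rewrite /pp far_lo.
by rewrite hiJ [X in _ - X = _]subrr; exact: subr0.
Qed.

Let prev_rel (m : int) : m != 0 ->
  (q (lo J') J' ^ m - q (hi J') J' ^ m) * sXs P J J' m =
  p (hi J) J ^ m - q (hi J) J ^ m.
Proof.
move=> m0; rewrite (sXs_sym J J' m0) (jump_rel J' J m0).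
have -> : p (hi J') J = q (hi J') J by rewrite /pp far_hi.
by rewrite -hiJ [X in X - _ = _]subrr sub0r; exact: opprB.
Qed.

(** [s_j(m) A_(j,j+1)(m) s_(j+1)(-m)] takes the same value at [1] and [-1]. *)
Lemma logs_next :
  logq P (lo J) J + logq P (hi J) J = logq P (lo J') J' + logp P (lo J') J'.
Proof.
have [c1 _ _] := sys_coh sys; apply: c1 => //.
have qp : q (lo J') J' != p (lo J') J' by apply/eqP => e; apply: (pq_lo (J := J')).
have := even_next (qq_neq0 P (lo J) J) (qq_neq0 P (hi J) J)
  (qq_neq0 P (lo J') J') (pp_neq0 P (lo J') J') qp (next_rel (m := 1) isT).
by apply; have := next_rel (m := -1) isT; rewrite sXs_even.
Qed.

Lemma logs_prev :
  logq P (lo J') J' + logq P (hi J') J' = logq P (hi J) J + logp P (hi J) J.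
Proof.
have [c1 _ _] := sys_coh sys; apply: c1 => //.
have qp : p (hi J) J != q (hi J) J by apply/eqP; exact: pq_hi.
rewrite [RHS]mulrC.
have := even_next (qq_neq0 P (lo J') J') (qq_neq0 P (hi J') J')
  (pp_neq0 P (hi J) J) (qq_neq0 P (hi J) J) qp (prev_rel (m := 1) isT).
by apply; have := prev_rel (m := -1) isT; rewrite sXs_even.
Qed.

(** The other alternative of [neighbours] would identify the points [q_jj] and
   [q_(j,j-1)], which are distinct. *)
Lemma logs_step :
  logq P (hi J) J - logq P (lo J) J = logq P (hi J') J' - logq P (lo J') J'.
Proof.
have [c1 _ _] := sys_coh sys.
have cm a b c d : genuine_log P a -> genuine_log P b -> genuine_log P c ->
  genuine_log P d -> a + b = c + d -> cexp a * cexp b = cexp c * cexp d.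
  by move=> _ _ _ _ e; rewrite -!cexpD e.
have := neighbours (qq_neq0 P (lo J') J') (qq_neq0 P (hi J) J)
   (next_rel (m := 1) isT) (prev_rel (m := 1) isT).
rewrite -/(q _ _) => /(_ (cm _ _ _ _ (gen_qlo J) (gen_qhi J) (gen_qlo J') (gen_plo J') logs_next)).
move=> /(_ (cm _ _ _ _ (gen_qlo J') (gen_qhi J') (gen_qhi J) (gen_phi J) logs_prev)).
case=> e.
  have := c1 _ _ _ _ (gen_qlo J') (gen_qhi J) (gen_qlo J) (gen_qhi J') e.
  by move=> e'; apply/eqP; rewrite subr_eq addrAC eq_sym subr_eq addrC -e' addrC.
have e' := c1 _ _ _ _ (gen_qlo J') (gen_qlo J') (gen_qhi J) (gen_qhi J) e.
have e2 : logq P (lo J') J' = logq P (hi J) J.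
  apply: (@mulIf _ (2 : C)); first by rewrite pnatr_eq0.
  by rewrite !mulrDr !mulr1.
have := @sys_inj _ sys (lo J', J') (hi J, J); rewrite /= /qq e2 => /(_ erefl) [_ e3].
by move: JJ'; rewrite e3; lia.
Qed.

End Necessity.

(** * The extended Dynkin data *)

Lemma Re_mul_real (R : realType) (z t : R[i]) :
  complex.Im t = 0 -> complex.Re (z * t) = complex.Re z * complex.Re t.
Proof. by case: z t => a b [c d] /= ->; rewrite mulr0 subr0. Qed.

Section DynkinProfile.
Variables (R : realType) (n : nat) (P : params R n).
Local Notation C := R[i].
Hypothesis n_gt0 : (0 < n)%N.

(** A positive real multiple of a number with nonzero real part is not a period of [exp]. *)
Lemma sh_em_neq0 (m : int) (h t : C) : m != 0 -> complex.Re h != 0 -> 0 < t ->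
  sh (em m) (h * t) != 0.
Proof.
move=> m0 h0; rewrite ltcE /= => /andP[/eqP t1 t0].
rewrite (sh_neq0 (emD (R := R) m) (em0 R m)); apply/eqP => /(congr1 Num.norm).
rewrite /em norm_cexp normr1 => /(congr1 (@complex.Re R)) /= e1.
have {e1} : complex.Re (m%:~R * (2 * (h * t))) = 0 by apply: expR_inj; rewrite expR0.
have -> : m%:~R * (2 * (h * t)) = h * t * ((m * 2)%:~R%:C)%C.
  by rewrite rmorph_int intrM [RHS]mulrC -!mulrA.
rewrite !Re_mul_real //= => /eqP; rewrite !mulf_eq0 (negPf h0) (gt_eqF t0) /=.
by rewrite intr_eq0 mulf_eq0 (negPf m0).
Qed.

Lemma Aext_in k l : (0 < k <= n.+1)%N -> (0 < l <= n.+1)%N ->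
  Aext P k l = Aat P k l 0.
Proof.
move=> /andP[k0 kn] /andP[l0 ln]; rewrite /Aext !modn_small ?ltnS //.
by rewrite !gtn_eqF.
Qed.

Lemma Aext_first : Aext P 0 1 =
  if ix 1 \in Jset P then - 1 - Aat P 1 2 0 else Aat P 1 2 0.
Proof. by rewrite /Aext mod0n modn_small ?ltnS. Qed.

Lemma Aext_last : Aext P n.+1 n.+2 =
  if ix n.+1 \in Jset P then - 1 - Aat P n.+1 n 0 else Aat P n.+1 n 0.
Proof.
rewrite /Aext modnn eqxx modn_small ?ltnS //= /A0at eqxx.
by have /negPf-> : n.+1 != 1%N by lia.
Qed.

(** For [j] in [Jset], where [A_jj(0) = 1], the rule says that row [j] of the extended
   matrix adds up to zero. *)
Definition dynkin : Prop := forall j, (j < n.+1)%N ->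
  Aext P j.+1 j.+2 =
  if ix j.+1 \in Jset P then - 1 - Aext P j j.+1 else Aext P j j.+1.

(** With these bounds all exponents [prof h j] are positive multiples of [h], which keeps
   every denominator away from [0]. *)
Definition subcritical : Prop := forall j, (j < n.+2)%N -> -1 < Aext P j j.+1 < 0.

(** At both ends of the diagram the rule holds by the definition of the extension. *)
Lemma dynkin_ends :
  (forall k l, Aat P k l 0 = Aat P l k 0) ->
  (forall j, (0 < j < n)%N -> Aext P j.+1 j.+2 =
  if ix j.+1 \in Jset P then - 1 - Aext P j j.+1 else Aext P j j.+1) -> dynkin.
Proof.
move=> A_sym mid j jn; have [->|j0] := eqVneq j 0%N.
  rewrite Aext_in // Aext_first; case: (_ \in _) => //.
  by rewrite opprB addrC subrK.
have [->|jn'] := eqVneq j n.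
  by rewrite Aext_last (@Aext_in n n.+1) ?n_gt0 ?leqnSn ?leqnn // (A_sym n.+1).
by apply: mid; lia.
Qed.

Lemma subcritical_ends : (forall k l, Aat P k l 0 = Aat P l k 0) ->
  (forall k, (1 <= k <= n)%N -> - 1 < Aat P k k.+1 0 < 0) -> subcritical.
Proof.
move=> A_sym mid j jn.
have opp (a : C) : - 1 < a < 0 -> - 1 < - 1 - a < 0.
  by move=> /andP[a1 a2]; rewrite ltrDl oppr_gt0 a2 ltrBlDr add0r.
have [->|j0] := eqVneq j 0%N.
  by rewrite Aext_first; case: ifP => _; [apply: opp|]; apply: mid.
have [->|jn'] := eqVneq j n.+1.
  by rewrite Aext_last A_sym; case: ifP => _; [apply: opp|]; apply: mid; rewrite n_gt0 /=.
by rewrite Aext_in; [apply: mid|..]; lia.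
Qed.

(** The logarithm of [q_jj / q_(j-1,j-1)] in terms of the extended matrix. *)
Definition prof (h : C) (i : nat) : C := h * (1 + Aext P i.-1 i).

Section Nonvanishing.
Variable h : C.
Hypothesis dyn : dynkin.
Hypothesis sub : subcritical.

Lemma prof_flips : flips n (prof h) h.
Proof.
move=> j jn; rewrite /prof /= dyn //; case: ifP => _; last by right.
by left; ring.
Qed.

Lemma prof_bounds j : (j < n.+2)%N -> 0 < 1 + Aext P j j.+1 < 1.
Proof.
by move=> jn; have := sub jn; rewrite gtrDl -ltrBlDl sub0r.
Qed.

Lemma Etail_prof : exists2 t : C, 0 < t & Etail n (prof h) 0 = h * t.
Proof.
exists (\sum_(1 <= i < n.+3) (1 + Aext P i.-1 i)); last by rewrite /Etail mulr_sumr.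
rewrite big_nat_recl //= ltr_pwDl //; first by have /andP[] := prof_bounds (ltn0Sn n.+1).
rewrite big_nat_cond sumr_ge0 // => i; rewrite andbT => /andP[i0 i1].
by apply: ltW; have /andP[] := @prof_bounds i i1.
Qed.

Hypothesis h0 : complex.Re h != 0.

Lemma profile_neq0 : h != 0.
Proof. by apply: contraNneq h0 => ->. Qed.

Lemma sh_h_neq0 (m : int) : m != 0 -> sh (em m) h != 0.
Proof. by move=> m0; have := sh_em_neq0 m0 h0 ltr01; rewrite mulr1. Qed.

Lemma sh_Etail_neq0 (m : int) : m != 0 -> sh (em m) (Etail n (prof h) 0) != 0.
Proof. by move=> m0; have [t t0 ->] := Etail_prof; exact: sh_em_neq0. Qed.

Lemma Etail_neq0 : Etail n (prof h) 0 != 0.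
Proof.
have [t t0 ->] := Etail_prof; by rewrite mulf_neq0 ?profile_neq0 // gt_eqF.
Qed.

Lemma sh_prof_neq0 (m : int) j : m != 0 -> (j < n.+2)%N ->
  sh (em m) (h - prof h j.+1) != 0.
Proof.
move=> m0 jn; have -> : h - prof h j.+1 = h * (- Aext P j j.+1).
  by rewrite /prof /= mulrDr mulr1 opprD addrA subrr sub0r mulrN.
by apply: sh_em_neq0 => //; have /andP[_] := sub jn; rewrite oppr_gt0.
Qed.

Lemma chS_prof_neq0 (m : int) j : m != 0 -> (j < n.+1)%N ->
  chS (em m) h (prof h j.+1) (prof h j.+2) != 0.
Proof.
move=> m0 jn; case: (prof_flips jn) => [e|->].
  by rewrite (chS_flip _ e) oppr_eq0 oner_eq0.
rewrite (chS_same (emD (R := R) m) (em0 R m) (sh_h_neq0 m0)) oppr_eq0.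
rewrite !mulf_neq0 ?invr_eq0 ?sh_h_neq0 //; first by apply: sh_prof_neq0 => //; exact: ltnW.
apply: (ch_neq0 (emD (R := R) m)); rewrite mulrCA; apply: sh_em_neq0 => //.
by rewrite mulr_gt0 ?ltr0n //; have /andP[] := prof_bounds (ltnW jn).
Qed.

End Nonvanishing.
End DynkinProfile.

(** * Necessity: the normal form *)

Section LogArithmetic.
Variable K : numFieldType.
Implicit Types a b c d h A B : K.

Let two0 : (2 : K) != 0. Proof. by rewrite pnatr_eq0. Qed.

Lemma log_next a b a' c' h A : b = a + 2 * h -> a + b = a' + c' ->
  2 * h * A = a' - c' -> a' = a + h * (1 + A).
Proof.
move=> -> e1 e2; apply: (mulfI two0).
have -> : 2 * (a + h * (1 + A)) = 2 * a + 2 * h + 2 * h * A by ring.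
have -> : 2 * a + 2 * h = a' + c' by rewrite -e1; ring.
by rewrite e2; ring.
Qed.

Lemma log_near a b a' c' h x : b = a + 2 * h -> a + b = a' + c' ->
  a' = a + x -> c' = a' + 2 * h - 2 * x.
Proof.
move=> -> e1 e2; apply: (addrI a'); rewrite -e1 e2; ring.
Qed.

Lemma log_far a b a' b' d h x : b = a + 2 * h -> b' = a' + 2 * h ->
  a' + b' = b + d -> a' = a + x -> d = a + 2 * x.
Proof.
move=> e0 -> e1 e2; apply: (addrI b); rewrite -e1 e0 e2; ring.
Qed.

Lemma diag_unit a b c d h A : h != 0 -> b = a + 2 * h ->
  2 * h * A = (b - d) - (a - c) -> (A == 1) = (c == d).
Proof.
move=> h0 -> e; have h2 : 2 * h != 0 by rewrite mulf_neq0.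
rewrite -(inj_eq (mulfI h2)) e mulr1 -subr_eq0 -[c == d]subr_eq0.
by congr (_ == 0); ring.
Qed.

(** Whether [p_jj = p_(j+1,j)] or [p_jj p_(j+1,j) = q_jj q_(j+1,j)] decides between the
   two possible values of the next entry of the Dynkin diagram. *)
Lemma flip_of_logs (J : bool) a c d h A A' : h != 0 ->
  c = a + 2 * h - 2 * (h * (1 + A)) -> d = a + 2 * (h * (1 + A')) ->
  (if J then c = d else a + (a + 2 * h) = c + d) -> A' = if J then -1 - A else A.
Proof.
move=> h0 -> ->; case: J => e; apply: (mulfI (mulf_neq0 two0 h0)).
  apply: (addrI (a + 2 * h)); transitivity (a + 2 * (h * (1 + A'))); first by ring.
  by rewrite -e; ring.
apply: (addIr (a + 2 * h - 2 * (h * (1 + A)) + a + 2 * h)).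
transitivity (a + 2 * h - 2 * (h * (1 + A)) + (a + 2 * (h * (1 + A')))); first by ring.
by rewrite -e; ring.
Qed.

Lemma log_first (J : bool) a c d h A A' : A' = (if J then -1 - A else A) ->
  d = a + 2 * (h * (1 + A')) -> (if J then c = d else a + (a + 2 * h) = c + d) ->
  c = a + 2 * h - 2 * (h * (1 + A)).
Proof.
move=> -> ->; case: J => [->|e]; first by ring.
apply: (addIr (a + 2 * (h * (1 + A)))); rewrite -e; ring.
Qed.

Lemma log_last (J : bool) a c d h A A' : A' = (if J then -1 - A else A) ->
  c = a + 2 * h - 2 * (h * (1 + A)) ->
  (if J then c = d else a + (a + 2 * h) = c + d) -> d = a + 2 * (h * (1 + A')).
Proof.
move=> -> ->; case: J => [<-|e]; first by ring.
apply: (addrI (a + 2 * h - 2 * (h * (1 + A)))); rewrite -e; ring.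
Qed.
End LogArithmetic.

Lemma swap4 (K : comPzRingType) (x y z w : K) : x * y * z * w = y * (x * z * w).
Proof. by ring. Qed.

Section NormalFormNecessary.
Variables (R : realType) (n : nat) (P : params R n).
Local Notation C := R[i].
Local Notation I := 'I_n.+1.
Hypothesis n_gt0 : (0 < n)%N.
Hypothesis sys : functional_system P.
Hypothesis qnorm : `|qq P (ix 2) (ix 1) / qq P (ix 1) (ix 1)| != 1.
Hypothesis crit : forall k, (1 <= k <= n)%N -> - 1 < Aat P k k.+1 0 < 0.

(** Half the logarithm of [q_21 / q_11], that is [r log x]. *)
Definition step : C := (logq P (ix 2) (ix 1) - logq P (ix 1) (ix 1)) / 2.
Local Notation h := step.

Let a j := logq P (ix j.+1) (ix j.+1).
Let b j := logq P (ix j.+2) (ix j.+1).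
Let c j := logp P (ix j.+1) (ix j.+1).
Let d j := logp P (ix j.+2) (ix j.+1).

Lemma lo_ix j : (j < n.+1)%N -> lo (@ix n j.+1) = ix j.+1.
Proof. by move=> jn; rewrite /lo ix_val. Qed.
Lemma hi_ix j : (j < n.+1)%N -> hi (@ix n j.+1) = ix j.+2.
Proof. by move=> jn; rewrite /hi ix_val. Qed.

Lemma step_double : 2 * h = b 0 - a 0.
Proof. by rewrite /step mulrC divfK // pnatr_eq0. Qed.

Lemma step_Re : complex.Re h != 0.
Proof.
apply: contraNneq qnorm => h0; rewrite /qq -cexpN -cexpD norm_cexp.
rewrite -[_ - _]step_double mulrC Re_mul_real ?h0 ?mul0r ?expR0 //.
by rewrite /= addr0.
Qed.

Let h0 : h != 0.
Proof. by apply: contraNneq step_Re => ->. Qed.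

Let ixS j : (j < n)%N -> @ix n j.+2 = (@ix n j.+1).+1 :> nat.
Proof. by move=> jn; rewrite !ix_val // ltnW. Qed.

Lemma step_const j : (j < n.+1)%N -> b j = a j + 2 * h.
Proof.
elim: j => [_|j IHj jn]; first by rewrite step_double addrC subrK.
have jn' : (j < n.+1)%N by lia.
have := logs_step sys (ixS jn).
rewrite !lo_ix // !hi_ix // -/(a _) -/(b _) -/(a j.+1) -/(b j.+1) IHj //.
by rewrite addrAC subrr add0r => ->; rewrite addrC subrK.
Qed.

Lemma Aat_sym k l : Aat P k l 0 = Aat P l k 0.
Proof.
rewrite /Aat; have [->//|kl] := eqVneq (ix k : I) (ix l).
by have [_ /(_ _ _ 0 kl) + _] := sys_heis sys; rewrite oppr0.
Qed.

Let sub : subcritical P := subcritical_ends n_gt0 Aat_sym crit.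

Lemma next_logs j : (j < n)%N -> a j.+1 = a j + prof P h j.+2.
Proof.
move=> jn; have jn' : (j < n.+1)%N by lia.
have := logs_next sys (ixS jn); rewrite !lo_ix // !hi_ix // => e1.
apply: (log_next (step_const jn') e1).
have := jump_rel0 sys (ix j.+1) (ix j.+2); rewrite !lo_ix // !hi_ix //.
rewrite -/(a _) -/(b _) step_const // addrAC subrr add0r Aext_in; try lia.
rewrite /Aat => ->; rewrite (@logs_far _ _ _ sys (ix j.+1)) ?subrr ?subr0 //.
  by rewrite lo_ix // -val_eqE /= !ix_val; lia.
by rewrite hi_ix // -val_eqE /= !ix_val; lia.
Qed.

Lemma apos_logs j : (j < n.+1)%N -> a j = apos (prof P h) (a 0) j.+1.
Proof.
elim: j => [_|j IHj jn]; first by rewrite apos1.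
by rewrite next_logs // IHj ?aposS // ltnW.
Qed.

Lemma near_logs j : (j < n)%N -> c j.+1 = a j.+1 + 2 * h - 2 * prof P h j.+2.
Proof.
move=> jn; have jn' : (j < n.+1)%N by lia.
have := logs_next sys (ixS jn); rewrite !lo_ix // !hi_ix // => e1.
exact: (log_near (step_const jn') e1 (next_logs jn)).
Qed.

Lemma far_logs j : (j < n)%N -> d j = a j + 2 * prof P h j.+2.
Proof.
move=> jn; have jn' : (j < n.+1)%N by lia.
have := logs_prev sys (ixS jn); rewrite !lo_ix // !hi_ix // => e1.
exact: (log_far (step_const jn') (step_const (j := j.+1) jn) e1 (next_logs jn)).
Qed.

Lemma diag_logs j : (j < n.+1)%N ->
  if ix j.+1 \in Jset P then c j = d j else a j + (a j + 2 * h) = c j + d j.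
Proof.
move=> jn; have -> : (ix j.+1 \in Jset P) = (c j == d j).
  rewrite inE; apply: (diag_unit h0 (step_const jn)).
  have := jump_rel0 sys (ix j.+1) (ix j.+1); rewrite !lo_ix // !hi_ix //.
  by rewrite -/(a _) -/(b _) step_const // [X in X * _]addrAC subrr add0r.
have := logs_diag sys (ix j.+1); rewrite !lo_ix // !hi_ix //.
rewrite -/(a _) -/(b _) -/(c _) -/(d _) step_const //.
by case: eqP => // cd [/cd|].
Qed.

Lemma system_dynkin : dynkin P.
Proof.
apply: dynkin_ends => // [|j /andP[j0 jn]]; first exact: Aat_sym.
have jn' : (j < n.+1)%N by lia.
apply: (flip_of_logs h0 _ _ (diag_logs jn')).
  by case: j j0 jn jn' => // j _ jn _; rewrite near_logs //; lia.
by rewrite far_logs.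
Qed.

Lemma system_logs_form : logs_form (prof P h) h (a 0) P.
Proof.
move=> i j i_n jn; have := system_dynkin jn => dyn.
have cj : c j = a j + 2 * h - 2 * prof P h j.+1.
  case: j jn dyn => [|j] jn dyn; last exact: near_logs.
  apply: (log_first dyn _ (diag_logs jn)); exact: far_logs.
have dj : d j = a j + 2 * prof P h j.+2.
  have [jn'|jn'] := ltnP j n; first exact: far_logs.
  by apply: (log_last dyn cj (diag_logs jn)).
case: eqP => [->|ij] /=.
  by rewrite logq_nf_diag logp_nf_diag -apos_logs.
case: eqP => [->|ij1].
  by rewrite logq_nf_next logp_nf_next -apos_logs // -/(b _) step_const.
apply: (logs_far sys); rewrite ?lo_ix ?hi_ix // -val_eqE /= !ix_val //; apply/eqP; lia.
Qed.

Let dyn := system_dynkin.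
Let shh := sh_h_neq0 step_Re.
Let shE := sh_Etail_neq0 sub step_Re.
Let flip := prof_flips h dyn.

Lemma q_jump (m : int) j : (j < n.+1)%N ->
  qq P (ix j.+1) (ix j.+1) ^ m - qq P (ix j.+2) (ix j.+1) ^ m =
  jump (em m) h (apos (prof P h) (a 0) j.+1).
Proof.
move=> jn; rewrite /qq -!em_exp -/(a j) -/(b j) step_const // -apos_logs //.
by rewrite /jump emD mulrBr mulr1.
Qed.

Let jump_neq0 (m : int) v : m != 0 -> jump (em m) h v != 0.
Proof.
move=> m0; rewrite /jump mulf_neq0 ?(mexp_neq0 (emD (R := R) m) (em0 R m)) //.
by rewrite subr_eq0 eq_sym -(sh_neq0 (emD (R := R) m) (em0 R m)); exact: shh.
Qed.

(** Divide [jump_rel] by the step, which is nonzero since [q_21 / q_11] is not of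
   modulus [1]. *)
Lemma system_X k l (m : int) : (k < n.+1)%N -> (l < n.+1)%N -> m != 0 ->
  sXs P (ix k.+1) (ix l.+1) m = Xext (prof P h) h m k.+1 l.+1.
Proof.
move=> kn ln m0; apply: (mulfI (jump_neq0 (apos (prof P h) (a 0) k.+1) m0)).
rewrite -[RHS](row_jump _ _ shh m0 kn ln) -(q_jump m kn).
have := jump_rel sys (ix k.+1) (ix l.+1) m0; rewrite lo_ix // hi_ix // => ->.
by rewrite !(logs_Tq _ system_logs_form) // ltnW.
Qed.

Lemma system_A0 k l : (k < n.+1)%N -> (l < n.+1)%N ->
  hA P (ix k.+1) (ix l.+1) 0 * h = Xext0 (prof P h) h k.+1 l.+1.
Proof.
move=> kn ln; have h2 : 2 * h != 0 by rewrite mulf_neq0 ?pnatr_eq0.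
apply: (mulfI h2); rewrite -[RHS](row_jump0 (prof P h) h (a 0) kn ln) -mulrBl mulrA.
congr (_ * _); rewrite !(logs_Tq0 system_logs_form) //; last exact: ltnW.
have := jump_rel0 sys (ix k.+1) (ix l.+1); rewrite lo_ix // hi_ix // => <-.
by rewrite -/(a k) -/(b k) step_const // [X in _ = X * _]addrAC subrr add0r.
Qed.

(** The product [s_j(m) s_j(-m)] has just been computed, and it does not vanish. *)
Lemma sS_neq0 j (m : int) : (j < n.+1)%N -> m != 0 -> sS P (ix j.+1) m != 0.
Proof.
move=> jn m0; have := chS_prof_neq0 dyn sub step_Re m0 jn.
by rewrite -Xext_diag -system_X // /sXs !mulf_eq0 !negb_or => /andP[/andP[]].
Qed.

(** The first row solves a linear system with the invertible matrix [A(m)], of which the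
   explicit row is a solution. *)
Lemma system_lam1 k : (k < n.+1)%N ->
  lam P (ix 1) (ix k.+1) 0 = yrow0 n (prof P h) h k.+1 /\
  forall m : int, m != 0 ->
    lam P (ix 1) (ix k.+1) m =
    sS P (ix k.+1) m * yrow n (prof P h) h (a 0) m k.+1.
Proof.
move=> kn; have [_ _ Adet] := sys_heis sys; split=> [|m m0].
  apply/eqP; rewrite -subr_eq0; apply/eqP.
  have := nondegenerate (Adet 0) (c := fun j => lam P (ix 1) j 0 -
     yrow0 n (prof P h) h j.+1) _ (ix k.+1).
  rewrite ix_val //; apply=> l; rewrite -[l]ix_ord.
  apply: (mulIf h0); rewrite mul0r.
  under eq_bigr do rewrite mulrBl.
  rewrite sumrB mulrBl; apply/eqP; rewrite subr_eq0; apply/eqP.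
  transitivity (Tq0 (prof P h) h (a 0) 1 l.+1 * h).
    by have [_ _ ->] := sys_coh sys; rewrite (logs_Tq0 system_logs_form).
  rewrite -(lrow0_sum (a 0) flip (Etail_neq0 sub step_Re)) // mulr_suml.
  by apply: eq_bigr => j _; rewrite lrow01 -system_A0 // mulrA (ix_ord j).
apply/eqP; rewrite -subr_eq0; apply/eqP.
have := nondegenerate (Adet m) (c := fun j => lam P (ix 1) j m -
   sS P j m * yrow n (prof P h) h (a 0) m j.+1) _ (ix k.+1).
rewrite ix_val //; apply=> l; rewrite -[l]ix_ord.
have sl0 : sS P (ix l.+1) (- m) != 0 by apply: sS_neq0 => //; rewrite oppr_eq0.
apply: (mulIf sl0); rewrite mul0r.
under eq_bigr do rewrite mulrBl.
rewrite sumrB mulrBl; apply/eqP; rewrite subr_eq0; apply/eqP.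
transitivity (Tq (prof P h) h (a 0) m 1 l.+1).
  by rewrite (logs_Tq _ system_logs_form) //; exact: locality_int.
rewrite -(lrow_sum (a 0) flip shh shE) // mulr_suml.
apply: eq_bigr => j _; rewrite lrow1 -system_X // /sXs (ix_ord j).
by symmetry; exact: swap4.
Qed.

Lemma system_normal_form : normal_form (prof P h) h (a 0) P.
Proof.
split.
- exact: system_logs_form.
- exact: system_X.
- exact: system_A0.
- exact: system_lam1.
- move=> i k i_n kn; have [_ dm d0' _] := sys_diff sys (ix i.+1).
  rewrite lo_ix // hi_ix // in dm d0'; split=> [|m m0].
    have := d0' (ix k.+1); rewrite ix_eq // => e.
    rewrite -[LHS](subrK (lam P (ix i.+1) (ix k.+1) 0)) e addrC; congr (_ + _).
    by case: ifP => // _; rewrite -/(a i) -/(b i) step_const // addrAC subrr add0r.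
  have := dm (ix k.+1) m m0; rewrite ix_eq // => e.
  rewrite -[LHS](subrK (lam P (ix i.+1) (ix k.+1) m)) e addrC; congr (_ + _).
  by case: eqP => // ->; rewrite q_jump.
- move=> i i_n; have [_ _ _] := sys_diff sys (ix i.+1).
  have A0 : hA P (ix i.+1) (ix i.+1) 0 * h = 2 * h - prof P h (@ix n i.+1).+1 -
      prof P h (@ix n i.+1).+2 by rewrite system_A0 // Xext0_diag ix_val.
  by move/(kappa_balance system_logs_form A0); rewrite lo_ix // hi_ix // ix_val.
Qed.

End NormalFormNecessary.

(** * Rescaling *)

Section ScalingAlgebra.
Variable K : fieldType.
Lemma scale_X (x s a y z t : K) : x != 0 -> y * z = 1 ->
  x * s * (x^-1 * a * y) * (z * t) = s * a * t.
Proof.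
move=> x0 yz; rewrite -[s * a * t]mulr1 -yz; have := mulfV x0.
move: (x^-1) => x' xx; rewrite -[RHS]mul1r -xx; ring.
Qed.
Lemma scale_row (c s y x : K) : c * (s * y) * x = x * s * (c * y).
Proof. by ring. Qed.
Lemma scale_jump (c l s j x : K) : c * (l + s * j) * x = c * l * x + x * s * (c * j).
Proof. by ring. Qed.
Lemma mulrA5 (c a b d f g : K) : c * (a * b * d * f * g) = c * a * b * d * f * g.
Proof. by ring. Qed.
Lemma mulr_rev (x a y : K) : x * a * y = y * a * x.
Proof. by ring. Qed.
End ScalingAlgebra.

Section Scaling.
Variables (R : realType) (n : nat) (P : params R n).
Local Notation C := R[i].
Variables (al : 'I_n.+1 -> int -> C) (ls : C).
Hypothesis al_inv : forall j (m : int), m != 0 -> al j m * al j (- m) = 1.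

Definition rescaled := scale_fields al (scale_variables ls (rearrange 1 1 P)).
Local Notation P' := rescaled.

Let al_neq0 j (m : int) : m != 0 -> al j m != 0.
Proof.
move=> m0; apply/eqP => a0; have := al_inv j m0.
by rewrite a0 mul0r => /esym/eqP; rewrite oner_eq0.
Qed.

Lemma rescaled_hA0 k l : hA P' k l 0 = hA P k l 0.
Proof. by rewrite /= invr1 mul1r mulr1 !permE. Qed.

Lemma rescaled_hA k l (m : int) : m != 0 ->
  hA P' k l m = (al k m)^-1 * hA P k l m * al l m.
Proof. by move=> m0; rewrite /= (negPf m0) !permE. Qed.

Lemma rescaled_sS k (m : int) : m != 0 -> sS P' k m = al k m * sS P k m.
Proof. by move=> m0; rewrite /= (negPf m0) !permE. Qed.

Lemma rescaled_sXs k l (m : int) : m != 0 -> sXs P' k l m = sXs P k l m.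
Proof.
move=> m0; rewrite /sXs rescaled_hA // !rescaled_sS ?oppr_eq0 //.
exact: scale_X (al_neq0 k m0) (al_inv l m0).
Qed.

Lemma rescaled_lam i k (m : int) : m != 0 ->
  lam P' i k m = cexp ls ^ m * lam P i k m * al k m.
Proof. by move=> m0; rewrite /= (negPf m0) !permE. Qed.

Lemma rescaled_lam0 i k : lam P' i k 0 = lam P i k 0.
Proof. by rewrite /= expr0z mul1r mulr1 !permE. Qed.

Lemma rescaled_logs i k : logp P' i k = ls + logp P i k /\ logq P' i k = ls + logq P i k.
Proof. by rewrite /= !permE. Qed.

Lemma apos_shift delta (a1 : C) j : apos delta (ls + a1) j = ls + apos delta a1 j.
Proof. by rewrite /apos addrA. Qed.

Lemma rescaled_normal_form delta h a1 :
  normal_form delta h a1 P -> normal_form delta h (ls + a1) P'.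
Proof.
case=> lg X A0 l1 lS g; split.
- move=> i j i_n jn; have := lg i j i_n jn.
  have [-> ->] := rescaled_logs (ix i.+1) (ix j.+1).
  rewrite /logq_nf /logp_nf !apos_shift.
  case: ifP => [_ [-> ->]|_ -> //]; split; case: ifP => _; rewrite !addrA //.
- by move=> k l m kn ln m0; rewrite rescaled_sXs // X.
- by move=> k l kn ln; rewrite rescaled_hA0 A0.
- move=> k kn; have [e0 em'] := l1 k kn; split; first by rewrite rescaled_lam0.
  move=> m m0; rewrite rescaled_lam // rescaled_sS // em' // /yrow (emD m ls a1) (em_exp m ls).
  rewrite scale_row; congr (_ * _); exact: mulrA5.
- move=> i k i_n kn; have [e0 em'] := lS i k i_n kn; split.
    by rewrite !rescaled_lam0.
  move=> m m0; rewrite !rescaled_lam // em' // rescaled_sS //.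
  case: ifP => _; last by rewrite !addr0.
  rewrite /jump apos_shift emD (em_exp m ls) scale_jump.
  by congr (_ + _ * _); exact: mulrA.
- by move=> i i_n; rewrite /= !permE; exact: g.
Qed.

Lemma rescaled_A_sym : (forall k l (m : int), m != 0 -> hA P k l m = hA P l k (- m)) ->
  forall k l (m : int), m != 0 -> hA P' k l m = hA P' l k (- m).
Proof.
move=> Asym k l m m0; rewrite !rescaled_hA ?oppr_eq0 // (Asym k l m m0).
have e j : (al j m)^-1 = al j (- m).
  by apply: (mulfI (al_neq0 j m0)); rewrite mulfV ?al_neq0 // al_inv.
have e' j : (al j (- m))^-1 = al j m by rewrite -e invrK.
rewrite e e'; exact: mulr_rev.
Qed.

End Scaling.

Section DynkinInvariance.
Variables (R : realType) (n : nat) (P P' : params R n).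
Hypothesis A0E : forall k l, hA P' k l 0 = hA P k l 0.

Lemma eq_Jset : Jset P' = Jset P.
Proof. by apply/setP => j; rewrite !inE A0E. Qed.

Lemma eq_Aext k l : Aext P' k l = Aext P k l.
Proof. by rewrite /Aext /A0at /Aat eq_Jset !A0E. Qed.

Lemma eq_prof h i : prof P' h i = prof P h i.
Proof. by rewrite /prof eq_Aext. Qed.

Lemma eq_Ihat d i : Ihat P' d i = Ihat P d i.
Proof. by rewrite /Ihat eq_Aext. Qed.

Lemma eq_rpar : rpar P' = rpar P.
Proof.
have eI d : nIhat P' d = nIhat P d by apply: eq_count => i; exact: eq_Ihat.
by rewrite /rpar !eI /Aat A0E.
Qed.

Lemma eq_dynkin : dynkin P -> dynkin P'.
Proof. by move=> dyn j jn; rewrite !eq_Aext eq_Jset dyn. Qed.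

Lemma eq_subcritical : subcritical P -> subcritical P'.
Proof. by move=> sub j jn; rewrite eq_Aext sub. Qed.
End DynkinInvariance.

(** * The normal form in terms of r and x *)

Section Formulas.
Variables (R : realType) (n : nat) (P : params R n) (r lx : R[i]).
Local Notation C := R[i].
Hypothesis n_gt0 : (0 < n)%N.
Hypothesis r_gt1 : 1 < r.
Hypothesis dich : forall j, (j < n.+2)%N -> I1 P r j.+1 || I2 P r j.+1.
Hypothesis dyn : dynkin P.
Hypothesis sub : subcritical P.
Hypothesis hRe : complex.Re (r * lx) != 0.
Local Notation h := (r * lx).
Local Notation delta := (prof P (r * lx)).
Local Notation D := (D P r).
Local Notation br := (br lx).

Let r_gt0 : 0 < r. Proof. exact: lt_trans ltr01 r_gt1. Qed.
Let r0 : r != 0. Proof. by rewrite gt_eqF. Qed.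

Lemma lx_neq0 : lx != 0.
Proof. by apply: contraNneq hRe => ->; rewrite mulr0. Qed.

Lemma sh_lx_neq0 (m : int) : m != 0 -> sh (em m) lx != 0.
Proof.
move=> m0; have -> : lx = h * r^-1 by rewrite mulrAC mulfV ?mul1r.
by apply: sh_em_neq0; rewrite ?invr_gt0.
Qed.

Lemma sh_r1_neq0 (m : int) : m != 0 -> sh (em m) ((r - 1) * lx) != 0.
Proof.
move=> m0; have -> : (r - 1) * lx = h * ((r - 1) / r).
  by rewrite mulrAC [r * _]mulrC divfK.
by apply: sh_em_neq0 => //; rewrite divr_gt0 // subr_gt0.
Qed.

Lemma prof_I1 j : I1 P r j -> delta j = (r - 1) * lx.
Proof.
rewrite /I1 /Ihat /prof => /andP[_ /eqP ->].
by rewrite mulrAC mulrBr mulr1 mulfV.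
Qed.

Lemma prof_I2 j : I2 P r j -> delta j = lx.
Proof.
rewrite /I2 /Ihat /prof => /andP[_ /eqP ->].
by rewrite mulrAC mulrDr mulr1 [r * (_ / r)]mulrC divfK // addrC subrK mul1r.
Qed.

Lemma prof_if j : (0 < j <= n.+2)%N ->
  delta j = if I1 P r j then (r - 1) * lx else lx.
Proof.
case: j => // j jn; case: ifP => [/prof_I1 //|i1].
by apply: prof_I2; have := dich jn; rewrite i1.
Qed.

(** [D] counts the exponents [(r - 1) log x] and [log x] of the successive quotients
   [q_jj / q_(j-1,j-1)]. *)
Lemma D_lx k l : (l <= n.+1)%N -> D k l * lx = \sum_(k.+1 <= i < l.+2) delta i.
Proof.
move=> ln; rewrite /D -!sum1_count (big_mkcond (I1 P r)) /=.
rewrite (big_mkcond (fun j => I2 P r j && ~~ I1 P r j)) /=.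
rewrite !natr_sum mulr_sumr -big_split mulr_suml /=.
apply: eq_big_nat => i /andP[i1 i2]; rewrite prof_if; last by lia.
have := @dich i.-1; rewrite prednK; last by lia.
move=> /(_ ltac:(lia)); case: (I1 P r i) => /=.
  by move=> _; rewrite andbF mulr1 addr0.
by move=> ->; rewrite mulr0 add0r mul1r.
Qed.

Lemma D_apos j : (0 < j <= n.+1)%N -> D 1 (j - 1) * lx = apos delta 0 j.
Proof.
move=> jn; rewrite D_lx; last by lia.
by rewrite /apos add0r; congr (bigop _ _ _); rewrite subn1 prednK //; lia.
Qed.

Lemma D_tail j : D j n.+1 * lx = Etail n delta j.
Proof. by rewrite D_lx. Qed.

Lemma D_head j : (0 < j <= n.+1)%N ->
  D 0 (j - 1) * lx = Etail n delta 0 - Etail n delta j.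
Proof.
move=> jn; rewrite D_lx; last by lia.
rewrite /Etail [in RHS](big_cat_nat (n := j.+1)) //=; last by lia.
by rewrite addrK subn1 prednK //; lia.
Qed.

Lemma D_00 : D 0 0 * lx = delta 1.
Proof. by rewrite D_lx // big_nat1. Qed.

Lemma D_total : D 0 n.+1 != 0.
Proof.
have : D 0 n.+1 * lx != 0 by rewrite D_tail; exact: Etail_neq0 sub hRe.
by rewrite mulf_eq0 negb_or => /andP[].
Qed.

Lemma br_sh u (m : int) : br (u * m%:~R) = sh (em m) (u * lx) / sh (em 1) lx.
Proof.
rewrite /Defs.br /xpow /sh /em !mul1r !mulN1r mulNr mulrN.
by rewrite -mulrA mulrCA.
Qed.

Lemma br_shZ (m : int) : br m%:~R = sh (em m) lx / sh (em 1) lx.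
Proof. by have := br_sh 1 m; rewrite !mul1r. Qed.

Lemma br_sh1 u : br u = sh (em 1) (u * lx) / sh (em 1) lx.
Proof. by have := br_sh u 1; rewrite mulr1. Qed.

Lemma xpow_em u (m : int) : xpow lx (u * m%:~R) = em m (u * lx).
Proof. by rewrite /xpow /em -mulrA mulrCA. Qed.

Lemma xpow_sh : xpow lx 1 - xpow lx (-1) = sh (em 1) lx.
Proof. by rewrite /xpow /sh /em !mul1r mulN1r. Qed.

Lemma q_diag j : (0 < j <= n.+1)%N -> logq_nf delta h 0 j j = D 1 (j - 1) * lx.
Proof. by move=> jn; rewrite logq_nf_diag D_apos. Qed.

Lemma q_next j : (0 < j <= n.+1)%N ->
  logq_nf delta h 0 j.+1 j = (2 * r + D 1 (j - 1)) * lx.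
Proof. by move=> jn; rewrite logq_nf_next -(D_apos jn) [RHS]mulrDl addrC mulrA. Qed.

Lemma p_first : (I1 P r 1 -> logp_nf delta h 0 1 1 = 2 * lx) /\
  (I2 P r 1 -> logp_nf delta h 0 1 1 = (2 * r - 2) * lx).
Proof.
by rewrite logp_nf_diag apos1; split=> [/prof_I1|/prof_I2] ->; ring.
Qed.

Lemma p_diag j : (2 <= j <= n.+1)%N ->
  (I1 P r j -> logp_nf delta h 0 j j = (D 1 (j - 2) + (r + 1)) * lx) /\
  (I2 P r j -> logp_nf delta h 0 j j = (D 1 (j - 2) + (2 * r - 1)) * lx).
Proof.
case: j => // -[//|j] jn; rewrite logp_nf_diag aposS.
have e : D 1 (j.+2 - 2) * lx = apos delta 0 j.+1.
  by rewrite -D_apos ?subn2 ?subn1 //; lia.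
by split=> [/prof_I1|/prof_I2] ->; rewrite [RHS]mulrDl e; ring.
Qed.

Lemma p_next j : (2 <= j <= n.+2)%N ->
  (I1 P r j -> logp_nf delta h 0 j (j - 1) = (D 1 (j - 2) + (2 * r - 2)) * lx) /\
  (I2 P r j -> logp_nf delta h 0 j (j - 1) = (D 1 (j - 2) + 2) * lx).
Proof.
case: j => // -[//|j] jn; rewrite subn1 /= logp_nf_next.
have e : D 1 (j.+2 - 2) * lx = apos delta 0 j.+1.
  by rewrite -D_apos ?subn2 ?subn1 //; lia.
by split=> [/prof_I1|/prof_I2] ->; rewrite [RHS]mulrDl e; ring.
Qed.

Definition cfac (j : nat) (m : int) : C :=
  if I1 P r j then br m%:~R / br (r * m%:~R)
  else br ((r - 1) * m%:~R) / br (r * m%:~R).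

Lemma div_cancel (K : fieldType) (x y z : K) : z != 0 -> x / z / (y / z) = x / y.
Proof. by move=> z0; rewrite invf_div mulrA divfK. Qed.

Lemma chX_br (m : int) j : m != 0 -> (0 < j <= n.+2)%N ->
  chX (em m) h (delta j) = cfac j m.
Proof.
move=> m0 jn; rewrite /cfac !br_sh br_shZ !div_cancel ?sh_lx_neq0 // /chX prof_if //.
case: ifP => _; last by congr (sh _ _ / _); ring.
by congr (sh _ _ / _); ring.
Qed.

Lemma in_Jset_flip j : (0 < j <= n.+1)%N -> Jhat P j ->
  delta j + delta j.+1 = h.
Proof.
case: j => // j jn; rewrite /Jhat ifT //= => J; rewrite /prof /= dyn // J; ring.
Qed.

Lemma notin_Jset_same j : (0 < j <= n.+1)%N -> ~~ Jhat P j -> delta j.+1 = delta j.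
Proof. by case: j => // j jn; rewrite /Jhat ifT //= /prof /= dyn // => /negPf->. Qed.

Lemma chS_Jhat (m : int) j : (0 < j <= n.+1)%N -> Jhat P j ->
  chS (em m) h (delta j) (delta j.+1) = -1.
Proof. by move=> jn J; apply: chS_flip; exact: in_Jset_flip. Qed.

Lemma frac_four (K : fieldType) (x y z t u : K) : z != 0 -> u != 0 -> t != 0 ->
  x / z * (y * t / z) / (u / z * (t / z)) = x * y / u.
Proof. by move=> z0 u0 t0; field; rewrite z0 u0 t0. Qed.

Lemma sh_double (m : int) d : sh (@em R m) (2 * d) = (em m d + em m (- d)) * sh (em m) d.
Proof. by rewrite mulr_natl mulr2n /sh opprD !(emD (R := R)); ring. Qed.

Lemma chS_br (m : int) j : m != 0 -> (0 < j <= n.+1)%N -> ~~ Jhat P j ->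
  let b (u : C) := br (u * m%:~R) in
  (I1 P r j -> chS (em m) h (delta j) (delta j.+1) =
      - (b 1 * b (2 * (r - 1)) / (b r * b (r - 1)))) /\
  (I2 P r j -> chS (em m) h (delta j) (delta j.+1) =
      - (b (r - 1) * b 2 / (b r * b 1))).
Proof.
move=> m0 jn J b; rewrite notin_Jset_same // (chS_same (emD (R := R) m) (em0 R m) (sh_h_neq0 hRe m0)).
rewrite /b !br_sh; split=> [/prof_I1|/prof_I2] ->; congr (- _).
  have -> : 2 * (r - 1) * lx = 2 * ((r - 1) * lx) by rewrite mulrA.
  rewrite sh_double frac_four ?sh_lx_neq0 ?sh_r1_neq0 ?sh_h_neq0 //.
  by congr (sh _ _ * _ / _); ring.
rewrite sh_double mul1r frac_four ?sh_lx_neq0 ?sh_r1_neq0 ?sh_h_neq0 //.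
by congr (sh _ _ * _ / _); ring.
Qed.

Lemma ratio_head (K : fieldType) (q l d0 d e0 ej : K) : l != 0 -> d0 != 0 ->
  d0 * l = e0 -> d * l = e0 - ej ->
  2 * q * l / d0 * d = - (2 * (q * l) / e0 * ej) + 2 * (q * l).
Proof.
move=> l0 d00 <- e; have -> : ej = d0 * l - d * l by rewrite e opprB addrC subrK.
by field; rewrite l0 d00.
Qed.

Lemma ratio_tail (K : fieldType) (q l d0 d e0 ej : K) : l != 0 -> d0 != 0 ->
  d0 * l = e0 -> d * l = ej -> 2 * q * l / d0 * (- d) = - (2 * (q * l) / e0 * ej).
Proof. by move=> l0 d00 <- <-; field; rewrite l0 d00. Qed.

Lemma lam0_formula i j : (0 < j <= n.+1)%N ->
  2 * r * lx / D 0 n.+1 * (if (j < i)%N then D 0 (j - 1) else - D j n.+1) =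
  lrow0 n delta h i j.
Proof.
move=> jn; rewrite /lrow0 /yrow0; case: ifP => _.
  exact: ratio_head lx_neq0 D_total (D_tail 0) (D_head jn).
rewrite addr0; exact: ratio_tail lx_neq0 D_total (D_tail 0) (D_tail j).
Qed.

Lemma frac_row (K : fieldType) (x y z w s : K) : s != 0 -> y != 0 ->
  x / s * s / (y / s) * (w * (z / s)) = x / y * (w * z).
Proof. by move=> s0 y0; field; rewrite s0 y0. Qed.

Lemma row_split (K : fieldType) (s y w w' z z' J : K) : s != 0 -> y != 0 ->
  - (w * z) - w' * z' = J / s * y -> s / y * (- w * z) = 1 * s * w' / y * z' + J.
Proof.
move=> s0 y0 e; have -> : J = s / y * (J / s * y) by field; rewrite y0 s0.
by rewrite -e; field; rewrite y0.
Qed.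

Lemma apos_Etail j : (0 < j <= n.+1)%N ->
  apos delta 0 j = Etail n delta 0 - Etail n delta j - delta 1.
Proof.
move=> jn; rewrite -D_head // -D_apos // !D_lx; try lia.
by rewrite [in RHS]big_ltn ?[delta 1 + _]addrC ?addrK //; lia.
Qed.

(** For the columns left of the diagonal the first row and the accumulated steps combine
   into a single product, by [branch_jump]. *)
Lemma lam_formula (m : int) i j : m != 0 -> (0 < j <= n.+1)%N ->
  let u : C := m%:~R in
  br (r * u) * (xpow lx 1 - xpow lx (- 1)) / br (D 0 n.+1 * u)
          * (if (j < i)%N
             then - xpow lx ((r + D 1 n.+1) * u) * br (D 0 (j - 1) * u)
             else xpow lx ((r - D 0 0) * u) * br (D j n.+1 * u))
  = lrow n delta h 0 m i j.
Proof.
move=> m0 jn u; rewrite /u !br_sh xpow_sh !xpow_em /lrow /yrow em0.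
have hE : (r + D 1 n.+1) * lx = 0 + h + (Etail n delta 0 - Etail n delta j + Etail n delta j) - delta 1.
  rewrite mulrDl D_tail subrK add0r (@EtailS _ n delta 0) //; ring.
have hd : (r - D 0 0) * lx = h - delta 1 by rewrite mulrBl D_00.
have nzE := sh_Etail_neq0 sub hRe m0; have nzh := sh_h_neq0 hRe m0.
have nz1 := sh_lx_neq0 (m := 1) isT.
rewrite D_tail; case: ifP => _.
  rewrite D_head // frac_row // hE; apply: row_split => //.
  have := branch_jump (emD (R := R) m) (em0 R m) nzh 0 (f := Etail n delta 0 - Etail n delta j)
    (v := Etail n delta j) (delta 1).
  rewrite [_ - _ + _]subrK !add0r => /(_ nzE) ->.
  by rewrite apos_Etail.
rewrite D_tail frac_row // hd addr0 mul1r mulrA; congr (_ * _).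
by rewrite mulrAC.
Qed.

Section Equivalence.
Hypothesis Adiag : forall k (m : int), m != 0 -> hA P k k m = 1.
Hypothesis Asym : forall k l (m : int), m != 0 -> hA P k l m = hA P l k (- m).
Hypothesis Asym0 : forall k l, hA P k l 0 = hA P l k 0.

Lemma solution_pqP : solution_pq P r lx <-> logs_form delta h 0 P.
Proof.
split=> [[H1 H2 H3 H4 H5] i j i_n jn|lg].
  case: eqP => [->|ij] /=.
    split; first by rewrite q_diag //; have [] := H1 j.+1 jn.
    have := dich (ltnW jn); case: j jn i_n => [|j] jn _ /orP[] Ij.
    - by rewrite (p_first.1 Ij) H2.1.
    - by rewrite (p_first.2 Ij) H2.2.
    - by rewrite ((p_diag (j := j.+2) jn).1 Ij) ((H3 j.+2 jn).1 Ij).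
    - by rewrite ((p_diag (j := j.+2) jn).2 Ij) ((H3 j.+2 jn).2 Ij).
  case: eqP => [->|ij1].
    split; first by rewrite q_next //; have [] := H1 j.+1 jn.
    have e1 : (j.+2 - 1 = j.+1)%N by rewrite subn1.
    have := @dich j.+1 jn => /orP[] Ij.
    - have := (p_next (j := j.+2) jn).1 Ij; rewrite e1 => ->.
      by have := (H4 j.+2 jn).1 Ij; rewrite e1.
    - have := (p_next (j := j.+2) jn).2 Ij; rewrite e1 => ->.
      by have := (H4 j.+2 jn).2 Ij; rewrite e1.
  by apply: H5; rewrite ?eqSS //; apply/eqP.
have lgd j : (j < n.+1)%N -> logq P (ix j.+1) (ix j.+1) = logq_nf delta h 0 j.+1 j.+1 /\
    logp P (ix j.+1) (ix j.+1) = logp_nf delta h 0 j.+1 j.+1.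
  by move=> jn; have := lg j j (ltnW jn) jn; rewrite eqxx.
have lgn j : (j < n.+1)%N -> logq P (ix j.+2) (ix j.+1) = logq_nf delta h 0 j.+2 j.+1 /\
    logp P (ix j.+2) (ix j.+1) = logp_nf delta h 0 j.+2 j.+1.
  by move=> jn; have := lg j.+1 j jn jn; rewrite eqxx orbT.
split.
- move=> [//|j] jn; have [-> _] := lgd j jn; have [-> _] := lgn j jn.
  by rewrite q_diag // q_next.
- by have [_ ->] := lgd 0 isT; exact: p_first.
- by move=> [//|j] jn; have [_ ->] := lgd j (proj2 (andP jn)); exact: p_diag.
- move=> [//|[//|j]] jn; have jn' : (j < n.+1)%N by case/andP: jn.
  have e1 : (j.+2 - 1 = j.+1)%N by rewrite subn1.
  have := p_next jn; rewrite e1.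
  by have [_ ->] := lgn j jn'.
- move=> [//|k'] [//|l] kn ln kl kl1; have := lg k' l kn ln.
  by rewrite !eqSS in kl kl1; rewrite (negPf kl) (negPf kl1).
Qed.

Lemma Aext_sym k l : Aext P k l = Aext P l k.
Proof.
rewrite /Aext; case: (eqVneq (k %% n.+2)%N 0%N) => [_|k0].
  by case: (eqVneq (l %% n.+2)%N 0%N).
by case: (eqVneq (l %% n.+2)%N 0%N) => // _; exact: Asym0.
Qed.

Lemma prof_up j : delta j.+1 - h = Aext P j j.+1 * h.
Proof. by rewrite /prof /=; ring. Qed.

Lemma em_opp m (v : C) : em (- m) v = em m (- v).
Proof. by rewrite /em mulrNz mulNr mulrN. Qed.

Lemma chX_opp m d : sh (em m) h != 0 -> chX (em (- m)) h d = chX (em m) h d.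
Proof.
have e (v : C) : sh (em (- m)) v = - sh (em m) v.
  by rewrite /sh !em_opp opprK opprB.
by rewrite /chX !e invrN mulrNN.
Qed.

(** The products [s A s] are even in [m]; on the diagonal this uses the rule for
   consecutive exponents. *)
Lemma Xext_opp (m : int) k l : m != 0 -> (0 < k <= n.+1)%N -> (0 < l <= n.+1)%N ->
  Xext delta h (- m) k l = Xext delta h m k l.
Proof.
move=> m0 kn ln; have hm := sh_h_neq0 hRe m0; rewrite /Xext !chX_opp //.
case: ifP => // _; case: ifP => // _.
have [J|J] := boolP (Jhat P k); first by rewrite !chS_Jhat.
rewrite notin_Jset_same //.
have hm' : sh (em (- m)) h != 0 by apply: sh_h_neq0; rewrite ?oppr_eq0.
rewrite (chS_same (emD (R := R) m) (em0 R m) hm).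
rewrite (chS_same (emD (R := R) (- m)) (em0 R (- m)) hm').
rewrite /sh !em_opp !opprK -[em m (h - _) - _]opprB -[em m h - _]opprB invrN.
by rewrite !mulNr mulrN opprK [em m (- delta k) + _]addrC.
Qed.

Section Charges.
Hypothesis s1 : forall j (m : int), (j < n.+1)%N -> 0 < m -> sS P (ix j.+1) m = 1.
Hypothesis sneg : forall j (m : int), (j < n.+1)%N -> 0 < m ->
  sS P (ix j.+1) (- m) = chS (em m) h (delta j.+1) (delta j.+2).

Lemma s_neq0 j (m : int) : (j < n.+1)%N -> m != 0 -> sS P (ix j.+1) m != 0.
Proof.
move=> jn m0; have [m1|m1] := ltP 0 m; first by rewrite s1 ?oner_eq0.
have m2 : 0 < - m by rewrite oppr_gt0 lt_neqAle m0.
by rewrite -[m]opprK sneg // chS_prof_neq0 // oppr_eq0.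
Qed.

Lemma solution_sP : solution_s P r lx.
Proof.
move=> m [//|j] m0 /= jn.
have m00 : m != 0 by rewrite gt_eqF.
split.
- exact: s1.
- by move=> J; rewrite sneg // chS_Jhat.
- by move=> J Ij; rewrite sneg //; exact: ((chS_br m00 (j := j.+1) jn J).1 Ij).
- by move=> J Ij; rewrite sneg //; exact: ((chS_br m00 (j := j.+1) jn J).2 Ij).
Qed.
End Charges.

Section FromNormalForm.
Hypothesis nf : normal_form delta h 0 P.
Hypothesis s1 : forall j (m : int), (j < n.+1)%N -> 0 < m -> sS P (ix j.+1) m = 1.

Let h_neq0 : h != 0 := profile_neq0 hRe.

Let sneg j (m : int) : (j < n.+1)%N -> 0 < m ->
  sS P (ix j.+1) (- m) = chS (em m) h (delta j.+1) (delta j.+2).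
Proof.
move=> jn m0; have m00 : m != 0 by rewrite gt_eqF.
have := nf_X nf jn jn m00; rewrite /sXs s1 // Adiag // Xext_diag.
by rewrite mul1r mul1r.
Qed.

Let s0 j (m : int) := s_neq0 s1 sneg (j := j) (m := m).

Lemma normal_solution_A : solution_A P r lx.
Proof.
split.
- by move=> j m jn m0; exact: Adiag.
- move=> [//|k] [//|l] m kn ln kl m0.
  have := nf_X nf kn ln m0; rewrite Xext_far; try lia.
  move/eqP; rewrite /sXs !mulf_eq0 (negPf (s0 kn m0)) /=.
  by rewrite (negPf (s0 ln _)) ?oppr_eq0 // orbF => /eqP.
- move=> [//|[//|j]] m jn; rewrite subn1 /= in jn *.
  have jn1 : (j < n.+1)%N by lia.
  have jn2 : (j.+1 < n.+1)%N by lia.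
  have X m' (m0 : m' != 0) : sXs P (ix j.+1) (ix j.+2) m' = cfac j.+2 m'.
    by rewrite (nf_X nf jn1 jn2 m0) Xext_up chX_br // ltnW.
  split=> m0.
    have m00 : m != 0 by rewrite gt_eqF.
    have := X m m00; rewrite /sXs s1 // mul1r /cfac => <-.
    by rewrite mul1r mulfK // s0 // oppr_eq0.
  have m00 : m != 0 by rewrite lt_eqF.
  have := X m m00; rewrite /sXs (s1 jn2) ?oppr_gt0 // mulr1 /cfac => <-.
  by rewrite mul1r mulrC mulKf // s0.
- move=> [//|[//|j]] m jn m0; rewrite subn1 /=.
  have m00 : m != 0 by rewrite gt_eqF.
  by rewrite /Aat -(Asym (ix j.+2) _ m00) -(Asym (ix j.+1) _ m00).
Qed.

Let A0h k l : (k < n.+1)%N -> (l < n.+1)%N -> Aext P k.+1 l.+1 * h = Xext0 delta h k.+1 l.+1.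
Proof. by move=> kn ln; rewrite Aext_in // -(nf_A0 nf kn ln). Qed.

Lemma r_cancel (K : fieldType) (x c y l : K) : y != 0 -> l != 0 ->
  x * (y * l) = c * l -> x = c / y.
Proof.
move=> y0 l0 e; apply: (mulIf (mulf_neq0 y0 l0)); rewrite e mulrA divfK //.
Qed.

Lemma normal_solution_A0 : solution_A0 P r.
Proof.
split.
- move=> [//|i] i_n; have [i_n'|i_n'] := ltnP i n.+1.
    have e := A0h i_n' i_n'; rewrite Xext0_diag in e; split=> J.
    - apply: (mulIf h_neq0); rewrite e -addrA -opprD (in_Jset_flip (j := i.+1) i_n' J).
      by rewrite mul1r mulr_natl mulr2n addrK.
    - move=> /prof_I1 Ij; apply: (r_cancel r0 lx_neq0).
      by rewrite e (notin_Jset_same (j := i.+1) i_n' J) Ij; ring.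
    - move=> /prof_I2 Ij; apply: (r_cancel r0 lx_neq0).
      by rewrite e (notin_Jset_same (j := i.+1) i_n' J) Ij; ring.
  have -> : i = n.+1 by move: i_n; lia.
  have eL : Aext P n.+1 n.+2 = A0at P n.+1.
    by rewrite /Aext modnn eqxx modn_small ?ltnS.
  have e : Aext P n.+2 n.+2 = if odd #|Jset P| then 1 else - 2 * A0at P n.+1.
    by rewrite /Aext modnn.
  rewrite e /Jhat ltnn; split=> [->//|/negPf ->|/negPf ->].
    by rewrite /I1 /Ihat /= eL => /andP[_ /eqP ->]; rewrite mulrNN.
  by rewrite /I2 /Ihat /= eL => /andP[_ /eqP ->]; rewrite mulrA; congr (_ / _); ring.
- move=> [//|j] jn; split; first exact: dich.
    by case/andP=> _ /eqP e; rewrite (Aext_sym j.+1) e.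
  by case/andP=> _ /eqP e; rewrite (Aext_sym j.+1) e.
- move=> k l kl; suff : Aext P k l = 0 by rewrite (Aext_sym l).
  case/orP: kl => kl.
    case: k kl => [//|k] kl; case: l kl => [|l] kl; first by lia.
    have [kn ln] : (k < n.+1)%N /\ (l < n.+1)%N by lia.
    by apply: (mulIf h_neq0); rewrite mul0r A0h // Xext0_far //; lia.
  case/and3P: kl => /eqP -> l1 l2; rewrite /Aext mod0n modn_small /=; last by lia.
  by rewrite /A0at; case: eqP => [|_]; [lia|]; case: eqP => [|_]; [lia|]; case: eqP => //; lia.
- move=> [//|j] /andP[_ jn]; rewrite /Jhat jn; exact: dyn.
Qed.

Lemma normal_solution_lambda : solution_lambda P r lx.
Proof.
move=> [//|i] [//|j] i_n jn; split.
  by rewrite lam0_formula //; exact: (lam_lrow0 nf).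
move=> m m0 u; rewrite /u lam_formula // (lam_lrow nf) //.
by rewrite mulrC mulKf // s0.
Qed.

Lemma normal_solution_g : solution_g P r lx.
Proof.
pose G := gT P (ix 1) * sh (em 1) (h - delta 1).
have gG i : (i < n.+2)%N -> gT P (ix i.+1) * sh (em 1) (h - delta i.+1) = G.
  elim: i => // i IHi i_n; rewrite (@nf_g _ _ _ _ _ _ nf i i_n) IHi //; exact: ltnW.
have nz1 := sh_lx_neq0 (m := 1) isT; have nzr := sh_r1_neq0 (m := 1) isT.
exists (G / sh (em 1) ((r - 1) * lx)) => -[//|i] i_n; have := gG i i_n; split=> Ii.
  rewrite br_sh1 mulrA divfK // -(gG i i_n) (prof_I1 Ii).
  have -> : h - (r - 1) * lx = lx by ring.
  by rewrite mulfK.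
rewrite -(gG i i_n) (prof_I2 Ii).
have -> : h - lx = (r - 1) * lx by ring.
by rewrite mulfK.
Qed.

Lemma normal_solution : solution_form P r lx.
Proof.
split; [exact/solution_pqP/nf_logs|exact: solution_sP|exact: normal_solution_A0|split].
- exact: normal_solution_A.
- exact: normal_solution_lambda.
- exact: normal_solution_g.
Qed.
End FromNormalForm.

Section FromSolution.
Hypothesis sol : solution_form P r lx.

Let s1 j (m : int) : (j < n.+1)%N -> 0 < m -> sS P (ix j.+1) m = 1.
Proof. by case: sol => _ S _ _ jn m0; have [] := S m j.+1 m0 jn. Qed.

Let sneg j (m : int) : (j < n.+1)%N -> 0 < m ->
  sS P (ix j.+1) (- m) = chS (em m) h (delta j.+1) (delta j.+2).
Proof.
case: sol => _ S _ _ jn m0; have m00 : m != 0 by rewrite gt_eqF.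
have [_ S1 S2 S3] := S m j.+1 m0 jn.
have [J|J] := boolP (Jhat P j.+1); first by rewrite S1 // chS_Jhat.
case/orP: (dich (ltnW jn)) => Ij.
  by rewrite S2 //; symmetry; exact: ((chS_br m00 (j := j.+1) jn J).1 Ij).
by rewrite S3 //; symmetry; exact: ((chS_br m00 (j := j.+1) jn J).2 Ij).
Qed.

Let s0 j (m : int) := s_neq0 s1 sneg (j := j) (m := m).

Let X_pos k l (m : int) : (k < n.+1)%N -> (l < n.+1)%N -> 0 < m ->
  sXs P (ix k.+1) (ix l.+1) m = Xext delta h m k.+1 l.+1.
Proof.
case: sol => _ _ _ [[A1 A2 A3 A4] _ _] kn ln m0; have m00 : m != 0 by rewrite gt_eqF.
rewrite /sXs s1 // mul1r.
have up i : (i.+1 < n.+1)%N -> hA P (ix i.+1) (ix i.+2) m * sS P (ix i.+2) (- m) =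
    cfac i.+2 m.
  move=> i_n; have := (A3 i.+2 m i_n).1 m0; rewrite subn1 /= /Aat => ->.
  by rewrite mul1r divfK // s0 // oppr_eq0.
have down i : (i.+1 < n.+1)%N -> hA P (ix i.+2) (ix i.+1) m * sS P (ix i.+1) (- m) =
    cfac i.+2 m.
  move=> i_n; have mN : - m < 0 by rewrite oppr_lt0.
  have mN0 : - m != 0 by rewrite oppr_eq0.
  have := (A3 i.+2 (- m) i_n).2 mN; rewrite subn1 /= /Aat (Asym _ _ m00) => ->.
  rewrite mul1r divfK; last by apply: s0 => //; exact: ltnW.
  rewrite -/(cfac i.+2 (- m)) -!chX_br ?chX_opp ?sh_h_neq0 //; lia.
case: (eqVneq k l) => [<-|kl]; first by rewrite Xext_diag Adiag // mul1r sneg.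
case: (eqVneq k.+1 l) => [e|k1]; first by subst l; rewrite Xext_up up // chX_br //; lia.
case: (eqVneq l.+1 k) => [e|l1]; first by subst k; rewrite Xext_down down // chX_br //; lia.
rewrite Xext_far; try lia.
by have := A2 k.+1 l.+1 m kn ln; rewrite /Aat => -> //; rewrite ?mul0r //; lia.
Qed.

Let lam_row0 i j : (i < n.+2)%N -> (j < n.+1)%N ->
  lam P (ix i.+1) (ix j.+1) 0 = lrow0 n delta h i.+1 j.+1.
Proof.
case: sol => _ _ _ [_ Sl _] i_n jn.
exact: etrans (proj1 (Sl i.+1 j.+1 i_n jn)) (lam0_formula i.+1 (j := j.+1) jn).
Qed.

Let lam_row i j (m : int) : (i < n.+2)%N -> (j < n.+1)%N -> m != 0 ->
  lam P (ix i.+1) (ix j.+1) m = sS P (ix j.+1) m * lrow n delta h 0 m i.+1 j.+1.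
Proof.
case: sol => _ _ _ [_ Sl _] i_n jn m0.
have <- := etrans (proj2 (Sl i.+1 j.+1 i_n jn) m m0)
  (lam_formula i.+1 m0 (j := j.+1) jn).
by rewrite mulrC divfK // s0.
Qed.

Lemma solution_normal : normal_form delta h 0 P.
Proof.
case: sol => Spq _ SA0 [SA Sl Sg]; split.
- exact/solution_pqP.
- move=> k l m kn ln m0; have [m1|m1] := ltP 0 m; first exact: X_pos.
  have m2 : 0 < - m by rewrite oppr_gt0 lt_neqAle m0.
  have mN0 : - m != 0 by rewrite oppr_eq0.
  transitivity (sXs P (ix l.+1) (ix k.+1) (- m)).
    rewrite /sXs opprK (Asym _ _ m0) mulrC [sS P _ m * _]mulrC mulrA //.
  by rewrite X_pos // Xext_opp // Xext_sym.
- case: SA0 => A1 A2 A3 _ k l kn ln.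
  have -> : hA P (ix k.+1) (ix l.+1) 0 = Aext P k.+1 l.+1 by rewrite Aext_in.
  case: (eqVneq k l) => [<-|kl].
    have [B1 B2 B3] := A1 k.+1 (ltnW kn).
    rewrite Xext0_diag; have [J|J] := boolP (Jhat P k.+1).
      by rewrite B1 // mul1r -addrA -opprD (in_Jset_flip (j := k.+1) kn J) mulr_natl mulr2n addrK.
    rewrite (notin_Jset_same (j := k.+1) kn J); case/orP: (dich (ltnW kn)) => Ij.
      by rewrite B2 // (prof_I1 Ij) mulrA divfK //; ring.
    by rewrite B3 // (prof_I2 Ij) mulrA divfK //; ring.
  case: (eqVneq k.+1 l) => [<-|k1]; first by rewrite Xext0_up prof_up.
  case: (eqVneq l.+1 k) => [<-|l1]; first by rewrite Xext0_down prof_up Aext_sym.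
  rewrite Xext0_far; try lia.
  have [kl2|kl2] := leqP (k + 2) l.
    by have [-> _] := A3 k.+1 l.+1 ltac:(lia); rewrite mul0r.
  by have [_ ->] := A3 l.+1 k.+1 ltac:(lia); rewrite mul0r.
- move=> k kn; split; first by rewrite -lrow01; exact: (lam_row0 (i := 0)).
  by move=> m m0; rewrite -lrow1; exact: (lam_row (i := 0)).
- move=> i k i_n kn; split.
    by rewrite !lam_row0 ?lrow0S // ltnW.
  move=> m m0; rewrite (lam_row (i := i.+1) i_n kn m0) (lam_row (i := i) (ltnW i_n) kn m0).
  by rewrite lrowS [LHS]mulrDr; congr (_ + _); case: ifP => _; rewrite ?mulr0.
- case: Sg => g Sg i i_n.
  have gG j : (j < n.+2)%N ->
      gT P (ix j.+1) * sh (em 1) (h - delta j.+1) = g * sh (em 1) ((r - 1) * lx).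
    move=> jn; have [g1 g2] := Sg j.+1 jn; case/orP: (dich jn) => Ij.
      rewrite g1 // br_sh1 (prof_I1 Ij).
      have -> : h - (r - 1) * lx = lx by ring.
      by rewrite mulrA divfK // sh_lx_neq0.
    rewrite g2 // (prof_I2 Ij); congr (_ * sh _ _); ring.
  by rewrite !gG // ltnW.
Qed.
End FromSolution.
End Equivalence.

End Formulas.

(** * The parameter r and the normalisation of the fields *)

Section DynkinParameter.
Variables (R : realType) (n : nat) (P : params R n).
Local Notation C := R[i].
Hypothesis n_gt0 : (0 < n)%N.

Section FromDynkin.
Hypothesis dyn : dynkin P.
Hypothesis sub : subcritical P.
Local Notation b := (Aat P 1 2 0).

Let b12 : Aext P 1 2 = b. Proof. by rewrite Aext_in. Qed.

Let bP : -1 < b < 0. Proof. by rewrite -b12; exact: (sub (j := 1)). Qed.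

Let b0 : b != 0. Proof. by case/andP: bP => _ h; rewrite lt_eqF. Qed.
Let b1_gt0 : 0 < 1 + b.
Proof. by case/andP: bP => h _; rewrite -ltrBlDl sub0r. Qed.

(** As [-1 < A_12(0) < 0], both candidates for [r] are inverses of numbers between [0] and
   [1]. *)
Lemma rpar_gt1 : 1 < rpar P.
Proof.
case/andP: bP => h1 h2; rewrite /rpar; case: ifP => _.
  by rewrite invf_gt1 // gtrDl.
by rewrite -invrN invf_gt1 ?oppr_gt0 // ltrNl.
Qed.

(** Along the diagram the entry either stays or changes to its mirror image. *)
Lemma Aext_two j : (j < n.+2)%N -> Aext P j j.+1 = b \/ Aext P j j.+1 = - 1 - b.
Proof.
have inv (x y : C) : x = - 1 - y -> y = - 1 - x by move=> ->; ring.
elim: j => [_|j IHj jn].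
  have := dyn (ltn0Sn n); rewrite b12; case: ifP => _; last by left.
  by move/inv; right.
rewrite dyn //; case: (IHj (ltnW jn)) => ->; case: ifP => _; try by [left|right].
by left; symmetry; exact: inv.
Qed.

(** Either definition of [r] turns the two possible entries into [-1/r] and
   [(1-r)/r]. *)
Lemma rpar_dichotomy j : (j < n.+2)%N ->
  I1 P (rpar P) j.+1 || I2 P (rpar P) j.+1.
Proof.
move=> jn; rewrite /I1 /I2 /Ihat /= jn /=.
have r0 : rpar P != 0 by rewrite gt_eqF // (lt_trans ltr01 rpar_gt1).
rewrite mulrBl mul1r divff // /rpar; case: ifP => _.
  have -> : (1 + b)^-1^-1 = 1 + b by rewrite invrK.
  have -> : 1 + b - 1 = b by rewrite addrC addKr.
  by rewrite opprD; case: (Aext_two jn) => ->; rewrite eqxx ?orbT.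
have -> : (- b^-1)^-1 = - b by rewrite invrN invrK.
have -> : - b - 1 = - 1 - b by rewrite addrC.
by rewrite opprK; case: (Aext_two jn) => ->; rewrite eqxx ?orbT.
Qed.
End FromDynkin.

Section FromSolutionForm.
Variable r : C.
Hypothesis r_gt1 : 1 < r.
Hypothesis sol : solution_A0 P r.

Lemma solution_dichotomy j : (j < n.+2)%N -> I1 P r j.+1 || I2 P r j.+1.
Proof. by case: sol => _ + _ _ jn => /(_ j.+1 jn) []. Qed.

Lemma solution_dynkin : dynkin P.
Proof. by case: sol => _ _ _ + j jn => /(_ j.+1 jn) ->; rewrite /Jhat jn. Qed.

Lemma solution_subcritical : subcritical P.
Proof.
move=> j jn; have r_gt0 : 0 < r by exact: lt_trans ltr01 r_gt1.
have [ri0 ri1] : 0 < r^-1 /\ r^-1 < 1 by rewrite invr_gt0 invf_lt1.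
case/orP: (solution_dichotomy jn) => /andP[_ /eqP] /= ->.
  by rewrite oppr_lt0 ri0 ltrN2 ri1.
rewrite mulrBl mul1r divff ?gt_eqF // subr_lt0 ri1 andbT.
by rewrite -{1}[- 1]add0r ltrD2r.
Qed.
End FromSolutionForm.
End DynkinParameter.

Lemma heisenberg_sym0 (R : realType) n (A : 'I_n.+1 -> 'I_n.+1 -> int -> R[i]) :
  heisenberg A -> forall k l, A k l 0 = A l k 0.
Proof.
case=> _ A2 _ k l; have [->//|kl] := eqVneq k l.
by rewrite A2 // oppr0.
Qed.

Lemma half_ratio (K : numFieldType) (x r : K) : r != 0 -> x / 2 = r * (x / (2 * r)).
Proof. by move=> r0; field. Qed.

Section Gauge.
Variables (R : realType) (n : nat) (P : params R n).
Local Notation C := R[i].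

(** Free fields normalised by [s_j(m) = 1] for positive [m]. *)
Definition unit_scaling (j : 'I_n.+1) (m : int) : C :=
  if 0 < m then (sS P j m)^-1 else sS P j (- m).

Hypothesis s0 : forall j (m : int), m != 0 -> sS P j m != 0.

Lemma unit_scalingP : field_scaling unit_scaling.
Proof.
move=> j m m0; rewrite /unit_scaling m0 invr_eq0 s0 ?gt_eqF //.
by rewrite oppr_gt0 (lt_gtF m0) opprK invrK.
Qed.

Lemma unit_scaling_inv j (m : int) : m != 0 ->
  unit_scaling j m * unit_scaling j (- m) = 1.
Proof.
move=> m0; rewrite /unit_scaling oppr_gt0; case: (ltgtP m 0) m0 => // m1 _.
  by rewrite mulfV // s0 // oppr_eq0 lt_eqF.
by rewrite opprK mulVf // s0 // gt_eqF.
Qed.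
End Gauge.
Theorem theorem3p1 (R : realType) (M N : nat) (hMN : (1 <= M + N)%N) :
  let n := (M + N)%N in
  let L := n.+1 in
  (forall (P : params R n) (B : currents R n),
     heisenberg (hA P) ->
     mutual_locality P ->
     commutativity P B -> currents_nonzero B ->
     symmetry P ->
     coherent_logs P ->
     injective (fun ij : 'I_n.+2 * 'I_n.+1 => qq P ij.1 ij.2) ->
     (forall j, (1 <= j <= L)%N ->
        `| qq P (ix j.+1) (ix j) / qq P (ix j) (ix j) | != 1) ->
     (forall k, (1 <= k <= L - 1)%N -> - 1 < Aat P k k.+1 0 < 0) ->
     Jset P != finset.set0 ->
     `| cexp (logx P) | < 1 ->
     exists (sigma : {perm 'I_n.+2}) (tau : {perm 'I_n.+1}) (ls : R[i])
            (alpha : 'I_n.+1 -> int -> R[i]),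
       field_scaling alpha /\
       let P' := scale_fields alpha (scale_variables ls (rearrange sigma tau P))
       in solution_form P' (rpar P) (logx P) /\
          forall B' : currents R n,
            commutativity P' B' <->
            (forall j mu e f, B' j mu e f = Bcurrent P' j mu e f))
  /\
  (forall (P : params R n) (lx : R[i]),
     heisenberg (hA P) ->
     Jset P != finset.set0 ->
     1 < rpar P ->
     `| cexp lx | < 1 ->
     solution_form P (rpar P) lx ->
     [/\ mutual_locality P, commutativity P (Bcurrent P) & symmetry P]).
Proof.
move=> n L; have n_gt0 : (0 < n)%N := hMN; split.
- move=> P B heis ml comm Bnz symm coh qinj qnorm crit _ _.
  have loc : locality_eqs P by apply/mutual_localityP.
  have [_ _ Adet] := heis.
  have nec := commutativity_nec loc qinj Adet comm Bnz.
  have [symX _] := (symmetryP P).1 symm.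
  have sys : functional_system P.
    by split=> // J; have [] := nec J.
  have qn := qnorm 1%N isT.
  have cr k : (1 <= k <= n)%N -> - 1 < Aat P k k.+1 0 < 0.
    by move=> kn; apply: crit; rewrite /L subn1.
  have dyn := system_dynkin n_gt0 sys qn.
  have sub := subcritical_ends n_gt0 (Aat_sym sys) cr.
  have nf := system_normal_form n_gt0 sys qn cr.
  have s0 j (m : int) : m != 0 -> sS P j m != 0.
    by move=> m0; rewrite -(ix_ord j); exact: sS_neq0 n_gt0 sys qn cr _ _ _ m0.
  have hRe := step_Re qn.
  pose al := unit_scaling P; pose ls := - logq P (ix 1) (ix 1).
  (* Commutativity already orders the indices. The scaling of the variables moves
     [q_11] to [1], that of the fields moves [s_j(m)] to [1] for positive [m]. *)
  exists 1%g, 1%g, ls, al; split; first exact: unit_scalingP.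
  have al_inv : forall j (m : int), m != 0 -> al j m * al j (- m) = 1 :=
    unit_scaling_inv s0.
  rewrite -/(rescaled P al ls); set P' := rescaled P al ls => /=.
  have A0E := rescaled_hA0 P al ls; rewrite -/P' in A0E.
  have dyn' := eq_dynkin A0E dyn; have sub' := eq_subcritical A0E sub.
  have r1 : 1 < rpar P by rewrite -(eq_rpar A0E); exact: rpar_gt1.
  have dich' := rpar_dichotomy n_gt0 dyn' sub'; rewrite (eq_rpar A0E) in dich'.
  have hE : step P = rpar P * logx P.
    by apply: half_ratio; rewrite gt_eqF // (lt_trans ltr01).
  rewrite hE in hRe nf.
  have nf' : normal_form (prof P' (rpar P * logx P)) (rpar P * logx P) 0 P'.
    have -> : prof P' (rpar P * logx P) = prof P (rpar P * logx P).
      by apply/funext => i; exact: eq_prof.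
    by have := rescaled_normal_form ls al_inv nf; rewrite addNr.
  have A1' k (m : int) : m != 0 -> hA P' k k m = 1.
    have [A1 _ _] := heis; move=> m0; rewrite rescaled_hA // A1 // mulr1 mulVf //.
    apply/eqP => a0; have := al_inv k m m0.
    by rewrite a0 mul0r => /esym/eqP; rewrite oner_eq0.
  have Asym' := rescaled_A_sym ls al_inv (heisenberg_sym heis); rewrite -/P' in Asym'.
  have Asym0' k l : hA P' k l 0 = hA P' l k 0.
    by rewrite !A0E; exact: heisenberg_sym0.
  have s1 j (m : int) : (j < n.+1)%N -> 0 < m -> sS P' (ix j.+1) m = 1.
    move=> jn m0; rewrite rescaled_sS ?gt_eqF // /al /unit_scaling m0 mulVf //.
    by rewrite s0 // gt_eqF.
  split; first exact: normal_solution nf' s1.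
  have flip := prof_flips (rpar P * logx P) dyn'.
  have h0 := profile_neq0 hRe.
  have Et0 := Etail_neq0 sub' hRe.
  have shh := sh_h_neq0 hRe.
  have shE := sh_Etail_neq0 sub' hRe.
  have loc' := normal_form_locality nf' flip h0 Et0 shh shE Asym'.
  have qinj' : injective (fun ij : 'I_n.+2 * 'I_n.+1 => qq P' ij.1 ij.2).
    move=> x y; rewrite /qq !(rescaled_logs P al ls _ _).2 !cexpD.
    by move=> /(mulfI (cexp_neq0 _)); exact: qinj.
  move=> B'; split=> [/(commutativity_unique loc' qinj') //|B'E].
  have -> : B' = Bcurrent P' by do 4!apply/funext => ?; exact: B'E.
  exact: normal_form_commutativity nf' flip h0 Et0 shh shE Asym'.
- move=> P lx heis _ r1 x1 sol.
  have [A1 _ _] := heis; have Asym := heisenberg_sym heis.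
  have SA0 : solution_A0 P (rpar P) by case: sol.
  have dich := solution_dichotomy SA0.
  have dyn := solution_dynkin SA0.
  have sub := solution_subcritical r1 SA0.
  have hRe : complex.Re (rpar P * lx) != 0.
    move: r1 x1; rewrite norm_cexp !ltcE /= => /andP[/eqP r_re r1] /andP[_ x1].
    rewrite mulrC Re_mul_real // mulf_neq0 //; last by rewrite gt_eqF // (lt_trans ltr01).
    by apply: contraTneq x1 => ->; rewrite expR0 ltxx.
  have nf := solution_normal n_gt0 r1 dich dyn sub hRe A1 Asym
    (heisenberg_sym0 heis) sol.
  have flip := prof_flips (rpar P * lx) dyn.
  have h0 := profile_neq0 hRe.
  have Et0 := Etail_neq0 sub hRe.
  have shh := sh_h_neq0 hRe.
  have shE := sh_Etail_neq0 sub hRe.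
  split.
  + exact: normal_form_mutual_locality nf flip h0 Et0 shh shE Asym.
  + exact: normal_form_commutativity nf flip h0 Et0 shh shE Asym.
  + exact: normal_form_symmetry nf.
Qed.
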